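(* Let $c_1,c_2\ge 0$, let $\phi\in S_h^1(D)$, and let $\mathbf u,\mathbf p\in\mathbb R^M$ be the discrete state and the discrete adjoint associated with $\phi$. For an element $\tau_l$ let $\mathbf u_l=[u_{l_1},u_{l_2},u_{l_3}]^\top$, $\mathbf p_l=[p_{l_1},p_{l_2},p_{l_3}]^\top$ and $\hat{\mathbf u}_l=[\hat u_{l_1},\hat u_{l_2},\hat u_{l_3}]^\top$ be the local nodal values of state, adjoint and desired state, and set $$\mathbf k_{0,l}[i,j]=(J_l^{-\top}\nabla_\xi\psi_j)^\top(J_l^{-\top}\nabla_\xi\psi_i),\quad i,j=1,2,3.$$ Write $u_k,p_k,\hat u_k$ for the values of state, adjoint and desired state at $\mathbf x_k$, and $\Delta\alpha=\alpha_1-\alpha_2$, $\Delta\lambda=\lambda_1-\lambda_2$, $\Delta f=f_1-f_2$, $\Delta\tilde\alpha=\tilde\alpha_1-\tilde\alpha_2$. Then the numerical topological-shape derivative $d\mathcal J(\phi)(\mathbf x_k)$ is given as follows. (i) If $\mathbf x_k\in\mathfrak T^-(\phi)$: $$d\mathcal J(\phi)(\mathbf x_k)=-c_1-\Delta\lambda\,\frac{\sum_{l\in I_{\mathbf x_k}}\frac{\mathbf p_l^\top\mathbf k_{0,l}\mathbf u_l\,|\det J_l|}{\phi_{l_2}\phi_{l_3}}}{\sum_{l\in I_{\mathbf x_k}}\frac{|\det J_l|}{\phi_{l_2}\phi_{l_3}}}-\Delta\alpha\,p_ku_k+\Delta f\,p_k-c_2\Delta\tilde\alpha\,(u_k-\hat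 u_k)^2.$$ (ii) If $\mathbf x_k\in\mathfrak T^+(\phi)$: $$d\mathcal J(\phi)(\mathbf x_k)=c_1+\Delta\lambda\,\frac{\sum_{l\in I_{\mathbf x_k}}\frac{\mathbf p_l^\top\mathbf k_{0,l}\mathbf u_l\,|\det J_l|}{\phi_{l_2}\phi_{l_3}}}{\sum_{l\in I_{\mathbf x_k}}\frac{|\det J_l|}{\phi_{l_2}\phi_{l_3}}}+\Delta\alpha\,p_ku_k-\Delta f\,p_k+c_2\Delta\tilde\alpha\,(u_k-\hat u_k)^2.$$ (iii) If $\mathbf x_k\in\mathfrak S(\phi)$: $$d\mathcal J(\phi)(\mathbf x_k)=-c_1+\Delta\lambda\frac{\sum_{l\in C_k}\mathbf p_l^\top\mathbf k_{0,l}\mathbf u_l\,d_ka_l}{d_k\tilde a}+\Delta\alpha\frac{\sum_{l\in C_k}\mathbf p_l^\top d_k\mathbf m_l^I\,\mathbf u_l}{d_k\tilde a}-\Delta f\frac{\sum_{l\in C_k}\mathbf p_l^\top d_k\mathbf f_l^I}{d_k\tilde a}+c_2\Delta\tilde\alpha\frac{\sum_{l\in C_k}(\mathbf u_l-\hat{\mathbf u}_l)^\top d_k\mathbf m_l^I(\mathbf u_l-\hat{\mathbf u}_l)}{d_k\tilde a},$$ where for each $l\in C_k$ the superscript $I\in\{A^\pm,B^\pm,C^\pm\}$ is the cut configuration of $\tau_l$, and $d_ka_l$, $d_k\tilde a$, $d_k\mathbf m_l^I$, $d_k\mathbf f_l^I$ are the explicit quantities given in the context.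
   Context: **Mesh.** $D\subset\mathbb R^2$ is a bounded polygonal domain with a conforming finite element mesh $\mathcal T$ with nodes $\mathbf x_1,\dots,\mathbf x_M$ and (open) triangles $\tau_1,\dots,\tau_N$. $I_{\mathbf x_k}=\{l:\mathbf x_k\in\bar\tau_l\}$; $R_{\mathbf x_k}=\{i:\exists l\in I_{\mathbf x_k},\ \mathbf x_i\in\bar\tau_l\}$ is the one-ring of $\mathbf x_k$ (it contains $k$). $S_h^1(D)$ is the space of continuous functions on $D$ that are affine on each triangle, with hat basis $\varphi_1,\dots,\varphi_M$, $\varphi_i(\mathbf x_j)=\delta_{ij}$. The vertices of $\tau_l$ have indices $l_1,l_2,l_3$ in counter-clockwise order; for $l\in I_{\mathbf x_k}$ the numbering is chosen with $l_1=k$. $J_l=[\mathbf x_{l_2}-\mathbf x_{l_1},\ \mathbf x_{l_3}-\mathbf x_{l_1}]\in\mathbb R^{2\times2}$. Reference shape functions: $\psi_1=1-\xi_1-\xi_2$, $\psi_2=\xi_1$, $\psi_3=\xi_2$. **Level sets and perturbations.** For $\phi\in S_h^1(D)$, $\Omega(\phi)$ is the set where $\phi<0$ ($\phi>0$ on $D\setminus\overline{\Omega(\phi)}$ and $\phi=0$ on $\partial\Omega(\phi)\cap D$). $\mathfrak T^-(\phi)=\{\mathbf x_k:\phi(\mathbf x_i)\le0\ \forall i\in R_{\mathbf x_k}\}$, $\mathfrak T^+(\phi)=\{\mathbf x_k:\phi(\mathbf x_i)\ge0\ \forall i\in R_{\mathbf x_k}\}$, and $\mathfrak S(\phi)$ is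 the set of all remaining nodes. For $\varepsilon>0$ let $O_{k,\varepsilon}\phi=\phi-(\phi(\mathbf x_k)-\varepsilon)\varphi_k$ if $\mathbf x_k\in\mathfrak T^-(\phi)$; $O_{k,\varepsilon}\phi=\phi-(\phi(\mathbf x_k)+\varepsilon)\varphi_k$ if $\mathbf x_k\in\mathfrak T^+(\phi)$; $O_{k,\varepsilon}\phi=\phi+\varepsilon\varphi_k$ if $\mathbf x_k\in\mathfrak S(\phi)$. Let $A\triangle B=(A\setminus\overline B)\cup(B\setminus\overline A)$. **Discrete problem.** Constants $\lambda_1,\lambda_2>0$, $\alpha_1,\alpha_2,\tilde\alpha_1,\tilde\alpha_2\ge0$, $f_1,f_2\in\mathbb R$; $\lambda_\Omega=\lambda_1$ on $\Omega$ and $\lambda_2$ on $D\setminus\Omega$, and similarly $\alpha_\Omega,\tilde\alpha_\Omega,f_\Omega$. With $\Omega=\Omega(\phi)$: $\mathbf A[i,j]=\int_D\lambda_\Omega\nabla\varphi_j\cdot\nabla\varphi_i+\alpha_\Omega\varphi_j\varphi_i\,dx$, $\mathbf f[i]=\int_Df_\Omega\varphi_i\,dx$, $\tilde{\mathbf M}[i,j]=\int_D\tilde\alpha_\Omega\varphi_j\varphi_i\,dx$. The boundary $\partial D$ is split into disjoint $\Gamma_D,\Gamma_N$ (with $\overline{\Gamma_D}\cup\overline{\Gamma_N}=\partial D$), and either $|\Gamma_D|>0$ or $\alpha_1,\alpha_2>0$. The state $\mathbf u$ is the solution of $\mathbf A\mathbf u=\mathbf f$, where Dirichlet data are built in as usual: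 the finite element function of $\mathbf u$ equals $g_D$ on $\Gamma_D$ and the equations are imposed for test functions in $S_h^1(D)$ vanishing on $\Gamma_D$. $\hat{\mathbf u}\in\mathbb R^M$ is the nodal vector of the desired state $\hat u$. The cost is $\mathcal J(\phi)=c_1|\Omega(\phi)|+c_2(\mathbf u-\hat{\mathbf u})^\top\tilde{\mathbf M}(\mathbf u-\hat{\mathbf u})$. The adjoint $\mathbf p$ solves $\mathbf A^\top\mathbf p=-2c_2\tilde{\mathbf M}(\mathbf u-\hat{\mathbf u})$, with finite element function vanishing on $\Gamma_D$ and equations imposed for the same test functions. **Numerical topological-shape derivative.** $$d\mathcal J(\phi)(\mathbf x_k)=\lim_{\varepsilon\searrow0}\frac{\mathcal J(O_{k,\varepsilon}\phi)-\mathcal J(\phi)}{|\Omega(O_{k,\varepsilon}\phi)\triangle\Omega(\phi)|}.$$ **Cut configurations.** $C_k=\{l\in I_{\mathbf x_k}:\tau_l\cap\partial\Omega(O_{k,\varepsilon}\phi)\ne\emptyset\}$ for all sufficiently small $\varepsilon>0$ (independent of $\varepsilon$). With $\tilde\phi_{l_j}=(O_{k,\varepsilon}\phi)(\mathbf x_{l_j})$, element $l\in I_{\mathbf x_k}$ has configuration $A^+$, $B^+$, $C^+$, $A^-$, $B^-$, $C^-$ if the signs of $(\tilde\phi_{l_1},\tilde\phi_{l_2},\tilde\phi_{l_3})$ are respectively $(+,-,-)$, $(-,+,-)$, $(-,-,+)$, $(-,+,+)$, $(+,-,+)$, $(+,+,-)$ (strict signs). Let $I_{\mathbf x_k}^{A_\pm},I_{\mathbf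 x_k}^{B_\pm},I_{\mathbf x_k}^{C_\pm}$ be the corresponding index sets. Standing assumption: every $l\in C_k$ has one of these six configurations; moreover $I_{\mathbf x_k}=I_{\mathbf x_k}^{A_+}$ if $\mathbf x_k\in\mathfrak T^-(\phi)$ and $I_{\mathbf x_k}=I_{\mathbf x_k}^{A_-}$ if $\mathbf x_k\in\mathfrak T^+(\phi)$. Furthermore the denominator $d_k\tilde a$ below is nonzero. **Explicit quantities for $\mathbf x_k\in\mathfrak S(\phi)$.** Write $\phi_{l_j}=\phi(\mathbf x_{l_j})$ and $a=\phi_{l_1}$, $b=\phi_{l_2}$, $c=\phi_{l_3}$; let $\sigma=+1$ for $A^+,B^+,C^+$ and $\sigma=-1$ for $A^-,B^-,C^-$. Then $d_ka_l=\sigma|\det J_l|\frac{a[a(b+c)-2bc]}{2(a-b)^2(a-c)^2}$ for $A^\pm$; $d_ka_l=-\sigma\frac{|\det J_l|}{2}\frac{b^2}{(b-c)(b-a)^2}$ for $B^\pm$; $d_ka_l=-\sigma\frac{|\det J_l|}{2}\frac{c^2}{(c-b)(c-a)^2}$ for $C^\pm$. Set $d_k\tilde a=\sum_{l\in C_k}|d_ka_l|$. $d_k\mathbf m_l^I=|\det J_l|\,\bar m^I$ with $\bar m^I$ symmetric, and $d_k\mathbf f_l^I=|\det J_l|\,\bar f^I$, where: $A^\pm$: $\bar m_{11}=\sigma\frac{a^4(b^3+b^2c+bc^2+c^3)-4ab^3c^3+6a^2b^2c^2(b+c)-4a^3bc(b^2+bc+c^2)}{4(a-b)^4(a-c)^4}$,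 $\bar m_{12}=-\sigma\frac{a^2(3a^2b^2+2a^2bc+a^2c^2-8ab^2c-4abc^2+6b^2c^2)}{12(a-b)^4(a-c)^3}$, $\bar m_{13}=-\sigma\frac{a^2(a^2b^2+2a^2bc+3a^2c^2-4ab^2c-8abc^2+6b^2c^2)}{12(a-b)^3(a-c)^4}$, $\bar m_{22}=\sigma\frac{a^3(3ab+ac-4bc)}{12(a-b)^4(a-c)^2}$, $\bar m_{23}=\sigma\frac{a^3(ab+ac-2bc)}{12(a-b)^3(a-c)^3}$, $\bar m_{33}=\sigma\frac{a^3(ab+3ac-4bc)}{12(a-b)^2(a-c)^4}$; $\bar f_1=-\sigma\frac{a(a^2b^2+a^2bc+a^2c^2-3ab^2c-3abc^2+3b^2c^2)}{3(a-b)^3(a-c)^3}$, $\bar f_2=\sigma\frac{a^2(2ab+ac-3bc)}{6(a-b)^3(a-c)^2}$, $\bar f_3=\sigma\frac{a^2(ab+2ac-3bc)}{6(a-b)^2(a-c)^3}$. $B^\pm$: $\bar m_{11}=-\sigma\frac{b^4}{4(a-b)^4(b-c)}$, $\bar m_{12}=\sigma\frac{b^3(3ab-4ac+bc)}{12(a-b)^4(b-c)^2}$, $\bar m_{13}=\sigma\frac{b^4}{12(a-b)^3(b-c)^2}$, $\bar m_{22}=-\sigma\frac{b^2(3a^2b^2-8a^2bc+6a^2c^2+2ab^2c-4abc^2+b^2c^2)}{12(a-b)^4(b-c)^3}$, $\bar m_{23}=-\sigma\frac{b^3(ab-2ac+bc)}{12(a-b)^3(b-c)^3}$, $\bar m_{33}=-\sigma\frac{b^4}{12(a-b)^2(b-c)^3}$;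 $\bar f_1=\sigma\frac{b^3}{3(a-b)^3(b-c)}$, $\bar f_2=-\sigma\frac{b^2(2ab-3ac+bc)}{6(a-b)^3(b-c)^2}$, $\bar f_3=-\sigma\frac{b^3}{6(a-b)^2(b-c)^2}$. $C^\pm$: $\bar m_{11}=\sigma\frac{c^4}{4(a-c)^4(b-c)}$, $\bar m_{12}=\sigma\frac{c^4}{12(a-c)^3(b-c)^2}$, $\bar m_{13}=\sigma\frac{c^3(3ac-4ab+bc)}{12(a-c)^4(b-c)^2}$, $\bar m_{22}=\sigma\frac{c^4}{12(a-c)^2(b-c)^3}$, $\bar m_{23}=\sigma\frac{c^3(ac-2ab+bc)}{12(a-c)^3(b-c)^3}$, $\bar m_{33}=\sigma\frac{c^2(6a^2b^2-8a^2bc+3a^2c^2-4ab^2c+2abc^2+b^2c^2)}{12(a-c)^4(b-c)^3}$; $\bar f_1=-\sigma\frac{c^3}{3(a-c)^3(b-c)}$, $\bar f_2=-\sigma\frac{c^3}{6(a-c)^2(b-c)^2}$, $\bar f_3=-\sigma\frac{c^2(2ac-3ab+bc)}{6(a-c)^3(b-c)^2}$. *)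

(* Defs.v *)
From HB Require Import structures.
From mathcomp Require Import all_boot all_order all_algebra.
From mathcomp Require Import all_classical all_reals all_analysis.

Set Implicit Arguments.
Unset Strict Implicit.
Unset Printing Implicit Defensive.
Import Order.TTheory GRing.Theory Num.Theory.
Import numFieldNormedType.Exports.

Local Open Scope classical_set_scope.
Local Open Scope ring_scope.

(* Points of the plane are pairs, since the product type carries both the
   product topology and the product measure. *)
Notation pt R := (R * R)%type.

Section Plane.
Variable R : realType.

Definition area (A : set (pt R)) : R :=
  fine ((@lebesgue_measure R \x @lebesgue_measure R)%E A).

Definition integral2 (A : set (pt R)) (f : pt R -> R) : R :=
  Rintegral (@lebesgue_measure R \x @lebesgue_measure R)%E A f.

Definition boundary (A : set (pt R)) : set (pt R) :=
  closure A `\` interior A.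

(* Unlike setY, the closures of the sets are removed. *)
Definition symdiff (A B : set (pt R)) : set (pt R) :=
  (A `\` closure B) `|` (B `\` closure A).

Definition crd (p : pt R) (i : 'I_2) : R := if i == 0 then p.1 else p.2.

Definition gradient (v : pt R -> R) (x : pt R) : 'cV[R]_2 :=
  \col_i 'D_(((i == 0)%:R, (i == 1)%:R) : pt R) v x.

Definition psi (j : 'I_3) (xi : pt R) : R :=
  nth 0 [:: 1 - xi.1 - xi.2; xi.1; xi.2] j.

End Plane.

Record mesh (R : realType) := Mesh {
  nnodes : nat;
  ntris : nat;
  node : 'I_nnodes -> pt R;
  vtx : 'I_ntris -> 'I_3 -> 'I_nnodes }.

Section Mesh.
Variables (R : realType) (T : mesh R).
Implicit Types (k i : 'I_(nnodes T)) (l : 'I_(ntris T)) (j : 'I_3).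

Definition tau l : set (pt R) := [set x | exists t : 'I_3 -> R,
  [/\ forall j, 0 < t j, \sum_j t j = 1
    & x = \sum_j t j *: node (vtx l j)]].

Definition hull (S : pred 'I_(nnodes T)) : set (pt R) :=
  [set x | exists t : 'I_(nnodes T) -> R,
    [/\ forall i, 0 <= t i, forall i, ~~ S i -> t i = 0, \sum_i t i = 1
      & x = \sum_i t i *: node i]].

(* Taking the interior of the union of the closed triangles excludes slits:
   continuity on D then forces a single nodal value at each node. *)
Definition dom : set (pt R) :=
  interior (\bigcup_(l in [set: 'I_(ntris T)]) closure (tau l)).

Definition Jmat (v : 'I_3 -> 'I_(nnodes T)) : 'M[R]_2 :=
  \matrix_(i, j) crd (node (v (lift ord0 j)) - node (v ord0)) i.

Definition conforming_mesh : Prop :=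
  [/\ injective (@node R T),
      forall i, exists l j, vtx l j = i,
      forall l, 0 < \det (Jmat (vtx l)),
      forall l l', l != l' ->
        tau l `&` tau l' = set0 /\
        closure (tau l) `&` closure (tau l') =
          hull [pred i | (i \in codom (vtx l)) && (i \in codom (vtx l'))]
    & connected dom].

Definition tri_patch k : pred 'I_(ntris T) :=
  [pred l | node k \in closure (tau l)].

Definition one_ring k : set 'I_(nnodes T) :=
  [set i | exists2 l, tri_patch k l & closure (tau l) (node i)].

(* Local numbering of tau_l relative to x_k: the cyclic (hence still
   counter-clockwise) renumbering of the vertices whose first vertex is k. *)
Definition lnode k l j : 'I_(nnodes T) :=
  vtx l (j + odflt 0 [pick i | vtx l i == k]).

Definition Jl k l : 'M[R]_2 := Jmat (lnode k l).

Definition k0 k l : 'M[R]_3 := \matrix_(i, j)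
  (((invmx (Jl k l))^T *m gradient (@psi R j) 0)^T *m
   ((invmx (Jl k l))^T *m gradient (@psi R i) 0)) 0 0.

Definition loc k l (u : 'cV[R]_(nnodes T)) : 'cV[R]_3 :=
  \col_j u (lnode k l j) 0.

Definition S1h (v : pt R -> R) : Prop :=
  {within closure dom, continuous v} /\
  forall l, exists a b c : R,
    forall x, tau l x -> v x = a * x.1 + b * x.2 + c.

Definition hat_basis (hat : 'I_(nnodes T) -> pt R -> R) : Prop :=
  forall i, S1h (hat i) /\ forall k, hat i (node k) = (i == k)%:R.

Definition femfun (hat : 'I_(nnodes T) -> pt R -> R)
    (u : 'cV[R]_(nnodes T)) (x : pt R) : R :=
  \sum_i u i 0 * hat i x.

(* Elementwise gradient, extended by 0 to the (null) set of mesh edges. *)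
Definition grad (v : pt R -> R) (x : pt R) : 'cV[R]_2 :=
  if `[< exists l, tau l x >] then gradient v x else 0.

Definition edge l j (t : R) : pt R :=
  (1 - t) *: node (vtx l j) + t *: node (vtx l (j + 1)).

(* Length of a subset of the boundary: sum, over the mesh edges contained in
   the boundary (each belongs to exactly one triangle), of the length of its
   part lying on that edge. *)
Definition bdlength (G : set (pt R)) : \bar R :=
  (\sum_l \sum_(j | `[< forall t : R, (t \in `[0, 1])%R ->
                         boundary dom (edge l j t) >])
    (Num.sqrt (((edge l j 1).1 - (edge l j 0).1) ^+ 2
             + ((edge l j 1).2 - (edge l j 0).2) ^+ 2))%:E *
    @lebesgue_measure R [set t | (t \in `[0, 1])%R /\ G (edge l j t)])%E.

Definition Omega (phi : pt R -> R) : set (pt R) :=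
  [set x | dom x /\ phi x < 0].

Definition Tminus (phi : pt R -> R) : set 'I_(nnodes T) :=
  [set k | forall i, one_ring k i -> phi (node i) <= 0].

Definition Tplus (phi : pt R -> R) : set 'I_(nnodes T) :=
  [set k | forall i, one_ring k i -> 0 <= phi (node i)].

Definition Snodes (phi : pt R -> R) : set 'I_(nnodes T) :=
  ~` (Tminus phi `|` Tplus phi).

(* A node of both Tminus and Tplus (phi = 0 on its one-ring) gets the
   perturbation of Tminus; such nodes violate standing_assumption below. *)
Definition perturb (hat : 'I_(nnodes T) -> pt R -> R) k (e : R)
    (phi : pt R -> R) (x : pt R) : R :=
  if k \in Tminus phi then phi x - (phi (node k) - e) * hat k x
  else if k \in Tplus phi then phi x - (phi (node k) + e) * hat k x
  else phi x + e * hat k x.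

End Mesh.

Record problem (R : realType) (M : nat) := Problem {
  lambda1 : R; lambda2 : R;
  alpha1 : R; alpha2 : R;
  talpha1 : R; talpha2 : R;
  fsrc1 : R; fsrc2 : R;
  c1 : R; c2 : R;
  GammaD : set (pt R); GammaN : set (pt R);
  gD : pt R -> R;
  uhat : 'cV[R]_M }.

Section DiscreteProblem.
Variables (R : realType) (T : mesh R) (P : problem R (nnodes T)).
Variable hat : 'I_(nnodes T) -> pt R -> R.
Implicit Types (Om : set (pt R)) (phi : pt R -> R) (k : 'I_(nnodes T)).

Definition admissible : Prop :=
  [/\ [/\ 0 < lambda1 P & 0 < lambda2 P],
      [/\ 0 <= alpha1 P, 0 <= alpha2 P, 0 <= talpha1 P & 0 <= talpha2 P],
      [/\ 0 <= c1 P & 0 <= c2 P],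
      GammaD P `&` GammaN P = set0 /\
      closure (GammaD P) `|` closure (GammaN P) = boundary (dom T)
    & (0 < bdlength T (GammaD P))%E \/ (0 < alpha1 P /\ 0 < alpha2 P)].

Definition pw Om (v1 v2 : R) (x : pt R) : R := if x \in Om then v1 else v2.

Definition Amx phi : 'M[R]_(nnodes T) := \matrix_(i, j)
  integral2 (dom T) (fun x =>
    pw (Omega T phi) (lambda1 P) (lambda2 P) x
      * ((grad T (hat j) x)^T *m grad T (hat i) x) 0 0
    + pw (Omega T phi) (alpha1 P) (alpha2 P) x * hat j x * hat i x).

Definition fvec phi : 'cV[R]_(nnodes T) := \col_i
  integral2 (dom T) (fun x =>
    pw (Omega T phi) (fsrc1 P) (fsrc2 P) x * hat i x).

Definition Mtmx phi : 'M[R]_(nnodes T) := \matrix_(i, j)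
  integral2 (dom T) (fun x =>
    pw (Omega T phi) (talpha1 P) (talpha2 P) x * hat j x * hat i x).

Definition vanishes_GammaD (v : 'cV[R]_(nnodes T)) : Prop :=
  forall x, GammaD P x -> femfun hat v x = 0.

Definition is_state phi (u : 'cV[R]_(nnodes T)) : Prop :=
  (forall x, GammaD P x -> femfun hat u x = gD P x) /\
  forall v, vanishes_GammaD v -> v^T *m (Amx phi *m u) = v^T *m fvec phi.

Definition is_adjoint phi (u p : 'cV[R]_(nnodes T)) : Prop :=
  vanishes_GammaD p /\
  forall v, vanishes_GammaD v ->
    v^T *m ((Amx phi)^T *m p) =
    v^T *m (- (2 * c2 P) *: (Mtmx phi *m (u - uhat P))).

(* The state is unique; the default 0 is used only when gD is not the trace
   of a finite element function. *)
Definition state phi : 'cV[R]_(nnodes T) := xget 0 [set u | is_state phi u].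

Definition cost phi : R :=
  c1 P * area (Omega T phi) +
  c2 P * ((state phi - uhat P)^T *m Mtmx phi *m (state phi - uhat P)) 0 0.

Definition is_topshape_derivative phi k (d : R) : Prop :=
  (cost (perturb hat k e phi) - cost phi)
    / area (symdiff (Omega T (perturb hat k e phi)) (Omega T phi))
  @[e --> 0^'+] --> d.

End DiscreteProblem.

Inductive cut_shape := shA | shB | shC.

(* A cut configuration: (shA, true) is A^+, (shA, false) is A^-, etc. *)
Definition config := (cut_shape * bool)%type.

Definition config_sign (R : realType) (I : config) : R :=
  if I.2 then 1 else -1.

(* The vertex separated from the two others by the interface. *)
Definition cut_vertex (s : cut_shape) : 'I_3 :=
  match s with shA => 0 | shB => 1 | shC => 2%:R end.

Definition sign_pattern (R : realType) (I : config) (j : 'I_3) : R :=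
  if j == cut_vertex I.1 then config_sign R I else - config_sign R I.

Section ExplicitFormulas.
Variable R : realType.
Variables (I : config) (a b c : R).
Let s : R := config_sign R I.

(* d_k a_l without the factor |det J_l| *)
Definition abar : R :=
  match I.1 with
  | shA => s * (a * (a * (b + c) - 2 * b * c))
             / (2 * (a - b) ^+ 2 * (a - c) ^+ 2)
  | shB => - s * b ^+ 2 / (2 * ((b - c) * (b - a) ^+ 2))
  | shC => - s * c ^+ 2 / (2 * ((c - b) * (c - a) ^+ 2))
  end.

Definition sym3 (m11 m12 m13 m22 m23 m33 : R) : 'M[R]_3 :=
  \matrix_(i, j) nth 0 (nth [::] [:: [:: m11; m12; m13];
                                     [:: m12; m22; m23];
                                     [:: m13; m23; m33]] i) j.

Definition mbar : 'M[R]_3 :=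
  match I.1 with
  | shA => sym3
      (s * (a ^+ 4 * (b ^+ 3 + b ^+ 2 * c + b * c ^+ 2 + c ^+ 3)
            - 4 * a * b ^+ 3 * c ^+ 3
            + 6 * a ^+ 2 * b ^+ 2 * c ^+ 2 * (b + c)
            - 4 * a ^+ 3 * b * c * (b ^+ 2 + b * c + c ^+ 2))
         / (4 * (a - b) ^+ 4 * (a - c) ^+ 4))
      (- s * (a ^+ 2 * (3 * a ^+ 2 * b ^+ 2 + 2 * a ^+ 2 * b * c
                        + a ^+ 2 * c ^+ 2 - 8 * a * b ^+ 2 * c
                        - 4 * a * b * c ^+ 2 + 6 * b ^+ 2 * c ^+ 2))
         / (12 * (a - b) ^+ 4 * (a - c) ^+ 3))
      (- s * (a ^+ 2 * (a ^+ 2 * b ^+ 2 + 2 * a ^+ 2 * b * c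
                        + 3 * a ^+ 2 * c ^+ 2 - 4 * a * b ^+ 2 * c
                        - 8 * a * b * c ^+ 2 + 6 * b ^+ 2 * c ^+ 2))
         / (12 * (a - b) ^+ 3 * (a - c) ^+ 4))
      (s * (a ^+ 3 * (3 * a * b + a * c - 4 * b * c))
         / (12 * (a - b) ^+ 4 * (a - c) ^+ 2))
      (s * (a ^+ 3 * (a * b + a * c - 2 * b * c))
         / (12 * (a - b) ^+ 3 * (a - c) ^+ 3))
      (s * (a ^+ 3 * (a * b + 3 * a * c - 4 * b * c))
         / (12 * (a - b) ^+ 2 * (a - c) ^+ 4))
  | shB => sym3
      (- s * b ^+ 4 / (4 * (a - b) ^+ 4 * (b - c)))
      (s * (b ^+ 3 * (3 * a * b - 4 * a * c + b * c))
         / (12 * (a - b) ^+ 4 * (b - c) ^+ 2))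
      (s * b ^+ 4 / (12 * (a - b) ^+ 3 * (b - c) ^+ 2))
      (- s * (b ^+ 2 * (3 * a ^+ 2 * b ^+ 2 - 8 * a ^+ 2 * b * c
                        + 6 * a ^+ 2 * c ^+ 2 + 2 * a * b ^+ 2 * c
                        - 4 * a * b * c ^+ 2 + b ^+ 2 * c ^+ 2))
         / (12 * (a - b) ^+ 4 * (b - c) ^+ 3))
      (- s * (b ^+ 3 * (a * b - 2 * a * c + b * c))
         / (12 * (a - b) ^+ 3 * (b - c) ^+ 3))
      (- s * b ^+ 4 / (12 * (a - b) ^+ 2 * (b - c) ^+ 3))
  | shC => sym3
      (s * c ^+ 4 / (4 * (a - c) ^+ 4 * (b - c)))
      (s * c ^+ 4 / (12 * (a - c) ^+ 3 * (b - c) ^+ 2))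
      (s * (c ^+ 3 * (3 * a * c - 4 * a * b + b * c))
         / (12 * (a - c) ^+ 4 * (b - c) ^+ 2))
      (s * c ^+ 4 / (12 * (a - c) ^+ 2 * (b - c) ^+ 3))
      (s * (c ^+ 3 * (a * c - 2 * a * b + b * c))
         / (12 * (a - c) ^+ 3 * (b - c) ^+ 3))
      (s * (c ^+ 2 * (6 * a ^+ 2 * b ^+ 2 - 8 * a ^+ 2 * b * c
                      + 3 * a ^+ 2 * c ^+ 2 - 4 * a * b ^+ 2 * c
                      + 2 * a * b * c ^+ 2 + b ^+ 2 * c ^+ 2))
         / (12 * (a - c) ^+ 4 * (b - c) ^+ 3))
  end.

Definition col3 (v1 v2 v3 : R) : 'cV[R]_3 := \col_i nth 0 [:: v1; v2; v3] i.

Definition fbar : 'cV[R]_3 :=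
  match I.1 with
  | shA => col3
      (- s * (a * (a ^+ 2 * b ^+ 2 + a ^+ 2 * b * c + a ^+ 2 * c ^+ 2
                   - 3 * a * b ^+ 2 * c - 3 * a * b * c ^+ 2
                   + 3 * b ^+ 2 * c ^+ 2))
         / (3 * (a - b) ^+ 3 * (a - c) ^+ 3))
      (s * (a ^+ 2 * (2 * a * b + a * c - 3 * b * c))
         / (6 * (a - b) ^+ 3 * (a - c) ^+ 2))
      (s * (a ^+ 2 * (a * b + 2 * a * c - 3 * b * c))
         / (6 * (a - b) ^+ 2 * (a - c) ^+ 3))
  | shB => col3
      (s * b ^+ 3 / (3 * (a - b) ^+ 3 * (b - c)))
      (- s * (b ^+ 2 * (2 * a * b - 3 * a * c + b * c))
         / (6 * (a - b) ^+ 3 * (b - c) ^+ 2))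
      (- s * b ^+ 3 / (6 * (a - b) ^+ 2 * (b - c) ^+ 2))
  | shC => col3
      (- s * c ^+ 3 / (3 * (a - c) ^+ 3 * (b - c)))
      (- s * c ^+ 3 / (6 * (a - c) ^+ 2 * (b - c) ^+ 2))
      (- s * (c ^+ 2 * (2 * a * c - 3 * a * b + b * c))
         / (6 * (a - c) ^+ 3 * (b - c) ^+ 2))
  end.

End ExplicitFormulas.

Section CutElements.
Variables (R : realType) (T : mesh R) (hat : 'I_(nnodes T) -> pt R -> R).
Variables (phi : pt R -> R) (k : 'I_(nnodes T)).
Implicit Types (l : 'I_(ntris T)).

Definition cut_elements : pred 'I_(ntris T) := [pred l | tri_patch k l &&
  `[< \forall e \near 0^'+,
        tau l `&` boundary (Omega T (perturb hat k e phi)) !=set0 >]].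

Definition has_config l (I : config) : Prop :=
  \forall e \near 0^'+, forall j : 'I_3,
    Num.sg (perturb hat k e phi (node (lnode k l j))) = sign_pattern R I j.

Definition phil l (j : 'I_3) : R := phi (node (lnode k l j)).

Variable I : 'I_(ntris T) -> config.

(* I assigns to every cut element its configuration. *)
Definition standing_assumption : Prop :=
  [/\ forall l, l \in cut_elements -> has_config l (I l),
      Tminus phi k -> forall l, l \in tri_patch k -> has_config l (shA, true)
    & Tplus phi k -> forall l, l \in tri_patch k -> has_config l (shA, false)].

Definition dka l : R :=
  `|\det (Jl k l)| * abar (I l) (phil l 0) (phil l 1) (phil l 2%:R).

Definition dkatilde : R := \sum_(l in cut_elements) `|dka l|.

Definition dkm l : 'M[R]_3 :=
  `|\det (Jl k l)| *: mbar (I l) (phil l 0) (phil l 1) (phil l 2%:R).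

Definition dkf l : 'cV[R]_3 :=
  `|\det (Jl k l)| *: fbar (I l) (phil l 0) (phil l 1) (phil l 2%:R).

End CutElements.

(* Main.v *)
(* A nodal perturbation of size e changes the cost J by
     c1 d|Omega| + p^T (dA u_e - df) + c2 (u_e - uh)^T dM (u_e - uh) + c2 w^T M w,
   where dA, df, dM are the increments of the discrete data, u_e is the perturbed
   state and w = u_e - u: testing the adjoint equation with w eliminates the
   linear contribution of w.  The reduced stiffness matrix is invertible, so w is
   of the order of dA and df, and the last term is negligible.

   The data are sums over the elements of moments of products of barycentric
   functions over the part of the element where phi < 0.  This part or its
   complement is a corner of the element, cut at the relative distances
   s = v0/(v0 - v1) and t = v0/(v0 - v2), so the moments are explicit polynomials
   in s and t.  At a node of S(phi) they are differentiable in e, with the bars of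
   the statement as derivatives; at a node of T^-(phi) or T^+(phi) both s and t
   are of order e, the moments are of order e^2, and only the values of the
   barycentric functions at x_k survive. *)

Require Import Defs.
From HB Require Import structures.
From mathcomp Require Import all_boot all_order all_algebra.
From mathcomp Require Import all_classical all_reals all_analysis.
From mathcomp Require Import measurable_realfun ring lra.
Import Order.TTheory GRing.Theory Num.Theory.
Import numFieldNormedType.Exports.
Local Open Scope classical_set_scope.
Local Open Scope ring_scope.

Set Implicit Arguments.
Unset Strict Implicit.
Unset Printing Implicit Defensive.

(** * Planar Lebesgue measure *)

Section AffineMaps.
Variable R : realType.
Local Notation mR := (measurableTypeR R).
Local Notation mu := (@lebesgue_measure R).
Local Notation mu2 := (mu \x mu)%E.

(** All limits come from one 3x3 matrix [m l] per element: the limit of the increments of its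
    moments divided by a scale [h], which is [e] at nodes of S(phi) and [e ^+ 2] at the others. Load
    vector and area are moments against the constant 1, so [m l] determines them too; accordingly
    [fbar] is the row sum of [mbar], and [abar] the total of its entries.

    The denominator is controlled by monotonicity. A perturbed function lies everywhere above or
    everywhere below phi, the sets are nested, and the area of the symmetric difference is plus or
    minus the area increment.

    Three obstacles shape the local part. The interface may pass through x_k, so the corner formulas
    hold under weak inequalities. Six configurations must share one computation, by cyclic
    renumbering. The standing assumption gives no configuration for elements of the patch outside
    C_k, so their moments have to be shown constant for small [e].

    On the global side only a state for phi is given, so the perturbed state has to be constructed,
    by inverting the reduced matrix in a basis of the test space. *)

Lemma measurable_affine (r t : R) :
  measurable_fun [set: mR] (fun x : mR => r * x + t : mR).
Proof.
by apply: measurable_funD => //; apply: measurable_funM.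
Qed.

Lemma preimage_affine_itv (r t a b : R) : r != 0 ->
  (fun x => r * x + t) @^-1` `]a, b] =
  if 0 < r then `]((a - t) / r), ((b - t) / r)]%classic
  else `[((b - t) / r), ((a - t) / r)[%classic.
Proof.
move=> r0; have [rp|rn|/esym/eqP] := ltgtP 0 r; last by rewrite (negbTE r0).
  apply/seteqP; split => x /=; rewrite !in_itv/= ltr_pdivrMr// ler_pdivlMr//;
    rewrite (mulrC x) ltrBlDr lerBrDr //.
apply/seteqP; split => x /=; rewrite !in_itv/= ler_ndivrMr// ltr_ndivlMr//;
  by rewrite (mulrC x) ltrBlDr lerBrDr andbC.
Qed.

(** [|r|] times the pushforward of [mu] agrees with [mu] on half-open intervals, hence on all
    measurable sets. For [r < 0] the preimage of such an interval is closed at the other end, which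
    leaves its length unchanged. *)
Lemma lebesgue_affine (r t : R) (B : set mR) : r != 0 -> measurable B ->
  mu ((fun x => r * x + t) @^-1` B) = ((`|r|^-1)%:E * mu B)%E.
Proof.
move=> r0 mB; pose F (x : mR) : mR := r * x + t.
have mF : measurable_fun setT F by exact: measurable_affine.
have rp : 0 < `|r| by rewrite normr_gt0.
pose pf : {measure set mR -> \bar R} :=
  mscale (NngNum (ltW rp)) (pushforward mu F).
have E : forall A, measurable A -> mu A = pf mF A.
  apply: lebesgue_measure_unique => X /ocitvP[->|]; first by rewrite !measure0.
  case=> -[a b] /= ab ->.
  rewrite lebesgue_measure_itv/= lte_fin ab /pf /mscale/= /pushforward/=.
  rewrite [X in mu X](_ : _ = (fun x => r * x + t) @^-1` `]a, b])//.
  rewrite preimage_affine_itv//; case: ifPn => [r1|].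
    rewrite lebesgue_measure_itv/= lte_fin ltr_pM2r ?invr_gt0// ltrD2r ab.
    by rewrite -!EFinD -EFinM gtr0_norm//; congr (_%:E); field.
  rewrite -leNgt le_eqVlt (negbTE r0)/= => rn.
  rewrite lebesgue_measure_itv/= lte_fin ltr_nM2r ?invr_lt0// ltrD2r ab.
  by rewrite -!EFinD -EFinM ltr0_norm//; congr (_%:E); field.
rewrite (E B mB) /pf /mscale/= /pushforward muleA -EFinM mulVf ?gt_eqF//.
by rewrite mul1e.
Qed.

(** [c] is the absolute Jacobian of [F]. The formulation by preimages composes without any inverse
    of [F]. *)
Definition scales (F : mR * mR -> mR * mR) (c : R) :=
  measurable_fun setT F /\
  forall X, measurable X -> mu2 (F @^-1` X) = ((c^-1)%:E * mu2 X)%E.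

Lemma scales_comp F G c d : scales F c -> scales G d ->
  scales (F \o G) (d * c).
Proof.
move=> [mF HF] [mG HG]; split; first exact: measurableT_comp.
move=> X mX; rewrite comp_preimage HG; last by rewrite -[X in measurable X]setTI; exact: mF.
by rewrite HF// muleA -EFinM invfM.
Qed.

(** Uniqueness of the product measure: [c] times the pushforward agrees with it on rectangles. *)
Lemma scales_rect F c : measurable_fun setT F -> 0 < c ->
  (forall A B, measurable A -> measurable B ->
     mu2 (F @^-1` (A `*` B)) = ((c^-1)%:E * (mu A * mu B))%E) -> scales F c.
Proof.
move=> mF c0 H; split => // X mX.
pose pf : {measure set (mR * mR)%type -> \bar R} :=
  mscale (NngNum (ltW c0)) (pushforward mu2 F).
have E : mu2 X = pf mF X.
  apply: product_measure_unique => // A B mA mB.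
  change (c%:E * mu2 (F @^-1` (A `*` B)) = mu A * mu B)%E.
  by rewrite H// muleA -EFinM mulfV ?gt_eqF// mul1e.
rewrite E /pf /mscale/= /pushforward muleA -EFinM mulVf ?gt_eqF//.
by rewrite mul1e.
Qed.

Definition yaff (c r t : R) (x : mR * mR) : mR * mR :=
  (x.1, r * x.2 + (c * x.1 + t)).
Definition swp (x : mR * mR) : mR * mR := (x.2, x.1).

Lemma scales_swap : scales swp 1.
Proof.
apply: scales_rect => //.
  by apply: measurable_fun_pair.
move=> A B mA mB; rewrite invr1 mul1e.
rewrite (_ : _ @^-1` _ = B `*` A); first by rewrite product_measure1E// muleC.
by apply/seteqP; split => -[x y] /= [].
Qed.

(** Slicing: on each vertical line the map is affine with slope [r]; its offset varies with the line
    but does not affect the measure. *)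
Lemma scales_yaff (c r t : R) : r != 0 -> scales (yaff c r t) `|r|.
Proof.
move=> r0; apply: scales_rect; rewrite ?normr_gt0//.
  apply: measurable_fun_pair => //=.
  apply: measurable_funD; first exact: measurable_funM.
  by apply: measurable_funD => //; apply: measurable_funM.
move=> A B mA mB; rewrite {1}/product_measure1.
rewrite (_ : mu A = \int[mu]_(x in setT) (\1_A x)%:E)%E; last first.
  by rewrite integral_indic// setIT.
have -> : (`|r|^-1%:E * (\int[mu]_(x in setT) (\1_A x)%:E * mu B))%E =
  (\int[mu]_(x in setT) ((\1_A x)%:E * (`|r|^-1%:E * mu B)))%E.
  rewrite ge0_integralZr//.
  - by rewrite muleCA.
  - by apply/measurable_EFinP; exact: measurable_indic.
  - by rewrite mule_ge0// lee_fin invr_ge0.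
apply: eq_integral => x _ /=; rewrite indicE.
have [xA|xA] := boolP (x \in A).
  rewrite mul1e -(@lebesgue_affine r (c * x + t))//; congr (mu _).
  by apply/seteqP; split => y; rewrite /xsection/= inE/=; [case|];
    move/set_mem : xA.
rewrite mul0e [X in mu X](_ : _ = set0) ?measure0//.
apply/seteqP; split => y //; rewrite /xsection/= inE/= => -[xA' _].
by move: xA; rewrite notin_setE.
Qed.

Definition affmap (p a b q c d : R) (x : mR * mR) : mR * mR :=
  (p + a * x.1 + b * x.2, q + c * x.1 + d * x.2).

(* If d <> 0 the map factors through two maps acting on a single coordinate. *)
Lemma scales_affmap (p a b q c d : R) : a * d - b * c != 0 ->
  scales (affmap p a b q c d) `|a * d - b * c|.
Proof.
wlog d0 : p a b q c d / d != 0 => [H|] det0.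
  (* With [d = 0] the entry [b] is nonzero, and exchanging the output coordinates moves it to the
     place of [d]. *)
  have [d0|d0] := eqVneq d 0; last exact: H.
  have b0 : b != 0.
    by apply: contra det0 => /eqP ->; rewrite d0 mulr0 mul0r subrr.
  have D0 : c * b - d * a != 0.
    by rewrite -oppr_eq0 opprB (mulrC d) (mulrC c).
  have := scales_comp scales_swap (H q c d p a b b0 D0).
  rewrite mulr1 -normrN opprB (mulrC d) (mulrC c).
  by congr (scales _ _).
(* The Schur complement of [d]: the coefficient of the first coordinate in the first output, once
   the second coordinate is expressed by the second output. *)
have e0 : a - b * c / d != 0.
  apply: contra det0 => /eqP E; apply/eqP.
  by rewrite -[a](subrK (b * c / d)) E add0r; field.
have := scales_comp scales_swap (scales_comp (scales_yaff (b / d) (p - b * q / d) e0)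
   (scales_comp scales_swap (scales_yaff c q d0))).
rewrite !mulr1 -normrM.
rewrite (_ : d * (a - b * c / d) = a * d - b * c); last by field.
congr (scales _ _); apply: funext => -[x y]; rewrite /affmap /yaff /swp/=.
by congr (_, _); field.
Qed.

End AffineMaps.

(** * Change of variables and the reference triangle *)

Section Integrable.
Context d (T : measurableType d) (R : realType).
Variable m : {measure set T -> \bar R}.

Lemma bounded_integrable (A : set T) (f : T -> R) (M : R) :
  measurable A -> (m A < +oo)%E -> measurable_fun A f ->
  (forall x, A x -> `|f x| <= M) -> m.-integrable A (EFin \o f).
Proof.
move=> mA fA mf fM; apply: measurable_bounded_integrable => //.
exists M; split; first exact: num_real.
by move=> M' MM' x Ax; apply: (le_trans (fM x Ax)); exact: ltW.
Qed.

Lemma integral_mscale_integrable (k : {nonneg R}) (A : set T) (f : T -> \bar R) :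
  measurable A -> m.-integrable A f ->
  (\int[mscale k m]_(x in A) f x = (k%:num)%:E * \int[m]_(x in A) f x)%E.
Proof.
move=> mA intf; have mf := measurable_int m intf.
rewrite [LHS]integralE [in RHS]integralE !ge0_integral_mscale//; last 2 first.
- exact: measurable_funeneg.
- exact: measurable_funepos.
rewrite -muleBr//; apply: fin_num_adde_defr.
exact: integrable_fin_num (integrable_funepos _ _).
Qed.

End Integrable.

Section Change.
Variable R : realType.
Local Notation mR := (measurableTypeR R).
Local Notation mu := (@lebesgue_measure R).
Local Notation mu2 := (mu \x mu)%E.

Lemma scales_Rintegral (F : mR * mR -> mR * mR) (c : R)
    (D : set (mR * mR)) (f : mR * mR -> R) :
  0 < c -> scales F c -> measurable D -> measurable_fun setT f ->
  mu2.-integrable (F @^-1` D) (EFin \o (f \o F)) ->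
  mu2.-integrable D (EFin \o f) /\
  Rintegral mu2 D f = c * Rintegral mu2 (F @^-1` D) (f \o F).
Proof.
move=> c0 [mF sF] mD mf intf.
have mef : measurable_fun setT (EFin \o f) by exact/measurable_EFinP.
have ipf := integrable_pushforward mF mef intf mD.
have ci : 0 <= c^-1 by rewrite invr_ge0 ltW.
have E A : measurable A -> A `<=` D ->
    pushforward mu2 F A = mscale (NngNum ci) mu2 A.
  by move=> mA _; rewrite /pushforward sF.
have intfD : mu2.-integrable D (EFin \o f).
  have /integrableP[m1 m2] := ipf.
  apply/integrableP; split; first exact: measurable_funTS.
  rewrite (eq_measure_integral (mscale (NngNum ci) mu2))// in m2.
  rewrite ge0_integral_mscale// in m2; last first.
    by apply: measurableT_comp => //; exact: measurable_funTS.
  rewrite /= in m2; set J := integral _ _ _ in m2 *.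
  (* [J] could still be infinite here; only its multiple by [c^-1] is known to be finite. *)
  rewrite (_ : J = c%:E * (c^-1%:E * J))%E; last first.
    by rewrite muleA -EFinM mulfV ?mul1e ?gt_eqF.
  by rewrite lte_mul_pinfty// lee_fin ltW.
split => //.
rewrite /Rintegral.
have <- := integral_pushforward mF mef intf mD.
rewrite (eq_measure_integral (mscale (NngNum ci) mu2) E).
have -> := integral_mscale_integrable (NngNum ci) mD intfD.
have := integrable_fin_num mD intfD.
case: (integral _ _ _) => // r _.
by rewrite -EFinM/= mulrA mulfV ?mul1r ?gt_eqF.
Unshelve. all: exact: mF.
Qed.

Lemma poly_Rintegral (p q : {poly R}) (a b : R) : a < b -> q = p^`() ->
  mu.-integrable `]a, b[ (EFin \o horner q) /\
  Rintegral mu `]a, b[ (horner q) = p.[b] - p.[a].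
Proof.
move=> ab qE.
have cq : {within `[a, b], continuous (horner q)}.
  by apply: continuous_subspaceT => x; exact: continuous_horner.
have ic : mu.-integrable `[a, b] (EFin \o horner q).
  by apply: continuous_compact_integrable => //; exact: segment_compact.
have io A : measurable A -> A `<=` `[a, b] -> mu.-integrable A (EFin \o horner q).
  by move=> mA sA; exact: integrableS ic.
split; first by apply: io => //; exact: subset_itv_oo_cc.
rewrite Rintegral_itv_obnd_cbnd; last first.
  by apply: io => //; exact: subset_itv_oo_cc.
rewrite Rintegral_itv_bndo_bndc; last first.
  by apply: io => //; exact: subset_itv_co_cc.
rewrite /Rintegral (@continuous_FTC2 _ _ (horner p))//.
  split; first by move=> x _; exact: derivable_horner.
  - by apply: cvg_at_right_filter; exact: continuous_horner.
  - by apply: cvg_at_left_filter; exact: continuous_horner.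
by move=> x _; rewrite -derivE -qE.
Qed.

Lemma measurable_lt_set (f g : mR * mR -> R) :
  measurable_fun setT f -> measurable_fun setT g -> measurable [set x | f x < g x].
Proof.
move=> mf mg; rewrite -[X in measurable X]setTI.
exact: (measurable_fun_ltr mf mg measurableT (_ : measurable [set true])).
Qed.

Definition refT : set (pt R) := [set x | [/\ 0 < x.1, 0 < x.2 & x.1 + x.2 < 1]].

(** The shape of a product of two affine functions pulled back to the reference triangle. *)
Definition quad (q0 q1 q2 q11 q12 q22 : R) (x : mR * mR) : R :=
  q0 + q1 * x.1 + q2 * x.2 + q11 * x.1 ^+ 2 + q12 * (x.1 * x.2) + q22 * x.2 ^+ 2.

Lemma measurable_quad q0 q1 q2 q11 q12 q22 :
  measurable_fun setT (quad q0 q1 q2 q11 q12 q22).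
Proof.
by repeat first [exact: measurable_cst | exact: measurable_fst
  | exact: measurable_snd | apply: measurable_funD | apply: measurable_funM
  | apply: measurable_funX].
Qed.

Lemma measurable_refT : measurable (refT : set (mR * mR)).
Proof.
rewrite (_ : refT = [set x : mR * mR | 0 < x.1] `&` [set x | 0 < x.2] `&`
   [set x | x.1 + x.2 < 1]); last first.
  by apply/seteqP; split => x /= => [[]|[[]]].
apply: measurableI; first by apply: measurableI; exact: measurable_lt_set.
by apply: measurable_lt_set => //; exact: measurable_funD.
Qed.

Lemma refT_bounded x : refT x -> [/\ `|x.1| <= 1 & `|x.2| <= 1].
Proof. by case: x => x y [/= x0 y0 xy]; rewrite !gtr0_norm//; split; lra. Qed.

Lemma refT_lty : (mu2 refT < +oo)%E.
Proof.
apply: (@le_lt_trans _ _ (mu2 (`[0%R, 1%R] `*` `[0%R, 1%R]))).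
  apply: le_measure; rewrite ?inE.
  - exact: measurable_refT.
  - by apply: measurableX.
  by move=> [x y] [/= x0 y0 xy]; rewrite !in_itv/=; split; apply/andP; split; lra.
by rewrite product_measure1E//= lebesgue_measure_itv/= lte_fin ltr01 -!EFinB -EFinM ltry.
Qed.

Lemma integrable_refT q0 q1 q2 q11 q12 q22 :
  mu2.-integrable refT (EFin \o quad q0 q1 q2 q11 q12 q22).
Proof.
apply: (@bounded_integrable _ _ _ _ _ _
   (`|q0| + `|q1| + `|q2| + `|q11| + `|q12| + `|q22|)).
- exact: measurable_refT.
- exact: refT_lty.
- by apply: measurable_funTS; exact: measurable_quad.
move=> x /refT_bounded[x1 x2]; rewrite /quad.
have H (a b : R) : `|b| <= 1 -> `|a * b| <= `|a|.
  by move=> b1; rewrite normrM ler_piMr.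
have K (a b c e : R) : `|a| <= c -> `|b| <= e -> `|a + b| <= c + e.
  by move=> h1 h2; apply: (le_trans (ler_normD _ _)); exact: lerD.
do 3 (apply: (K _ _ _ _ _ _); last by apply: (H _ _ _);
  rewrite ?normrX ?normrM ?expr_le1 ?mulr_ile1).
by do 2 (apply: (K _ _ _ _ _ _); last by apply: (H _ _ _)).
Qed.

Lemma divZMn (c : R) (n : nat) (p : {poly R}) :
  (c / n.+1%:R) *: (p *+ n.+1) = c *: p.
Proof. by rewrite -(scaler_nat _ p) scalerA divfK// pnatr_eq0. Qed.

Lemma Rintegral_refT q0 q1 q2 q11 q12 q22 :
  Rintegral mu2 refT (quad q0 q1 q2 q11 q12 q22) =
  q0 / 2 + (q1 + q2) / 6 + (q11 + q22) / 12 + q12 / 24.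
Proof.
set f := quad _ _ _ _ _ _.
rewrite Rintegral_mkcond /Rintegral.
rewrite -integral12_prod_meas1; last first.
  rewrite (_ : (fun x => ((f \_ refT) x)%:E) = (EFin \o f) \_ refT).
    apply: (proj1 (integrable_mkcond (EFin \o f) measurable_refT)).
    exact: integrable_refT.
  by rewrite restrict_EFin.
(* [g0] to [g3] are the coefficients of the inner integral over [0 < y < 1 - x], as a polynomial [G]
   in [x]; [H] is the antiderivative of [G] that vanishes at 0. *)
pose g0 := q0 + q2 / 2 + q22 / 3.
pose g1 := q1 - q0 + (q12 - 2 * q2) / 2 - q22.
pose g2 := q11 - q1 + (q2 - 2 * q12) / 2 + q22.
pose g3 := - q11 + q12 / 2 - q22 / 3.
pose G : {poly R} := g0%:P + g1 *: 'X + g2 *: 'X^2 + g3 *: 'X^3.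
pose H : {poly R} := g0 *: 'X + (g1 / 2) *: 'X^2 + (g2 / 3) *: 'X^3 + (g3 / 4) *: 'X^4.
have GH : G = H^`().
  by rewrite /G /H !derivD !derivZ !derivXn derivX !divZMn alg_polyC.
transitivity (fine (\int[mu]_x ((horner G \_ `]0, 1[) x)%:E)%E).
  congr fine; apply: eq_integral => x _; rewrite /fubini_F [in RHS]patchE.
  case: ifPn => [|/negP x01]; last first.
    apply: integral0_eq => y _; rewrite patchE ifN//; apply/negP.
    by rewrite inE => -[/= x0 y0 xy]; apply: x01; rewrite inE/= in_itv/=; lra.
  rewrite inE/= in_itv/= => /andP[x0 x1].
  pose p : {poly R} := (q0 + q1 * x + q11 * x ^+ 2) *: 'X
     + ((q2 + q12 * x) / 2) *: 'X^2 + (q22 / 3) *: 'X^3.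
  have [_] := @poly_Rintegral p _ 0 (1 - x) ltac:(lra) erefl.
  rewrite Rintegral_mkcond.
  have [+ _] := @poly_Rintegral p _ 0 (1 - x) ltac:(lra) erefl.
  move=> ip e.
  transitivity (\int[mu]_y ((horner p^`() \_ `]0, (1 - x)[) y)%:E)%E.
    apply: eq_integral => y _; congr (_%:E); rewrite !patchE.
    have -> : ((x, y) \in refT) = (y \in `]0, (1 - x)[%classic).
      apply/idP/idP; rewrite !inE/= in_itv/=; first by case => /= *; lra.
      by case/andP => *; split => /=; lra.
    case: ifPn => // _; rewrite /f /quad /p /=.
    by rewrite !derivD !derivZ !derivXn derivX !divZMn !hornerE/=; ring.
  rewrite -[LHS]fineK; last first.
    apply: integrable_fin_num => //.
    rewrite -[X in _.-integrable _ X]/(EFin \o _) -restrict_EFin.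
    exact: (proj1 (@integrable_mkcond _ mR R mu _ (EFin \o horner p^`()) (measurable_itv _)) ip).
  congr (_%:E); rewrite /Rintegral in e; rewrite e /p /G !hornerE.
  by rewrite /= /g0 /g1 /g2 /g3; field.
have [_] := poly_Rintegral ltr01 GH.
rewrite Rintegral_mkcond /Rintegral => ->.
by rewrite /H !hornerE/= /g0 /g1 /g2 /g3; field.
Qed.

End Change.

Lemma sum3 (V : nmodType) (F : 'I_3 -> V) : \sum_j F j = F 0 + F 1 + F 2%:R.
Proof.
rewrite 3!big_ord_recl big_ord0 addr0 addrA.
by congr (F _ + F _ + F _); apply: val_inj.
Qed.

Lemma forall3 (Q : 'I_3 -> Prop) : Q 0 -> Q 1 -> Q 2%:R -> forall j, Q j.
Proof.
move=> q0 q1 q2 [[|[|[|//]]] h]; [move: q0|move: q1|move: q2];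
  by congr Q; apply: val_inj.
Qed.

Lemma ptE (R : realType) :
  (forall p q : pt R, ((p + q).1 = p.1 + q.1) * ((p + q).2 = p.2 + q.2)) *
  (forall p : pt R, ((- p).1 = - p.1) * ((- p).2 = - p.2)) *
  (forall (a : R) (p : pt R), ((a *: p).1 = a * p.1) * ((a *: p).2 = a * p.2)).
Proof. by []. Qed.

(** * Triangles and their corners *)

Section Triangle.
Variable R : realType.
Implicit Types (P : 'I_3 -> pt R) (x : pt R) (v w : 'I_3 -> R).

Definition det3 P : R :=
  (P 1 - P 0).1 * (P 2%:R - P 0).2 - (P 2%:R - P 0).1 * (P 1 - P 0).2.

(** The argument of [psi] is the preimage of [x] under the affine map from the reference triangle
    onto [P], by Cramer's rule. *)
Definition bary P (j : 'I_3) x : R :=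
  psi j (((P 2%:R - P 0).2 * (x - P 0).1 - (P 2%:R - P 0).1 * (x - P 0).2) / det3 P,
         ((P 1 - P 0).1 * (x - P 0).2 - (P 1 - P 0).2 * (x - P 0).1) / det3 P).

Definition interp P v x : R := \sum_j v j * bary P j x.

Definition tri P : set (pt R) := [set x | exists t : 'I_3 -> R,
  [/\ forall j, 0 < t j, \sum_j t j = 1 & x = \sum_j t j *: P j]].

Lemma sum_bary P x : \sum_j bary P j x = 1.
Proof. by rewrite sum3 /bary /psi/=; ring. Qed.

Lemma bary_comb P (t : 'I_3 -> R) j : det3 P != 0 -> \sum_j t j = 1 ->
  bary P j (\sum_j t j *: P j) = t j.
Proof.
(* Eliminating [t 0] by the constraint leaves an identity of rational functions. *)
rewrite sum3 => D0 t1; have {t1} -> : t = fun j => if j == 0 then 1 - t 1 - t 2%:R else t j.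
  by apply: funext; apply: forall3 => //=; rewrite -t1; ring.
rewrite sum3/=; move: D0; rewrite /bary /det3 !ptE; move: j.
by apply: forall3; rewrite /psi/= => D0; field.
Qed.

Lemma comb_bary P x : det3 P != 0 -> x = \sum_j bary P j x *: P j.
Proof.
rewrite sum3 /bary /det3/psi/= => D0.
rewrite [LHS]surjective_pairing [RHS]surjective_pairing !ptE.
by congr (_, _); field.
Qed.

Lemma triE P : det3 P != 0 -> tri P = [set x | forall j, 0 < bary P j x].
Proof.
move=> D0; apply/seteqP; split => x /=.
  by case=> t [t0 t1 ->] j; rewrite bary_comb.
by move=> h; exists (bary P ^~ x); split; [|exact: sum_bary|exact: comb_bary].
Qed.


Lemma bary_vertex P i j : det3 P != 0 -> bary P j (P i) = (i == j)%:R.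
Proof.
move=> D0; rewrite -[RHS](@bary_comb P (fun j => (i == j)%:R))//; last first.
  by rewrite (bigD1 i)//= eqxx big1 ?addr0// => k /negbTE; rewrite eq_sym => ->.
congr bary; rewrite (bigD1 i)//= eqxx scale1r big1 ?addr0// => k /negbTE.
by rewrite eq_sym => ->; rewrite scale0r.
Qed.

Lemma interp_vertex P v i : det3 P != 0 -> interp P v (P i) = v i.
Proof.
move=> D0; rewrite /interp (bigD1 i)//= bary_vertex// eqxx mulr1.
by rewrite big1 ?addr0// => k /negbTE; rewrite bary_vertex// eq_sym => ->; rewrite mulr0.
Qed.

Lemma interpE P v : exists a b c : R, forall x, interp P v x = a * x.1 + b * x.2 + c.
Proof.
pose a := ((v 1 - v 0) * (P 2%:R - P 0).2 - (v 2%:R - v 0) * (P 1 - P 0).2) / det3 P.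
pose b := ((v 2%:R - v 0) * (P 1 - P 0).1 - (v 1 - v 0) * (P 2%:R - P 0).1) / det3 P.
exists a, b, (v 0 - a * (P 0).1 - b * (P 0).2) => x.
rewrite /interp sum3 /bary /psi/= /a /b.
by move: (det3 P)^-1 => D; ring.
Qed.

Lemma affine_interp Q (f : pt R -> R) a b c : det3 Q != 0 ->
  (forall x, f x = a * x.1 + b * x.2 + c) -> forall x, f x = interp Q (f \o Q) x.
Proof.
move=> D0 fE x; rewrite {1}(comb_bary x D0) fE /interp !sum3 !ptE /= !fE.
have := sum_bary Q x; rewrite sum3 => s1.
rewrite -[c in LHS]mulr1 -s1; ring.
Qed.

(** An affine function is the interpolant of its values on any nondegenerate triangle. This
    transports functions from [P] to a corner of [P] and to a renumbering of its vertices. *)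
Lemma interp_interp P Q v x : det3 Q != 0 ->
  interp P v x = interp Q (interp P v \o Q) x.
Proof.
move=> D0; have [a [b [c E]]] := interpE P v.
exact: affine_interp D0 E x.
Qed.

Lemma bary_interp P j : bary P j = interp P (fun i => (i == j)%:R).
Proof.
apply: funext => x; rewrite /interp (bigD1 j)//= eqxx mul1r big1 ?addr0// => k /negbTE->.
by rewrite mul0r.
Qed.

Lemma continuous_affine (a b c : R) : continuous (fun x : pt R => a * x.1 + b * x.2 + c).
Proof.
move=> x; apply: cvgD; last exact: cvg_cst.
by apply: cvgD; apply: cvgM; [exact: cvg_cst|exact: cvg_fst|exact: cvg_cst|exact: cvg_snd].
Qed.

Lemma continuous_interp P v : continuous (interp P v).
Proof.
have [a [b [c E]]] := interpE P v.
by rewrite (funext E); exact: continuous_affine.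
Qed.

Lemma continuous_bary P j : continuous (bary P j).
Proof. by rewrite bary_interp; exact: continuous_interp. Qed.

Lemma measurable_interp P v :
  measurable_fun setT (interp P v : measurableTypeR R * measurableTypeR R -> R).
Proof.
have [a [b [c E]]] := interpE P v; rewrite (funext E).
apply: measurable_funD => //.
by apply: measurable_funD; apply: measurable_funM.
Qed.

Lemma measurable_bary P j :
  measurable_fun setT (bary P j : measurableTypeR R * measurableTypeR R -> R).
Proof. by rewrite bary_interp; exact: measurable_interp. Qed.

End Triangle.

Section TriangleMeasure.
Variable R : realType.
Local Notation mR := (measurableTypeR R).
Local Notation mu := (@lebesgue_measure R).
Local Notation mu2 := (mu \x mu)%E.
Implicit Types (P Q : 'I_3 -> pt R) (x : pt R) (v w f g : 'I_3 -> R).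

Lemma set_forall3 (A : 'I_3 -> set (pt R)) :
  [set x | forall j, A j x] = A 0 `&` A 1 `&` A 2%:R.
Proof.
apply/seteqP; split => x /= => [h|[[a0 a1] a2]]; first by [].
exact: (forall3 a0 a1 a2).
Qed.

Lemma open_tri P : det3 P != 0 -> open (tri P).
Proof.
move=> D0; rewrite triE// (set_forall3 (fun j => [set x | 0 < bary P j x])).
have H j : open [set x | 0 < bary P j x].
  apply: (open_comp (D := [set r : R | 0 < r])); last exact: open_gt.
  by move=> x _; exact: continuous_bary.
by apply: openI => //; exact: openI.
Qed.

Lemma closure_tri P : det3 P != 0 ->
  closure (tri P) = [set x | forall j, 0 <= bary P j x].
Proof.
move=> D0; apply/seteqP; split => x.
  move=> cx j; have : closed [set x | 0 <= bary P j x].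
    apply: (closed_comp (D := [set r : R | 0 <= r])); last exact: closed_ge.
    by move=> y _; exact: continuous_bary.
  apply; move: cx; apply: closure_subset => y.
  by rewrite triE// => /(_ j)/ltW.
move=> x0 B Bx.
(* [c] runs from [x] towards the centroid: a barycentric coordinate that vanishes at [x] becomes
   positive at once. *)
pose c (e : R) := (1 - e) *: x + e *: (\sum_j (3^-1 : R) *: P j).
have c3 : \sum_(j < 3) (3^-1 : R) = 1 by rewrite sum3; field.
have bc e j : bary P j (c e) = (1 - e) * bary P j x + e / 3.
  rewrite /c {1}(comb_bary x D0) !scaler_sumr -big_split/=.
  under eq_bigr do rewrite !scalerA -scalerDl.
  rewrite bary_comb// big_split/= -!mulr_sumr sum_bary c3; ring.
have cc : c e @[e --> 0^'+] --> x.
  have -> : x = c 0 by rewrite /c subr0 scale1r scale0r addr0.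
  apply: cvg_at_right_filter.
  apply: cvgD; apply: cvgZr_tmp; last exact: cvg_id.
  by apply: cvgB; [exact: cvg_cst|exact: cvg_id].
have : \forall e \near 0^'+, B (c e) by exact: cc.
move=> nB; near (0 : R)^'+ => e.
exists (c e); split; last by near: e.
have e0 : 0 < e by near: e; exact: nbhs_right_gt.
have e1 : e < 1 by near: e; exact: nbhs_right_lt.
rewrite triE// => j; rewrite bc; have := x0 j.
by move=> h; rewrite ltr_wpDl ?mulr_ge0 ?subr_ge0 ?(ltW e1) ?divr_gt0.
Unshelve. all: by end_near. Qed.

Lemma measurable_eq0 (f : mR * mR -> R) : measurable_fun setT f ->
  measurable [set x | f x = 0].
Proof.
move=> mf; rewrite -[X in measurable X]setTI.
exact: (mf measurableT _ (measurable_set1 0)).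
Qed.

Lemma measurable_tri P : det3 P != 0 -> measurable (tri P : set (mR * mR)).
Proof.
move=> D0; rewrite triE// (set_forall3 (fun j => [set x | 0 < bary P j x])).
have H j : measurable ([set x | 0 < bary P j x] : set (mR * mR)).
  by apply: measurable_lt_set => //; exact: measurable_bary.
by apply: measurableI => //; exact: measurableI.
Qed.

(** For [b != 0] every vertical section is a point; for [b = 0] and [a != 0] the set is a point
    times the line; if only [c] is nonzero, it is empty. *)
Lemma line_null (a b c : R) : [|| a != 0, b != 0 | c != 0] ->
  mu2 [set x : mR * mR | a * x.1 + b * x.2 + c = 0] = 0%E.
Proof.
have [->|b0] := eqVneq b 0; last first.
  move=> _; rewrite /product_measure1 integral0_eq// => x _ /=.
  rewrite (_ : xsection _ _ = [set (- (a * x + c) / b)]) ?lebesgue_measure_set1//.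
  apply/seteqP; split => y; rewrite /xsection/= inE/= => E.
    apply: (mulIf b0); rewrite mulfVK//; apply/eqP.
    by rewrite -subr_eq0 -[X in _ == X]E; apply/eqP; ring.
  by rewrite E; field.
have [->|a0] := eqVneq a 0; rewrite /=.
  move=> c0; rewrite (_ : [set x | _] = set0) ?measure0//.
  by apply/seteqP; split => // x /=; rewrite !mul0r !add0r => /eqP; rewrite (negbTE c0).
move=> _; rewrite (_ : [set x | _] = [set - c / a] `*` setT).
  by rewrite product_measure1E// [X in (X * _)%E]lebesgue_measure_set1 mul0e.
apply/seteqP; split => -[x y] /=.
  by rewrite mul0r addr0 => E; split => //; apply: (mulIf a0); rewrite mulfVK//;
    apply/eqP; rewrite -subr_eq0 -[X in _ == X]E; apply/eqP; ring.
by case=> -> _; field.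
Qed.

Lemma interp0_null P v : det3 P != 0 -> (exists j, v j != 0) ->
  mu2 [set x | interp P v x = 0] = 0%E.
Proof.
move=> D0 [j vj]; have [a [b [c E]]] := interpE P v; rewrite (funext E).
apply: line_null; apply: contraT; rewrite !negb_or !negbK => /and3P[/eqP a0 /eqP b0 /eqP c0].
by move: vj; rewrite -(interp_vertex v j D0) E a0 b0 c0 !mul0r !addr0 eqxx.
Qed.

(** The local mass matrix [(1 + delta_ij) / 24] as a bilinear form on vertex values, for a triangle
    whose [det3] has absolute value 1. *)
Definition mass (v w : 'I_3 -> R) : R :=
  ((\sum_j v j) * (\sum_j w j) + \sum_j v j * w j) / 24.

(** The affine map [F] from the reference triangle turns barycentric coordinates into [psi], hence
    the integrand into a [quad] with known integral. *)
Lemma integral_tri P v w : det3 P != 0 ->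
  mu2.-integrable (tri P) (EFin \o (fun x => interp P v x * interp P w x)) /\
  Rintegral mu2 (tri P) (fun x => interp P v x * interp P w x) =
  `|det3 P| * mass v w.
Proof.
move=> D0.
pose F : mR * mR -> mR * mR := affmap (P 0).1 (P 1 - P 0).1 (P 2%:R - P 0).1
  (P 0).2 (P 1 - P 0).2 (P 2%:R - P 0).2.
have bF j x : bary P j (F x) = psi j x.
  rewrite /bary /F /affmap/=; congr psi; rewrite [RHS]surjective_pairing.
  by move: D0; rewrite /det3 !ptE/= => D0; congr (_, _); field.
have FT : F @^-1` (tri P) = @refT R.
  rewrite triE//; apply/seteqP; split => x /=.
    move=> h; have := h 0; have := h 1; have := h 2%:R; rewrite !bF /psi/=.
    by move=> *; split; lra.
  by case=> h1 h2 h3; apply: forall3; rewrite bF /psi/=; lra.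
pose f := fun x => interp P v x * interp P w x.
have fF : f \o F = quad (v 0 * w 0) (v 0 * (w 1 - w 0) + (v 1 - v 0) * w 0)
    (v 0 * (w 2%:R - w 0) + (v 2%:R - v 0) * w 0)
    ((v 1 - v 0) * (w 1 - w 0))
    ((v 1 - v 0) * (w 2%:R - w 0) + (v 2%:R - v 0) * (w 1 - w 0))
    ((v 2%:R - v 0) * (w 2%:R - w 0)).
  by apply: funext => x; rewrite /f /= /interp !sum3 !bF /psi /quad/=; ring.
have [] := @scales_Rintegral R F `|det3 P| (tri P) f.
- by rewrite normr_gt0.
- exact: scales_affmap.
- exact: measurable_tri.
- by apply: measurable_funM; exact: measurable_interp.
- by rewrite fF FT; exact: integrable_refT.
move=> h1 h2; split; first exact: h1.
rewrite -/f h2 fF FT Rintegral_refT /mass !sum3.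
by congr (_ * _); field.
Qed.

End TriangleMeasure.

Section Corner.
Variable R : realType.
Local Notation mR := (measurableTypeR R).
Local Notation mu := (@lebesgue_measure R).
Local Notation mu2 := (mu \x mu)%E.
Implicit Types (P Q : 'I_3 -> pt R) (x : pt R) (v w f g : 'I_3 -> R).

Definition trineg P v : set (pt R) := tri P `&` [set x | interp P v x < 0].

Lemma measurable_trineg P v : det3 P != 0 -> measurable (trineg P v : set (mR * mR)).
Proof.
move=> D0; apply: measurableI; first exact: measurable_tri.
by apply: measurable_lt_set => //; exact: measurable_interp.
Qed.

Lemma integrable_sub_tri P f g (A : set (mR * mR)) : det3 P != 0 -> measurable A ->
  A `<=` tri P -> mu2.-integrable A (EFin \o (fun x => interp P f x * interp P g x)).
Proof.
move=> D0 mA sA; have [ip _] := integral_tri f g D0.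
exact: integrableS (measurable_tri D0) mA sA ip.
Qed.

(* Values of [interp P f] at the vertices of the corner cut off at vertex 0. *)
Definition cornerval (s t : R) f (j : 'I_3) : R :=
  nth 0 [:: f 0; (1 - s) * f 0 + s * f 1; (1 - t) * f 0 + t * f 2%:R] j.

Lemma interp_point P v (c : 'I_3 -> R) : det3 P != 0 -> \sum_j c j = 1 ->
  interp P v (\sum_j c j *: P j) = \sum_j v j * c j.
Proof. by move=> D0 c1; apply: eq_bigr => j _; rewrite bary_comb. Qed.

Lemma interpN P v x : interp P (\- v) x = - interp P v x.
Proof. by rewrite /interp -sumrN; apply: eq_bigr => j _; rewrite mulNr. Qed.

(** If [v 0 < 0], the negative part is the triangle [Q] spanned by [P 0] and the zeros of the
    interpolant on the two edges from [P 0]. Its determinant is [s * t] times that of [P], and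
    [cornerval] gives the values at its vertices. *)
Lemma integral_corner P v f g : det3 P != 0 -> v 0 <= 0 -> 0 <= v 1 -> 0 <= v 2%:R ->
  v 0 < v 1 -> v 0 < v 2%:R ->
  let s := v 0 / (v 0 - v 1) in let t := v 0 / (v 0 - v 2%:R) in
  Rintegral mu2 (trineg P v) (fun x => interp P f x * interp P g x) =
  `|det3 P| * (s * t * mass (cornerval s t f) (cornerval s t g)).
Proof.
move=> D0 v0 v1 v2 v01 v02 s t.
(* For [v 0 = 0] the corner shrinks to the vertex: the set is empty on the left, and [s = 0] on the
   right. *)
have [v00|v0n] := eqVneq (v 0) 0.
  rewrite (_ : trineg P v = set0).
    by rewrite Rintegral_set0 /s v00 !mul0r mulr0.
  apply/seteqP; split => // x; rewrite /trineg triE// => -[/= x0].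
  rewrite ltNge => /negP; apply; rewrite /interp sum3 v00 mul0r add0r.
  by apply: addr_ge0; apply: mulr_ge0 => //; exact: ltW.
have {v0 v0n} v0 : v 0 < 0 by rewrite lt_neqAle v0n.
have s0 : 0 < s by rewrite /s -mulrNN -invrN mulr_gt0 ?invr_gt0 ?oppr_gt0 ?subr_lt0.
have t0 : 0 < t by rewrite /t -mulrNN -invrN mulr_gt0 ?invr_gt0 ?oppr_gt0 ?subr_lt0.
have s1 : s <= 1 by rewrite /s ler_ndivrMr ?subr_lt0// mul1r lerBlDr lerDl.
have t1 : t <= 1 by rewrite /t ler_ndivrMr ?subr_lt0// mul1r lerBlDr lerDl.
pose c (i : 'I_3) : 'I_3 -> R := fun j =>
  if i == 0 then (j == 0)%:R else if i == 1 then (1 - s) * (j == 0)%:R + s * (j == 1)%:R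
  else (1 - t) * (j == 0)%:R + t * (j == 2%:R)%:R.
have c1 i : \sum_j c i j = 1.
  by rewrite sum3; move: i; apply: forall3; rewrite /c/=; ring.
pose Q i := \sum_j c i j *: P j.
have QE w : interp P w \o Q = cornerval s t w.
  apply: funext => i /=; rewrite interp_point// sum3; move: i.
  by apply: forall3; rewrite /c /cornerval/=; ring.
have dQ : det3 Q = s * t * det3 P.
  by rewrite /det3 /Q !sum3 !ptE /c/=; ring.
have DQ : det3 Q != 0 by rewrite dQ; apply: mulf_neq0 => //; apply: mulf_neq0; rewrite gt_eqF.
have PQ w x : interp P w x = interp Q (cornerval s t w) x.
  by rewrite (interp_interp P w x DQ) QE.
(* The interpolant vanishes at the two new vertices of [Q], so its sign is governed by one
   barycentric coordinate of [Q]. *)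
have PQv x : interp P v x = v 0 * bary Q 0 x.
  rewrite PQ /interp sum3 /cornerval/=.
  suff [-> ->] : (1 - s) * v 0 + s * v 1 = 0 /\ (1 - t) * v 0 + t * v 2%:R = 0.
    by rewrite !mul0r !addr0.
  have ? : v 0 - v 1 != 0 by rewrite lt_eqF ?subr_lt0.
  have ? : v 0 - v 2%:R != 0 by rewrite lt_eqF ?subr_lt0.
  by split; rewrite /s /t; field.
have bP j x : bary P j x = interp Q (cornerval s t (fun i => (i == j)%:R)) x.
  by rewrite -PQ bary_interp.
have -> : trineg P v = tri Q.
  rewrite /trineg !triE//; apply/seteqP; split => x /=.
    case=> h; rewrite PQv nmulr_rlt0// => h0; apply: (forall3 h0).
      have := h 1; rewrite bP /interp sum3 /cornerval/= => e.
      by rewrite -(pmulr_rgt0 _ s0); lra.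
    have := h 2%:R; rewrite bP /interp sum3 /cornerval/= => e.
    by rewrite -(pmulr_rgt0 _ t0); lra.
  move=> h; split; last by rewrite PQv nmulr_rlt0.
  have h0 := h 0; have h1 := h 1; have h2 := h 2%:R.
  have p1 : 0 <= (1 - s) * bary Q 1 x by rewrite mulr_ge0 ?subr_ge0// ltW.
  have p2 : 0 <= (1 - t) * bary Q 2%:R x by rewrite mulr_ge0 ?subr_ge0// ltW.
  have p3 : 0 < s * bary Q 1 x by exact: mulr_gt0.
  have p4 : 0 < t * bary Q 2%:R x by exact: mulr_gt0.
  by apply: forall3; rewrite bP /interp sum3 /cornerval/=; lra.
rewrite (_ : (fun x => _) = (fun x => interp Q (cornerval s t f) x * interp Q (cornerval s t g) x)).
  have [_ ->] := integral_tri (cornerval s t f) (cornerval s t g) DQ.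
  by rewrite dQ normrM (gtr0_norm (mulr_gt0 s0 t0)); ring.
by apply: funext => x; rewrite !PQ.
Qed.

(** The zero line of the interpolant is a null set, so the parts with negative and with positive
    values fill the triangle up to measure 0. *)
Lemma integral_trineg_compl P v (h : pt R -> R) : det3 P != 0 -> (exists j, v j != 0) ->
  mu2.-integrable (tri P) (EFin \o h) ->
  Rintegral mu2 (trineg P v) h =
  Rintegral mu2 (tri P) h - Rintegral mu2 (trineg P (\- v)) h.
Proof.
move=> D0 v0 ih; pose N : set (mR * mR) := [set x | interp P v x = 0].
have mN : measurable N by apply: measurable_eq0; exact: measurable_interp.
apply/eqP; rewrite eq_sym subr_eq; apply/eqP.
have E : tri P `\` N = trineg P v `|` trineg P (\- v).
  apply/seteqP; split => x; rewrite /trineg/= interpN oppr_lt0.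
    case=> xT xN; case: (ltgtP (interp P v x) 0) => e; [by left|by right|].
    by case: xN.
  by case=> -[xT h0]; split => // /= e; rewrite e ltxx in h0.
rewrite /Rintegral (negligible_integral mN (measurable_tri D0) ih); last exact: interp0_null.
rewrite E; apply: Rintegral_setU.
- exact: measurable_trineg.
- exact: measurable_trineg.
- rewrite -E; apply: integrableS ih => //; first exact: measurable_tri.
  by apply: measurableD => //; exact: measurable_tri.
apply/disj_setPS => x [[_ /= h1] [_ /=]]; rewrite interpN oppr_lt0 => h2.
by have := lt_trans h1 h2; rewrite ltxx.
Qed.

End Corner.

(** * Cyclic renumbering of the vertices *)

Section Rotation.
Variable R : realType.
Implicit Types (P Q : 'I_3 -> pt R) (x : pt R) (v w f g : 'I_3 -> R).

(** Addition in ['I_3] is modulo 3: vertex [r] becomes vertex 0, and the orientation is kept. *)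
Definition rot3 (A : Type) (r : 'I_3) (F : 'I_3 -> A) (j : 'I_3) : A := F (j + r).

Lemma det3_rot P r : det3 (rot3 r P) = det3 P.
Proof.
have e11 : 1 + 1 = 2%:R :> 'I_3 by apply: val_inj.
have e12 : 1 + 2%:R = 0 :> 'I_3 by apply: val_inj.
have e22 : 2%:R + 2%:R = 1 :> 'I_3 by apply: val_inj.
move: r; apply: forall3; rewrite /rot3 /det3 ?addr0 ?add0r ?e11 ?e22 1?[2%:R + 1]addrC ?e12 //.
  by rewrite !ptE; ring.
by rewrite !ptE; ring.
Qed.

Lemma interp_rot P v r x : det3 P != 0 -> interp (rot3 r P) (rot3 r v) x = interp P v x.
Proof.
move=> D0; rewrite [RHS](interp_interp P v x (Q := rot3 r P)) ?det3_rot//.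
by apply: eq_bigr => j _; congr (_ * _); rewrite /= /rot3 interp_vertex.
Qed.

Lemma bary_rot P r j x : det3 P != 0 -> bary (rot3 r P) j x = bary P (j + r) x.
Proof.
move=> D0; rewrite !bary_interp -(interp_rot _ r _ D0).
by apply: eq_bigr => i _; rewrite /rot3 (inj_eq (addIr _)).
Qed.

Lemma tri_rot P r : det3 P != 0 -> tri (rot3 r P) = tri P.
Proof.
move=> D0; rewrite !triE ?det3_rot//; apply/seteqP; split => x /= h j.
  by have := h (j - r); rewrite bary_rot// subrK.
by rewrite bary_rot.
Qed.

Lemma trineg_rot P v r : det3 P != 0 -> trineg (rot3 r P) (rot3 r v) = trineg P v.
Proof.
move=> D0; rewrite /trineg tri_rot//; congr (_ `&` _).
by apply: funext => x /=; rewrite interp_rot.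
Qed.

End Rotation.

(** * Derivatives of the moments *)

Section RightDerivative.
Variable R : realType.
Implicit Types F G : R -> R.

(* One-sided, since the interface may pass through the node: phi(x_k) = 0 is allowed. *)
Definition rder F (l : R) := (F e - F 0) / e @[e --> 0^'+] --> l.

Lemma rder_cvg F l : rder F l -> F e @[e --> 0^'+] --> F 0.
Proof.
move=> h.
have : (F e - F 0) / e * e + F 0 @[e --> 0^'+] --> l * 0 + F 0.
  apply: cvgD; last exact: cvg_cst.
  by apply: cvgM => //; apply: cvg_at_right_filter; exact: cvg_id.
rewrite mulr0 add0r; apply: cvg_trans; apply: near_eq_cvg.
near=> e; rewrite divfK ?subrK// gt_eqF//; near: e; exact: nbhs_right_gt.
Unshelve. all: by end_near. Qed.

Lemma rder_cst c : rder (fun=> c) 0.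
Proof. by rewrite /rder; under eq_fun do rewrite subrr mul0r; exact: cvg_cst. Qed.

Lemma rder_id a : rder (fun e => a + e) 1.
Proof.
have : (fun=> 1 : R) e @[e --> (0 : R)^'+] --> (1 : R) by exact: cvg_cst.
apply: cvg_trans; apply: near_eq_cvg; near=> e.
rewrite addr0 [a + e]addrC addrK divff// gt_eqF//; near: e; exact: nbhs_right_gt.
Unshelve. all: by end_near. Qed.

Lemma rderD F G l m : rder F l -> rder G m -> rder (fun e => F e + G e) (l + m).
Proof.
move=> h k; rewrite /rder.
rewrite (_ : (fun e => _) = (fun e => (F e - F 0) / e + (G e - G 0) / e)).
  exact: cvgD.
by apply: funext => e; rewrite -mulrDl; congr (_ * _); ring.
Qed.

Lemma rderM F G l m : rder F l -> rder G m ->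
  rder (fun e => F e * G e) (l * G 0 + F 0 * m).
Proof.
move=> h k; rewrite /rder.
rewrite (_ : (fun e => _) = (fun e => (F e - F 0) / e * G e + F 0 * ((G e - G 0) / e))).
  apply: cvgD; apply: cvgM => //; first exact: rder_cvg k.
  exact: cvg_cst.
apply: funext => e; move: e^-1 => d; ring.
Qed.

Lemma rderV F l : F 0 != 0 -> rder F l -> rder (fun e => (F e)^-1) (- l / F 0 ^+ 2).
Proof.
move=> F0 h; have cF := rder_cvg h.
have : - ((F e - F 0) / e) * ((F e)^-1 * (F 0)^-1) @[e --> 0^'+] --> - l * ((F 0)^-1 * (F 0)^-1).
  apply: cvgM; first exact: cvgN.
  by apply: cvgM; [exact: cvgV|exact: cvg_cst].
rewrite -invfM -expr2; apply: cvg_trans; apply: near_eq_cvg.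
have nF : \forall e \near 0^'+, F e != 0.
  have nb : nbhs (F 0) [set x : R | x != 0].
    by apply: open_nbhs_nbhs; split; [exact: open_neq|].
  exact: (cF _ nb).
near=> e; have Fe : F e != 0 by near: e.
have e0 : e != 0 by rewrite gt_eqF//; near: e; exact: nbhs_right_gt.
by field; rewrite Fe F0 e0.
Unshelve. all: by end_near. Qed.

Lemma rder_eq F l m : rder F l -> l = m -> rder F m.
Proof. by move=> h <-. Qed.

End RightDerivative.

Section LocalDerivative.
Variable R : realType.
Local Notation mu := (@lebesgue_measure R).
Local Notation mu2 := (mu \x mu)%E.
Implicit Types (P Q : 'I_3 -> pt R) (x : pt R) (v w f g : 'I_3 -> R).

Definition moment P v f g : R :=
  Rintegral mu2 (trineg P v) (fun x => interp P f x * interp P g x).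

(* The moment over the corner at vertex 0 cut at the relative distances s and t,
   divided by [`|det3 P|]. *)
Definition cmoment (s t : R) f g : R :=
  s * t * mass (cornerval s t f) (cornerval s t g).

Definition v3 (a b c : R) (j : 'I_3) : R := nth 0 [:: a; b; c] j.

Lemma moment_rot P v f g r : det3 P != 0 ->
  moment P v f g = moment (rot3 r P) (rot3 r v) (rot3 r f) (rot3 r g).
Proof.
move=> D0; rewrite /moment trineg_rot//; congr (Rintegral _ _ _).
by apply: funext => x; rewrite !interp_rot.
Qed.

Lemma moment_corner_neg P v f g : det3 P != 0 -> v 0 <= 0 -> 0 <= v 1 -> 0 <= v 2%:R ->
  v 0 < v 1 -> v 0 < v 2%:R ->
  moment P v f g =
  `|det3 P| * cmoment (v 0 / (v 0 - v 1)) (v 0 / (v 0 - v 2%:R)) f g.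
Proof. by move=> *; rewrite /moment integral_corner. Qed.

(** Up to a null set the negative part is the complement of the corner belonging to [\- v], and the
    two quotients do not change when [v] is negated. *)
Lemma moment_corner_pos P v f g : det3 P != 0 -> 0 <= v 0 -> v 1 <= 0 -> v 2%:R <= 0 ->
  v 1 < v 0 -> v 2%:R < v 0 ->
  moment P v f g = `|det3 P| * mass f g -
  `|det3 P| * cmoment (v 0 / (v 0 - v 1)) (v 0 / (v 0 - v 2%:R)) f g.
Proof.
move=> D0 v0 v1 v2 v10 v20.
have [ip e] := integral_tri f g D0.
rewrite /moment integral_trineg_compl//; last first.
  (* The complement formula asks for a nonzero vertex value; if [v 0 = 0], then [v 1] is
     negative. *)
  have [v00|v00] := eqVneq (v 0) 0; last by exists 0.
  by exists 1; rewrite lt_eqF// -v00.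
rewrite e; congr (_ - _); rewrite integral_corner// ?oppr_le0 ?oppr_ge0 ?ltrN2//.
rewrite /cmoment; congr (_ * (_ * _ * mass (cornerval _ _ _) (cornerval _ _ _)));
 by rewrite -opprD invrN mulrNN.
Qed.

End LocalDerivative.

Section LocalLimit.
Variable R : realType.
Implicit Types (P Q : 'I_3 -> pt R) (x : pt R) (v w f g : 'I_3 -> R).

(** 24 times the [mass] of the corner values, expanded in [s] and [t] so that the product rule
    applies term by term. *)
Definition corner_poly (s t : R) f g : R :=
  12 * (f 0 * g 0) + 4 * (f 0 * (g 1 - g 0) + (f 1 - f 0) * g 0) * s
   + 4 * (f 0 * (g 2%:R - g 0) + (f 2%:R - f 0) * g 0) * t
   + 2 * ((f 1 - f 0) * (g 1 - g 0)) * (s * s)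
   + 2 * ((f 2%:R - f 0) * (g 2%:R - g 0)) * (t * t)
   + ((f 1 - f 0) * (g 2%:R - g 0) + (f 2%:R - f 0) * (g 1 - g 0)) * (s * t).

Lemma mass_cornerval (s t : R) f g :
  mass (cornerval s t f) (cornerval s t g) = corner_poly s t f g / 24.
Proof. by rewrite /mass !sum3 /cornerval /corner_poly/=; field. Qed.

Lemma cmomentE (s t : R) f g :
  cmoment s t f g = s * t / 24 * corner_poly s t f g.
Proof. by rewrite /cmoment mass_cornerval; ring. Qed.

(** The derivative of [cmoment] when [s] and [t] move with velocities [s'] and [t']. *)
Definition dcmoment (s t s' t' : R) f g : R :=
  (s' * t + s * t') / 24 * corner_poly s t f g
  + s * t / 24 * (4 * (f 0 * (g 1 - g 0) + (f 1 - f 0) * g 0) * s'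
   + 4 * (f 0 * (g 2%:R - g 0) + (f 2%:R - f 0) * g 0) * t'
   + 4 * ((f 1 - f 0) * (g 1 - g 0)) * (s * s')
   + 4 * ((f 2%:R - f 0) * (g 2%:R - g 0)) * (t * t')
   + ((f 1 - f 0) * (g 2%:R - g 0) + (f 2%:R - f 0) * (g 1 - g 0)) * (s' * t + s * t')).

Lemma rder_cmoment (s t : R -> R) (s' t' : R) f g : rder s s' -> rder t t' ->
  rder (fun e => cmoment (s e) (t e) f g) (dcmoment (s 0) (t 0) s' t' f g).
Proof.
move=> hs ht; under [fun e => _]eq_fun do rewrite cmomentE /corner_poly.
have := rderM (rderM (rderM hs ht) (rder_cst (24^-1 : R)))
  (rderD (rderD (rderD (rderD (rderD (rder_cst (12 * (f 0 * g 0)))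
    (rderM (rder_cst (4 * (f 0 * (g 1 - g 0) + (f 1 - f 0) * g 0))) hs))
    (rderM (rder_cst (4 * (f 0 * (g 2%:R - g 0) + (f 2%:R - f 0) * g 0))) ht))
    (rderM (rder_cst (2 * ((f 1 - f 0) * (g 1 - g 0)))) (rderM hs hs)))
    (rderM (rder_cst (2 * ((f 2%:R - f 0) * (g 2%:R - g 0)))) (rderM ht ht)))
    (rderM (rder_cst ((f 1 - f 0) * (g 2%:R - g 0) + (f 2%:R - f 0) * (g 1 - g 0))) (rderM hs ht))).
move=> h; apply: rder_eq h _; by rewrite /dcmoment /corner_poly; ring.
Qed.

Definition delta3 (i j : 'I_3) : R := (j == i)%:R.

(** Vertex 0 lies on the side [sg], the others opposite. The sign conditions are weak because a
    value may vanish at [e = 0]; the strict comparisons keep the denominators [v 0 - v 1] and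
    [v 0 - v 2%:R] nonzero. *)
Definition cutcond (sg : R) v : Prop :=
  [/\ 0 <= sg * v 0, sg * v 1 <= 0, sg * v 2%:R <= 0, sg * v 1 < sg * v 0
    & sg * v 2%:R < sg * v 0].

(** One formula for both signs: the corner itself for [sg = -1], the full triangle minus the corner
    for [sg = 1]. The constant [b%:R * mass f g] drops out of increments. *)
Lemma moment_cut (b : bool) (sg := (if b then 1 else - 1) : R) P v f g :
  det3 P != 0 -> cutcond sg v -> moment P v f g = (b%:R * mass f g
   - sg * cmoment (v 0 / (v 0 - v 1)) (v 0 / (v 0 - v 2%:R)) f g) * `|det3 P|.
Proof.
move=> D0; rewrite /sg /cutcond; case: b {sg} => /=.
  rewrite !mul1r => -[*]; rewrite moment_corner_pos//; ring.
rewrite !mulN1r !oppr_ge0 !oppr_le0 !ltrN2 => -[*].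
rewrite moment_corner_neg//; ring.
Qed.

Lemma moment_quotient (b : bool) (sg := (if b then 1 else - 1) : R)
    P (V : R -> 'I_3 -> R) f g (s' t' : R) :
  det3 P != 0 -> cutcond sg (V 0) -> (\forall e \near 0^'+, cutcond sg (V e)) ->
  rder (fun e => V e 0 / (V e 0 - V e 1)) s' ->
  rder (fun e => V e 0 / (V e 0 - V e 2%:R)) t' ->
  rder (fun e => moment P (V e) f g)
    (`|det3 P| * (- sg *
      dcmoment (V 0 0 / (V 0 0 - V 0 1)) (V 0 0 / (V 0 0 - V 0 2%:R)) s' t' f g)).
Proof.
move=> D0 c0 ce hs ht.
have : rder (fun e => - sg * `|det3 P| *
    cmoment (V e 0 / (V e 0 - V e 1)) (V e 0 / (V e 0 - V e 2%:R)) f g)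
  (`|det3 P| * (- sg *
      dcmoment (V 0 0 / (V 0 0 - V 0 1)) (V 0 0 / (V 0 0 - V 0 2%:R)) s' t' f g)).
  apply: rder_eq (rderM (rder_cst _) (rder_cmoment (f:=f) (g:=g) hs ht)) _; ring.
rewrite /rder; apply: cvg_trans; apply: near_eq_cvg; near=> e.
have cVe : cutcond sg (V e) by near: e.
rewrite !(@moment_cut b)// -/sg; congr (_ / _).
by move: (b%:R : R) => B; ring.
Unshelve. all: by end_near. Qed.

Lemma near_ge0 (a : R) : (\forall e \near 0^'+, 0 < a + e) -> 0 <= a.
Proof.
move=> h; rewrite leNgt; apply/negP => a0; near (0 : R)^'+ => e.
have : 0 < a + e by near: e.
suff : e < - a by move=> *; lra.
by near: e; apply: nbhs_right_lt; rewrite oppr_gt0.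
Unshelve. all: by end_near. Qed.

Lemma near_lt0 (a : R) : (\forall e \near 0^'+, a + e < 0) -> a < 0.
Proof.
move=> h; near (0 : R)^'+ => e.
have : a + e < 0 by near: e.
have : 0 < e by near: e; exact: nbhs_right_gt.
lra.
Unshelve. all: by end_near. Qed.

Lemma near_cst (Q : Prop) : (\forall e \near (0 : R)^'+, Q) -> Q.
Proof. by move=> h; near (0 : R)^'+ => e; near: e. Unshelve. all: by end_near. Qed.

Lemma rder_frac (F G : R -> R) l m : rder F l -> rder G m -> F 0 - G 0 != 0 ->
  rder (fun e => F e / (F e - G e)) ((F 0 * m - l * G 0) / (F 0 - G 0) ^+ 2).
Proof.
move=> hF hG d0.
have hGN : rder (fun e => - G e) (- m).
  have := rderM (rder_cst (- 1 : R)) hG; rewrite mul0r add0r mulN1r.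
  by under [fun e => -1 * _]eq_fun do rewrite mulN1r.
apply: rder_eq (rderM hF (rderV d0 (rderD hF hGN))) _.
by field.
Qed.

Lemma rot3E (A : Type) (F : 'I_3 -> A) :
  ((rot3 0 F 0 = F 0) * (rot3 0 F 1 = F 1) * (rot3 0 F 2%:R = F 2%:R)) *
  ((rot3 1 F 0 = F 1) * (rot3 1 F 1 = F 2%:R) * (rot3 1 F 2%:R = F 0)) *
  ((rot3 2%:R F 0 = F 2%:R) * (rot3 2%:R F 1 = F 0) * (rot3 2%:R F 2%:R = F 1)).
Proof. by rewrite /rot3; do ![split]; congr F; apply: val_inj. Qed.

(** Bilinearity in [f] and [g]: the matrix of the form in the original numbering is read off on the
    renumbered unit vectors. *)
Lemma dcmoment_rot s t s' t' f g r :
  dcmoment s t s' t' (rot3 r f) (rot3 r g) =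
  \sum_i \sum_j f i * dcmoment s t s' t' (rot3 r (delta3 i)) (rot3 r (delta3 j)) * g j.
Proof.
move: r; apply: forall3; rewrite !sum3 /dcmoment /corner_poly !rot3E /delta3/=; by field.
Qed.

(** Moves the cut vertex to position 0. What a configuration still has to supply is the hypothesis
    on the nine entries of [m], in which only unit vectors occur. *)
Lemma rot_derivative (b : bool) (sg := (if b then 1 else - 1) : R)
    P (V : R -> 'I_3 -> R) f g (s' t' : R) (m : 'M[R]_3) (r : 'I_3) :
  det3 P != 0 -> cutcond sg (rot3 r (V 0)) -> (\forall e \near 0^'+, cutcond sg (rot3 r (V e))) ->
  rder (fun e => rot3 r (V e) 0 / (rot3 r (V e) 0 - rot3 r (V e) 1)) s' ->
  rder (fun e => rot3 r (V e) 0 / (rot3 r (V e) 0 - rot3 r (V e) 2%:R)) t' ->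
  let W := rot3 r (V 0) in
  (forall i j, m i j = - sg * dcmoment (W 0 / (W 0 - W 1)) (W 0 / (W 0 - W 2%:R)) s' t'
     (rot3 r (delta3 i)) (rot3 r (delta3 j))) ->
  rder (fun e => moment P (V e) f g) (`|det3 P| * \sum_i \sum_j f i * m i j * g j).
Proof.
move=> D0 c0 ce hs ht W hm.
have D0' : det3 (rot3 r P) != 0 by rewrite det3_rot.
under [fun e => _]eq_fun do rewrite (moment_rot _ _ _ r D0).
apply: rder_eq (moment_quotient (b := b) (V := rot3 r \o V)
  (f := rot3 r f) (g := rot3 r g) D0' c0 ce hs ht) _.
rewrite det3_rot dcmoment_rot; congr (_ * _).
rewrite mulr_sumr; apply: eq_bigr => i _; rewrite mulr_sumr; apply: eq_bigr => j _.
by rewrite hm /W /=; move: (dcmoment _ _ _ _ _ _) => D; rewrite -/sg; ring.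
Qed.

Lemma sg_pattern (b : bool) (sg := (if b then 1 else - 1) : R) (x : R) :
  (Num.sg x = sg -> 0 < sg * x) * (Num.sg x = - sg -> sg * x < 0).
Proof.
rewrite /sg; case: b {sg} => /=; split; rewrite ?opprK ?mul1r ?mulN1r ?oppr_gt0 ?oppr_lt0 => /eqP;
  by rewrite sgr_cp0.
Qed.

Lemma near_sg_ge0 (b : bool) (sg := (if b then 1 else - 1) : R) (a : R) :
  (\forall e \near 0^'+, 0 < sg * (a + e)) -> 0 <= sg * a.
Proof.
rewrite /sg; case: b {sg} => /= h; rewrite ?mul1r ?mulN1r ?oppr_ge0.
  by apply: near_ge0; near=> e; rewrite -[_ + _]mul1r; near: e.
by apply/ltW/near_lt0; near=> e; rewrite -oppr_gt0 -mulN1r; near: e.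
Unshelve. all: by end_near. Qed.

Lemma near_sg_le0 (b : bool) (sg := (if b then 1 else - 1) : R) (a : R) :
  (\forall e \near 0^'+, sg * (a + e) < 0) -> sg * a <= 0.
Proof.
rewrite /sg; case: b {sg} => /= h; rewrite ?mul1r ?mulN1r ?oppr_le0.
  by apply/ltW/near_lt0; near=> e; rewrite -[_ + _]mul1r; near: e.
by apply: near_ge0; near=> e; rewrite -oppr_lt0 -mulN1r; near: e.
Unshelve. all: by end_near. Qed.

Lemma cutcond_strict (sg : R) v : 0 < sg * v 0 -> sg * v 1 <= 0 -> sg * v 2%:R <= 0 ->
  cutcond sg v.
Proof.
move=> v0 v1 v2.
by split=> //; [exact: ltW|exact: le_lt_trans v0|exact: le_lt_trans v0].
Qed.

Lemma cutcond_weak (sg : R) v : 0 <= sg * v 0 -> sg * v 1 < 0 -> sg * v 2%:R < 0 ->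
  cutcond sg v.
Proof.
move=> v0 v1 v2.
by split=> //; [exact: ltW|exact: ltW|exact: lt_le_trans v0|exact: lt_le_trans v0].
Qed.

(** The shift by the cut vertex puts the perturbed value [a + e] in position 0, 2 or 1 for the
    shapes A, B, C. Hence both quotients move for A, only the second for B and only the first for C;
    the entries of [mbar] are then matched as rational functions. *)
Lemma local_derivative P I (a b c : R) f g : det3 P != 0 ->
  (\forall e \near 0^'+, forall j, Num.sg (v3 (a + e) b c j) = sign_pattern R I j) ->
  rder (fun e => moment P (v3 (a + e) b c) f g)
    (`|det3 P| * \sum_i \sum_j f i * mbar I a b c i j * g j).
Proof.
move=> D0; case: I => sh bb hI; pose sg : R := if bb then 1 else -1.
have neq (x y : R) : sg * x < sg * y -> x - y != 0 /\ y - x != 0.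
  by move=> xy; split; apply: contraTN xy => /eqP/subr0_eq ->; rewrite ltxx.
case: sh hI => hI.
- have ha : \forall e \near 0^'+, 0 < sg * (a + e).
    by near=> e; apply: (sg_pattern bb _).1; apply: (near hI e _ 0).
  have hb : sg * b < 0.
    by apply: near_cst; near=> e; apply: (sg_pattern bb _).2; apply: (near hI e _ 1).
  have hc : sg * c < 0.
    by apply: near_cst; near=> e; apply: (sg_pattern bb _).2; apply: (near hI e _ 2%:R).
  (* The strict sign of [a + e] holds for small [e > 0] only; in the limit the sign of [a] is known
     just weakly. *)
  have ha0 := near_sg_ge0 ha.
  have [_ n1] := neq _ _ (lt_le_trans hb ha0).
  have [_ n2] := neq _ _ (lt_le_trans hc ha0).
  apply: (@rot_derivative bb P _ f g _ _ _ 0) => //.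
  + by apply: cutcond_weak; rewrite !rot3E /v3/= ?addr0.
  + near=> e; apply: cutcond_weak; rewrite !rot3E /v3//=; apply/ltW; near: e; exact: ha.
  + under [fun e => _]eq_fun do rewrite !rot3E /v3/=.
    by apply: (rder_frac (rder_id a) (rder_cst b)); rewrite addr0.
  + under [fun e => _]eq_fun do rewrite !rot3E /v3/=.
    by apply: (rder_frac (rder_id a) (rder_cst c)); rewrite addr0.
  rewrite !rot3E /v3/= -/sg !addr0.
  apply: forall3; apply: forall3;
    rewrite mxE /dcmoment /corner_poly !rot3E /delta3 /config_sign /= -/sg;
    by field; rewrite n1 n2.
- have ha : \forall e \near 0^'+, sg * (a + e) < 0.
    by near=> e; apply: (sg_pattern bb _).2; apply: (near hI e _ 0).
  have hb : 0 < sg * b.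
    by apply: near_cst; near=> e; apply: (sg_pattern bb _).1; apply: (near hI e _ 1).
  have hc : sg * c < 0.
    by apply: near_cst; near=> e; apply: (sg_pattern bb _).2; apply: (near hI e _ 2%:R).
  have ha0 := near_sg_le0 ha.
  have [n1 n1'] := neq _ _ (le_lt_trans ha0 hb).
  have [_ n2] := neq _ _ (lt_trans hc hb).
  apply: (@rot_derivative bb P _ f g _ _ _ 1) => //.
  + by apply: cutcond_strict; rewrite !rot3E /v3/= ?addr0// ltW.
  + near=> e; apply: cutcond_strict; rewrite !rot3E /v3/= ?(ltW hc)//.
    by apply/ltW; near: e; exact: ha.
  + under [fun e => _]eq_fun do rewrite !rot3E /v3/=.
    by apply: (rder_frac (rder_cst b) (rder_cst c)).
  + under [fun e => _]eq_fun do rewrite !rot3E /v3/=.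
    by apply: (rder_frac (rder_cst b) (rder_id a)); rewrite addr0.
  rewrite !rot3E /v3/= -/sg !addr0.
  apply: forall3; apply: forall3;
    rewrite mxE /dcmoment /corner_poly !rot3E /delta3 /config_sign /= -/sg;
    by field; rewrite ?n1 ?n1' ?n2.
- have ha : \forall e \near 0^'+, sg * (a + e) < 0.
    by near=> e; apply: (sg_pattern bb _).2; apply: (near hI e _ 0).
  have hb : sg * b < 0.
    by apply: near_cst; near=> e; apply: (sg_pattern bb _).2; apply: (near hI e _ 1).
  have hc : 0 < sg * c.
    by apply: near_cst; near=> e; apply: (sg_pattern bb _).1; apply: (near hI e _ 2%:R).
  have ha0 := near_sg_le0 ha.
  have [n1 n1'] := neq _ _ (le_lt_trans ha0 hc).
  have [n2 n2'] := neq _ _ (lt_trans hb hc).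
  apply: (@rot_derivative bb P _ f g _ _ _ 2%:R) => //.
  + by apply: cutcond_strict; rewrite !rot3E /v3/= ?addr0// ltW.
  + near=> e; apply: cutcond_strict; rewrite !rot3E /v3/= ?(ltW hb)//.
    by apply/ltW; near: e; exact: ha.
  + under [fun e => _]eq_fun do rewrite !rot3E /v3/=.
    by apply: (rder_frac (rder_cst c) (rder_id a)); rewrite addr0.
  + under [fun e => _]eq_fun do rewrite !rot3E /v3/=.
    by apply: (rder_frac (rder_cst c) (rder_cst b)).
  rewrite !rot3E /v3/= -/sg !addr0.
  apply: forall3; apply: forall3;
    rewrite mxE /dcmoment /corner_poly !rot3E /delta3 /config_sign /= -/sg;
    by field; rewrite ?n1 ?n1' ?n2 ?n2'.
Unshelve. all: by end_near. Qed.

End LocalLimit.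

(** * Newly opened corners, and consistency of the explicit formulas *)

Section LocalLimit2.
Variable R : realType.
Local Notation mu := (@lebesgue_measure R).
Local Notation mu2 := (mu \x mu)%E.
Implicit Types (P Q : 'I_3 -> pt R) (x : pt R) (v w f g : 'I_3 -> R).

Lemma cvg_mass (s t : R -> R) s0 t0 f g :
  s e @[e --> 0^'+] --> s0 -> t e @[e --> 0^'+] --> t0 ->
  mass (cornerval (s e) (t e) f) (cornerval (s e) (t e) g) @[e --> 0^'+] -->
  mass (cornerval s0 t0 f) (cornerval s0 t0 g).
Proof.
move=> hs ht; rewrite mass_cornerval; under eq_fun do rewrite mass_cornerval.
apply: cvgM; last exact: cvg_cst.
have cM c (F : R -> R) (a : R) : F e @[e --> 0^'+] --> a ->
    c * F e @[e --> 0^'+] --> c * a by move=> hF; apply: cvgM => //; exact: cvg_cst.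
do 3 (apply: cvgD; last by apply: (cM _ _ _); apply: cvgM).
do 2 (apply: cvgD; last by apply: (cM _ _ _)).
exact: cvg_cst.
Qed.

Lemma moment_full P v f g : det3 P != 0 -> (forall j, v j <= 0) -> (exists j, v j < 0) ->
  moment P v f g = `|det3 P| * mass f g.
Proof.
move=> D0 v0 [j vj]; rewrite /moment (_ : trineg P v = tri P).
  by have [_ ->] := integral_tri f g D0.
apply/seteqP; split => x; rewrite /trineg triE//; first by case.
move=> /= b0; split => //; rewrite /interp (bigD1 j)//=.
rewrite ltr_nwDl//; first by rewrite nmulr_rlt0.
by apply: sumr_le0 => i _; rewrite mulr_le0_ge0// ltW.
Qed.

Lemma moment_empty P v f g : det3 P != 0 -> (forall j, 0 <= v j) -> moment P v f g = 0.
Proof.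
move=> D0 v0; rewrite /moment (_ : trineg P v = set0) ?Rintegral_set0//.
apply/seteqP; split => // x; rewrite /trineg triE// => -[/= b0].
by rewrite ltNge => /negP; apply; apply: sumr_ge0 => j _; rewrite mulr_ge0// ltW.
Qed.

Lemma moment_uniform (b : bool) (sg := (if b then 1 else - 1) : R) P v f g :
  det3 P != 0 -> sg * v 0 <= 0 -> sg * v 1 < 0 -> sg * v 2%:R < 0 ->
  moment P v f g = b%:R * mass f g * `|det3 P|.
Proof.
move=> D0; rewrite /sg; case: b {sg} => /=; rewrite ?mul1r ?mulN1r ?oppr_lt0 ?oppr_le0.
  move=> v0 v1 v2; rewrite moment_full// 1?mulrC//; last by exists 1.
  by apply: forall3 => //; exact: ltW.
move=> v0 v1 v2; rewrite !mul0r moment_empty//.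
by apply: forall3 => //; exact: ltW.
Qed.

(** An uncut element acquires a corner of relative area [s * t], of order [e ^+ 2], on which all
    vertex values tend to those at vertex 0. The factor 1/2 is the [mass] of the constant 1 with
    itself. *)
Lemma local_topological (b : bool) (sg := (if b then 1 else - 1) : R) P (a c d : R) f g :
  det3 P != 0 -> sg * a <= 0 -> sg * c < 0 -> sg * d < 0 ->
  (moment P (v3 (sg * e) c d) f g - moment P (v3 a c d) f g) / e ^+ 2
    @[e --> 0^'+] --> - sg * (`|det3 P| / (c * d) / 2 * (f 0 * g 0)).
Proof.
move=> D0 a0 c0 d0.
have sg2 : sg * sg = 1 by rewrite /sg; case: (b); rewrite ?mulrNN mulr1.
have nz (x : R) : sg * x < 0 -> x != 0.
  by move=> xy; apply: contraTN xy => /eqP ->; rewrite mulr0 ltxx.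
have cs (x : R) : sg * x < 0 -> sg / (sg * e - x) @[e --> 0^'+] --> sg / (sg * 0 - x).
  move=> x0; apply: cvgM; first exact: cvg_cst.
  apply: cvgV; first by rewrite mulr0 sub0r oppr_eq0 nz.
  apply: cvgB; last exact: cvg_cst.
  by apply: cvgM; [exact: cvg_cst|apply: cvg_at_right_filter; exact: cvg_id].
have cs0 (x : R) : sg * x < 0 -> sg * e / (sg * e - x) @[e --> 0^'+] --> (0 : R).
  move=> x0.
  have : sg / (sg * e - x) * e @[e --> 0^'+] --> sg / (sg * 0 - x) * 0.
    by apply: cvgM; [exact: cs|apply: cvg_at_right_filter; exact: cvg_id].
  rewrite [X in _ --> X -> _](mulr0 (sg / (sg * 0 - x))).
  by under eq_fun do rewrite mulrAC.
(* The quotient with [e ^+ 2] already cancelled: [sg / (sg * e - c)] is the cut distance divided by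
   [e]. *)
have lim : - sg * `|det3 P| * (sg / (sg * e - c) * (sg / (sg * e - d)) *
    mass (cornerval (sg * e / (sg * e - c)) (sg * e / (sg * e - d)) f)
         (cornerval (sg * e / (sg * e - c)) (sg * e / (sg * e - d)) g)) @[e --> 0^'+]
    --> - sg * `|det3 P| * (sg / (sg * 0 - c) * (sg / (sg * 0 - d)) *
    mass (cornerval 0 0 f) (cornerval 0 0 g)).
  apply: cvgM; first exact: cvg_cst.
  by apply: cvgM; [apply: cvgM; exact: cs|apply: cvg_mass; exact: cs0].
have E : - sg * `|det3 P| * (sg / (sg * 0 - c) * (sg / (sg * 0 - d)) *
    mass (cornerval 0 0 f) (cornerval 0 0 g)) = - sg * (`|det3 P| / (c * d) / 2 * (f 0 * g 0)).
  rewrite !mulr0 !sub0r /mass !sum3 /cornerval/=.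
  have -> : sg / - c * (sg / - d) = (c * d)^-1.
    by rewrite mulrACA sg2 mul1r -invfM mulrNN.
  by field; rewrite !nz.
rewrite -E; apply: cvg_trans lim; apply: near_eq_cvg; near=> e.
have e0 : 0 < e by near: e; exact: nbhs_right_gt.
rewrite (@moment_cut _ b)//; last first.
  by apply: cutcond_strict; rewrite /v3/= ?(ltW c0) ?(ltW d0)// mulrA -/sg sg2 mul1r.
rewrite (@moment_uniform b)// -/sg /cmoment /v3/= .
have nze (x : R) : sg * x < 0 -> sg * e - x != 0.
  move=> x0; apply: contraTneq x0 => /subr0_eq <-.
  by rewrite mulrA sg2 mul1r -leNgt ltW.
move: (mass (cornerval _ _ _) _) (mass f g) (b%:R : R) => M1 M2 B.
by field; rewrite !nze// gt_eqF.
Unshelve. all: by end_near. Qed.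

(** Nonvanishing of the differences in the denominators of the explicit formulas. *)
Definition config_regular (I : config) (a b c : R) : bool :=
  match I.1 with
  | shA => (a - b != 0) && (a - c != 0)
  | shB => (a - b != 0) && (b - c != 0)
  | shC => (a - c != 0) && (b - c != 0)
  end.

(** Reflects that the barycentric functions sum to 1: integrating against 1 is summing over [j].
    Thus the load derivative follows from the mass derivative. *)
Lemma sum_mbar I (a b c : R) i : config_regular I a b c ->
  \sum_j mbar I a b c i j = fbar I a b c i 0.
Proof.
case: I => -[] bb; rewrite /config_regular/= => /andP[n1 n2]; rewrite sum3; move: i;
 by apply: forall3; rewrite !mxE/= ; field; rewrite n1 n2.
Qed.

Lemma sum_fbar I (a b c : R) : config_regular I a b c ->
  \sum_i fbar I a b c i 0 = abar I a b c.
Proof.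
case: I => -[] bb; rewrite /config_regular/= => /andP[n1 n2]; rewrite sum3 !mxE/= /abar/=.
- by field; rewrite n1 n2.
- by field; rewrite -(opprB a b) oppr_eq0 n1 n2.
- by field; rewrite -(opprB a c) -(opprB b c) !oppr_eq0 n1 n2.
Qed.

Lemma near_config_regular I (a b c : R) :
  (\forall e \near 0^'+, forall j, Num.sg (v3 (a + e) b c j) = sign_pattern R I j) ->
  config_regular I a b c.
Proof.
case: I => sh bb hI; pose sg : R := if bb then 1 else -1.
have neq (x y : R) : sg * x < sg * y -> (x - y != 0) && (y - x != 0).
  by move=> xy; apply/andP; split; apply: contraTN xy => /eqP/subr0_eq ->; rewrite ltxx.
have pos (x : R) : Num.sg x = sg -> 0 < sg * x by exact: (sg_pattern bb _).1.
have neg (x : R) : Num.sg x = - sg -> sg * x < 0 by exact: (sg_pattern bb _).2.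
case: sh hI => hI; rewrite /config_regular/=.
- have ha : 0 <= sg * a.
    by apply: (@near_sg_ge0 _ bb); near=> e; apply: pos; apply: (near hI e _ 0).
  have hb : sg * b < 0 by apply: near_cst; near=> e; apply: neg; apply: (near hI e _ 1).
  have hc : sg * c < 0 by apply: near_cst; near=> e; apply: neg; apply: (near hI e _ 2%:R).
  have /andP[_ ->] := neq _ _ (lt_le_trans hb ha).
  by have /andP[_ ->] := neq _ _ (lt_le_trans hc ha).
- have ha : sg * a <= 0.
    by apply: (@near_sg_le0 _ bb); near=> e; apply: neg; apply: (near hI e _ 0).
  have hb : 0 < sg * b by apply: near_cst; near=> e; apply: pos; apply: (near hI e _ 1).
  have hc : sg * c < 0 by apply: near_cst; near=> e; apply: neg; apply: (near hI e _ 2%:R).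
  have /andP[-> _] := neq _ _ (le_lt_trans ha hb).
  by have /andP[_ ->] := neq _ _ (lt_trans hc hb).
have ha : sg * a <= 0.
  by apply: (@near_sg_le0 _ bb); near=> e; apply: neg; apply: (near hI e _ 0).
have hb : sg * b < 0 by apply: near_cst; near=> e; apply: neg; apply: (near hI e _ 1).
have hc : 0 < sg * c by apply: near_cst; near=> e; apply: pos; apply: (near hI e _ 2%:R).
have /andP[-> _] := neq _ _ (le_lt_trans ha hc).
by have /andP[-> _] := neq _ _ (lt_trans hb hc).
Unshelve. all: by end_near. Qed.

End LocalLimit2.

(** * Perturbation of the discrete problem *)

Section MatrixLimits.
Variable R : realType.

(** Entrywise, so that products, determinants and adjugates reduce to finite sums and products of
    real limits. *)
Definition mcvg m n (X : R -> 'M[R]_(m, n)) (L : 'M[R]_(m, n)) : Prop :=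
  forall i j, X e i j @[e --> 0^'+] --> L i j.

Lemma cvg_bigsum (I : Type) (r : seq I) (F : I -> R -> R) (L : I -> R) :
  (forall i, F i e @[e --> 0^'+] --> L i) ->
  \sum_(i <- r) F i e @[e --> 0^'+] --> \sum_(i <- r) L i.
Proof.
move=> h; elim: r => [|i r IH].
  by rewrite big_nil; under eq_fun do rewrite big_nil; exact: cvg_cst.
by rewrite big_cons; under eq_fun do rewrite big_cons; exact: cvgD.
Qed.

Lemma cvg_bigprod (I : Type) (r : seq I) (F : I -> R -> R) (L : I -> R) :
  (forall i, F i e @[e --> 0^'+] --> L i) ->
  \prod_(i <- r) F i e @[e --> 0^'+] --> \prod_(i <- r) L i.
Proof.
move=> h; elim: r => [|i r IH].
  by rewrite big_nil; under eq_fun do rewrite big_nil; exact: cvg_cst.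
by rewrite big_cons; under eq_fun do rewrite big_cons; exact: cvgM.
Qed.

Lemma mcvg_cst m n (L : 'M[R]_(m, n)) : mcvg (fun=> L) L.
Proof. by move=> i j; exact: cvg_cst. Qed.

Lemma mcvgD m n (X Y : R -> 'M[R]_(m, n)) L K : mcvg X L -> mcvg Y K ->
  mcvg (fun e => X e + Y e) (L + K).
Proof. by move=> h k i j; rewrite mxE; under eq_fun do rewrite mxE; exact: cvgD. Qed.

Lemma mcvgN m n (X : R -> 'M[R]_(m, n)) L : mcvg X L -> mcvg (fun e => - X e) (- L).
Proof. by move=> h i j; rewrite mxE; under eq_fun do rewrite mxE; exact: cvgN. Qed.

Lemma mcvgZ m n (c : R -> R) (X : R -> 'M[R]_(m, n)) (l : R) L :
  c e @[e --> 0^'+] --> l -> mcvg X L -> mcvg (fun e => c e *: X e) (l *: L).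
Proof. by move=> h k i j; rewrite mxE; under eq_fun do rewrite mxE; exact: cvgM. Qed.

Lemma mcvgM m n q (X : R -> 'M[R]_(m, n)) (Y : R -> 'M[R]_(n, q)) L K :
  mcvg X L -> mcvg Y K -> mcvg (fun e => X e *m Y e) (L *m K).
Proof.
move=> h k i j; rewrite mxE; under eq_fun do rewrite mxE.
by apply: cvg_bigsum => l; exact: cvgM.
Qed.

Lemma mcvg_tr m n (X : R -> 'M[R]_(m, n)) L : mcvg X L -> mcvg (fun e => (X e)^T) L^T.
Proof. by move=> h i j; rewrite mxE; under eq_fun do rewrite mxE; exact: h. Qed.

Lemma cvg_det n (X : R -> 'M[R]_n) L : mcvg X L -> \det (X e) @[e --> 0^'+] --> \det L.
Proof.
move=> h; apply: cvg_bigsum => s; apply: cvgM; first exact: cvg_cst.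
by apply: cvg_bigprod => i; exact: h.
Qed.

Lemma mcvg_adj n (X : R -> 'M[R]_n) L : mcvg X L -> mcvg (fun e => \adj (X e)) (\adj L).
Proof.
move=> h i j; rewrite mxE; under eq_fun do rewrite mxE.
apply: cvgM; first exact: cvg_cst.
apply: cvg_det => k l; rewrite !mxE; under eq_fun do rewrite !mxE; exact: h.
Qed.

Lemma near_unitmx n (X : R -> 'M[R]_n) L : mcvg X L -> L \in unitmx ->
  \forall e \near 0^'+, X e \in unitmx.
Proof.
move=> h; rewrite unitmxE unitfE => L0.
have nb : nbhs (\det L) [set x : R | x != 0].
  by apply: open_nbhs_nbhs; split; [exact: open_neq|].
have nd : \forall e \near 0^'+, \det (X e) != 0 by exact: (cvg_det h nb).
by near=> e; rewrite unitmxE unitfE; near: e.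
Unshelve. all: by end_near. Qed.

(** Cramer's formula. [invmx] is given by the adjugate only on invertible matrices, hence the
    passage to small [e]. *)
Lemma mcvg_inv n (X : R -> 'M[R]_n) L : mcvg X L -> L \in unitmx ->
  mcvg (fun e => invmx (X e)) (invmx L).
Proof.
move=> h uL; have nu := near_unitmx h uL.
have : mcvg (fun e => (\det (X e))^-1 *: \adj (X e)) (invmx L).
  rewrite /invmx uL; apply: mcvgZ; last exact: mcvg_adj.
  by apply: cvgV; [rewrite -unitfE -unitmxE|exact: cvg_det].
move=> k i j; have := k i j; apply: cvg_trans; apply: near_eq_cvg.
by near=> e; rewrite /invmx ifT//; near: e.
Unshelve. all: by end_near. Qed.

End MatrixLimits.

Section Subspace.
Variables (F : fieldType) (n : nat) (V : 'cV[F]_n -> Prop).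
Hypotheses (V0 : V 0) (VP : forall a u v, V u -> V v -> V (a *: u + v)).

(* The rows of B are a row base of a matrix of maximal rank with rows in V. *)
Lemma subspace_basis : exists r (B : 'M[F]_(r, n)), row_free B /\
  forall v, V v <-> exists y : 'cV_r, v = B^T *m y.
Proof.
have Vsub (W : 'M[F]_n) : (forall i, V (row i W)^T) ->
    forall u : 'rV_n, (u <= W)%MS -> V u^T.
  move=> hW u /submxP[a ->]; rewrite mulmx_sum_row linear_sum/=.
  by elim/big_ind: _ => // [x y hx hy|i _];
    [rewrite -[x]scale1r; exact: VP|rewrite linearZ/= -[_ *: _]addr0; exact: VP].
pose Q r := `[< exists W : 'M[F]_n, (forall i, V (row i W)^T) /\ \rank W = r >].
have exQ : exists r, Q r.
  by exists 0%N; apply/asboolP; exists 0; split=> [i|]; rewrite ?mxrank0// row0 trmx0.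
have ubQ r : Q r -> (r <= n)%N by move=> /asboolP[W [_ <-]]; exact: rank_leq_row.
case: (ex_maxnP exQ ubQ) => r /asboolP[W [hW rW]] maxr.
exists (\rank W), (row_base W); split; first exact: row_base_free.
move=> v; split.
  move=> Vv; suff /submxP[a e] : (v^T <= row_base W)%MS.
    by exists a^T; rewrite -trmx_mul -e trmxK.
  (* Adding [v] to the row space of [W] stays within [V]; by maximality the rank cannot grow, so [v]
     was already there. *)
  rewrite eq_row_base; have h : forall i, V (row i (W + v^T)%MS)^T.
    move=> i; have : (row i (W + v^T)%MS <= W + v^T)%MS by exact: row_sub.
    case/sub_addsmxP => -[a b] -> /=; rewrite linearD/= -[_^T]scale1r; apply: VP.
      by apply: (Vsub _ hW); exact: submxMl.
    rewrite [b]mx11_scalar mul_scalar_mx linearZ/= trmxK -[_ *: _]addr0; exact: VP.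
  have : (\rank (W + v^T)%MS <= r)%N by apply: maxr; apply/asboolP; exists (W + v^T)%MS.
  rewrite -rW => le; have := mxrank_leqif_sup (addsmxSl W v^T).
  move=> [_]; rewrite eqn_leq le (mxrankS (addsmxSl _ _)) => /esym h2.
  exact: submx_trans (addsmxSr W v^T) h2.
move=> [y ->]; have -> : (row_base W)^T *m y = (y^T *m row_base W)^T.
  by rewrite -[y in LHS]trmxK -trmx_mul.
by apply: (Vsub _ hW); rewrite -(eq_row_base W) submxMl.
Qed.

End Subspace.

Section StatePerturbation.
Variables (R : realType) (T : mesh R) (P : problem R (nnodes T)).
Variable hat : 'I_(nnodes T) -> pt R -> R.
Implicit Types (psi : pt R -> R) (u v w p : 'cV[R]_(nnodes T)).

Local Notation V := (vanishes_GammaD P hat).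

Lemma femfun_lin a u v x :
  femfun hat (a *: u + v) x = a * femfun hat u x + femfun hat v x.
Proof.
rewrite /femfun mulr_sumr -big_split/=; apply: eq_bigr => i _.
by rewrite !mxE mulrDl mulrA.
Qed.

Lemma vanishes0 : V 0.
Proof. by move=> x _; rewrite /femfun big1// => i _; rewrite mxE mul0r. Qed.

Lemma vanishesP a u v : V u -> V v -> V (a *: u + v).
Proof. by move=> hu hv x Gx; rewrite femfun_lin hu// hv// mulr0 addr0. Qed.

Definition definite_on_test (A : 'M[R]_(nnodes T)) :=
  forall v, V v -> v^T *m (A *m v) = 0 -> v = 0.

Lemma galerkin_unique (A : 'M[R]_(nnodes T)) v : definite_on_test A -> V v ->
  (forall w, V w -> w^T *m (A *m v) = 0) -> v = 0.
Proof. by move=> dA Vv h; apply: dA => //; exact: h. Qed.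

Variables (phi : pt R -> R) (u : 'cV[R]_(nnodes T)).
Hypothesis hu : is_state P hat phi u.
Hypothesis dA : definite_on_test (Amx P hat phi).

Lemma stateE : state P hat phi = u.
Proof.
apply: xget_unique => // v [hb hv]; apply/eqP; rewrite -subr_eq0; apply/eqP.
have [ub uv] := hu.
apply: (galerkin_unique dA).
  by move=> x Gx; rewrite addrC -scaleN1r femfun_lin hb// ub// mulN1r addNr.
by move=> w Vw; rewrite !mulmxBr hv// uv// subrr.
Qed.

Variables (phie : R -> pt R -> R) (h : R -> R).
Hypotheses (h0 : \forall e \near 0^'+, 0 < h e) (hl : h e @[e --> 0^'+] --> (0 : R)).
Variables (A' : 'M[R]_(nnodes T)) (f' : 'cV[R]_(nnodes T)).
Hypothesis cA : mcvg (fun e => (h e)^-1 *: (Amx P hat (phie e) - Amx P hat phi)) A'.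
Hypothesis cf : mcvg (fun e => (h e)^-1 *: (fvec P hat (phie e) - fvec P hat phi)) f'.

Lemma mcvg_near m n (X Y : R -> 'M[R]_(m, n)) L :
  (\forall e \near 0^'+, X e = Y e) -> mcvg X L -> mcvg Y L.
Proof.
move=> E k i j; have := k i j; apply: cvg_trans; apply: near_eq_cvg.
by near=> e; rewrite (near E).
Unshelve. all: by end_near. Qed.

(** In coordinates of the test space the increment solves a system with matrix [G e], whose right
    side is linear in the increments of the data. Definiteness makes [G0] invertible, hence [G e]
    for small [e]. This yields existence and uniqueness of the perturbed state, and continuity of
    the inverse yields the limit. *)
Lemma state_increment : exists W,
  mcvg (fun e => (h e)^-1 *: (state P hat (phie e) - u)) W /\
  \forall e \near 0^'+, V (state P hat (phie e) - u) /\
    forall v, V v -> v^T *m (Amx P hat (phie e) *m state P hat (phie e)) =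
                     v^T *m fvec P hat (phie e).
Proof.
have [r [B [rB HB]]] := subspace_basis vanishes0 vanishesP.
pose G e := B *m Amx P hat (phie e) *m B^T.
pose G0 := B *m Amx P hat phi *m B^T.
have VB y : V (B^T *m y) by apply/HB; exists y.
(* A left kernel vector [y] of [G0] gives the test vector [(y *m B)^T], on which the quadratic form
   vanishes. *)
have uG0 : G0 \in unitmx.
  rewrite -row_free_unit -kermx_eq0; apply/eqP/row_matrixP => i; rewrite row0.
  have : row i (kermx G0) *m G0 = 0 by apply/sub_kermxP; exact: row_sub.
  set y := row i _ => yG.
  have : y *m B = 0.
    apply: trmx_inj; rewrite trmx0 trmx_mul; apply: dA; first exact: VB.
    have := congr1 (fun z => z *m y^T) yG; rewrite mul0mx => <-.
    by rewrite trmx_mul !trmxK /G0 !mulmxA.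
  by move=> yB; apply: (row_free_inj rB); rewrite yB mul0mx.
have cAe : mcvg (fun e => Amx P hat (phie e)) (Amx P hat phi).
  have : mcvg (fun e => h e *: ((h e)^-1 *: (Amx P hat (phie e) - Amx P hat phi)) + Amx P hat phi)
     (0 *: A' + Amx P hat phi) by apply: mcvgD; [exact: mcvgZ|exact: mcvg_cst].
  rewrite scale0r add0r; apply: mcvg_near; near=> e.
  by rewrite scalerA divff ?scale1r ?subrK// gt_eqF//; near: e.
have cG : mcvg G G0 by apply: mcvgM; [apply: mcvgM|]; rewrite //; exact: mcvg_cst.
have nG := near_unitmx cG uG0.
(* The perturbed equation minus the equation for [u], solved within the test space. *)
pose w e := B^T *m (invmx (G e) *m (B *m
  (fvec P hat (phie e) - fvec P hat phi - (Amx P hat (phie e) - Amx P hat phi) *m u))).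
have [ub uv] := hu.
have Buv : B *m (Amx P hat phi *m u) = B *m fvec P hat phi.
  apply/row_matrixP => i; rewrite !row_mul.
  have Vi : V (row i B)^T.
    apply/HB; exists (delta_mx i 0); apply: trmx_inj.
    by rewrite trmx_mul !trmxK trmx_delta -rowE.
  by have := uv _ Vi; rewrite trmxK.
have VBtest (z : 'cV[R]_(nnodes T)) : (forall v, V v -> v^T *m z = 0) <-> B *m z = 0.
  split=> [H|H v /HB[y ->]]; last by rewrite trmx_mul trmxK -mulmxA H mulmx0.
  apply/row_matrixP => i; rewrite row_mul row0.
  have Vi : V (row i B)^T.
    apply/HB; exists (delta_mx i 0); apply: trmx_inj.
    by rewrite trmx_mul !trmxK trmx_delta -rowE.
  by have := H _ Vi; rewrite trmxK.
have wsol : \forall e \near 0^'+, state P hat (phie e) = u + w e /\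
   B *m (Amx P hat (phie e) *m (u + w e) - fvec P hat (phie e)) = 0.
  near=> e; have uGe : G e \in unitmx by near: e.
  have Ew : B *m (Amx P hat (phie e) *m (u + w e) - fvec P hat (phie e)) = 0.
    set Ae := Amx P hat (phie e); set A := Amx P hat phi.
    pose b := fvec P hat (phie e) - fvec P hat phi - (Ae - A) *m u.
    have BAw : B *m (Ae *m w e) = B *m b.
      by rewrite /w !mulmxA -/(G e) mulmxV// mul1mx.
    have -> : Ae *m (u + w e) - fvec P hat (phie e) =
        (A *m u - fvec P hat phi) + (Ae *m w e - b).
      rewrite /b mulmxDr mulmxBl.
      move: (Ae *m u) (Ae *m w e) (A *m u) (fvec _ _ _) (fvec _ _ _) => x1 x2 x3 x4 x5.
      by apply/matrixP => i j; rewrite !mxE; ring.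
    by rewrite mulmxDr mulmxBr Buv subrr add0r mulmxBr BAw subrr.
  split => //; apply: xget_unique.
    split.
      move=> x Gx; rewrite -[u]scale1r femfun_lin mul1r ub//.
      by have := VB (invmx (G e) *m _) x Gx; rewrite -/(w e) => ->; rewrite addr0.
    move=> v Vv; apply/eqP; rewrite -subr_eq0 -mulmxBr; apply/eqP.
    exact: (proj2 (VBtest _) Ew).
  move=> v [vb vv].
  have /HB[y Ey] : V (v - u).
    by move=> x Gx; rewrite addrC -scaleN1r femfun_lin vb// ub// mulN1r addNr.
  have Ev : B *m (Amx P hat (phie e) *m v - fvec P hat (phie e)) = 0.
    by apply/VBtest => z Vz; rewrite mulmxBr vv// subrr.
  have {}Ev : B *m (Amx P hat (phie e) *m (v - (u + w e))) = 0.
    have -> : Amx P hat (phie e) *m (v - (u + w e)) =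
        (Amx P hat (phie e) *m v - fvec P hat (phie e))
      - (Amx P hat (phie e) *m (u + w e) - fvec P hat (phie e)).
      by rewrite opprB addrA subrK mulmxBr.
    by rewrite mulmxBr Ev Ew subrr.
  have E2 : v - (u + w e) = B^T *m (y - invmx (G e) *m (B *m
     (fvec P hat (phie e) - fvec P hat phi - (Amx P hat (phie e) - Amx P hat phi) *m u))).
    by rewrite mulmxBr -Ey opprD addrA.
  move: Ev; rewrite E2 !mulmxA -/(G e) => /(congr1 (mulmx (invmx (G e)))).
  rewrite mulmxA mulVmx// mul1mx mulmx0 => y0.
  apply/eqP; rewrite -subr_eq0 E2; apply/eqP.
  by move: y0; rewrite -!mulmxA => ->; rewrite mulmx0.
have w1 : \forall e \near 0^'+, state P hat (phie e) = u + w e by apply: filterS wsol => e [].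
have w2 : \forall e \near 0^'+, B *m (Amx P hat (phie e) *m (u + w e) - fvec P hat (phie e)) = 0.
  by apply: filterS wsol => e [].
exists (B^T *m (invmx G0 *m (B *m (f' - A' *m u)))); split.
  apply: (@mcvg_near _ _ (fun e => B^T *m (invmx (G e) *m (B *m
    ((h e)^-1 *: (fvec P hat (phie e) - fvec P hat phi) -
     ((h e)^-1 *: (Amx P hat (phie e) - Amx P hat phi)) *m u))))).
    near=> e; rewrite (near w1)//.
    by rewrite [u + w e]addrC addrK /w -scalemxAl -scalerBr -!scalemxAr.
  apply: mcvgM; first exact: mcvg_cst.
  apply: mcvgM; first exact: mcvg_inv.
  apply: mcvgM; first exact: mcvg_cst.
  apply: mcvgD => //; apply: mcvgN; apply: mcvgM => //; exact: mcvg_cst.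
near=> e; rewrite (near w1)//; split.
  by rewrite [u + w e]addrC addrK; exact: VB.
move=> v Vv; apply/eqP; rewrite -subr_eq0 -mulmxBr; apply/eqP.
by apply/(proj2 (VBtest _)) => //; near: e.
Unshelve. all: by end_near. Qed.

End StatePerturbation.

(** * Elimination of the state increment by the adjoint *)

Section CostDerivative.
Variables (R : realType) (T : mesh R) (P : problem R (nnodes T)).
Variable hat : 'I_(nnodes T) -> pt R -> R.
Implicit Types (psi : pt R -> R) (v w : 'cV[R]_(nnodes T)).

(* The adjoint equation is only used for the test function [ue - u]. *)
Lemma adjoint_increment (A Ae M Me : 'M[R]_(nnodes T))
    (f fe u ue p uh : 'cV[R]_(nnodes T)) (c : R) :
  M^T = M ->
  (ue - u)^T *m (A^T *m p) = (ue - u)^T *m (- (2 * c) *: (M *m (u - uh))) ->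
  p^T *m (A *m u) = p^T *m f -> p^T *m (Ae *m ue) = p^T *m fe ->
  c *: ((ue - uh)^T *m Me *m (ue - uh) - (u - uh)^T *m M *m (u - uh)) =
  p^T *m ((Ae - A) *m ue) - p^T *m (fe - f)
  + c *: ((ue - uh)^T *m (Me - M) *m (ue - uh) + (ue - u)^T *m M *m (ue - u)).
Proof.
move=> sM ha hu hue; pose d := u - uh; pose w := ue - u.
have -> : ue - uh = d + w by rewrite /d /w [RHS]addrC addrA subrK.
rewrite -/d -/w.
have tr1 (z : 'M[R]_1) : z^T = z by rewrite [z]mx11_scalar tr_scalar_mx.
have dw : d^T *m M *m w = w^T *m M *m d.
  by rewrite -[LHS]tr1 !trmx_mul trmxK sM mulmxA.
have pAw : p^T *m (A *m w) = - (2 * c) *: (w^T *m M *m d).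
  by rewrite -[LHS]tr1 !trmx_mul trmxK -mulmxA ha -scalemxAr mulmxA.
have pA : p^T *m (A *m ue) = p^T *m (A *m w) + p^T *m f.
  by rewrite -hu -mulmxDr -mulmxDr /w subrK.
have q1 : (d + w)^T *m (Me - M) *m (d + w) = (d + w)^T *m Me *m (d + w) - (d + w)^T *m M *m (d + w).
  by rewrite mulmxBr mulmxBl.
have q2 : (d + w)^T *m M *m (d + w) =
    d^T *m M *m d + w^T *m M *m d + (w^T *m M *m d + w^T *m M *m w).
  have -> : (d + w)^T = d^T + w^T by apply/matrixP => i j; rewrite !mxE.
  rewrite mulmxDl mulmxDr !mulmxDl dw.
  move: (w^T *m M *m d) (w^T *m M *m w) (d^T *m M *m d) => x1 x2 x3.
  by apply/matrixP => i j; rewrite !mxE; ring.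
have q3 : p^T *m ((Ae - A) *m ue) = p^T *m fe - (- (2 * c) *: (w^T *m M *m d) + p^T *m f).
  by rewrite mulmxBl mulmxBr pA pAw hue.
rewrite q1 q2 q3 [p^T *m (fe - f)]mulmxBr.
move: (w^T *m M *m d) (w^T *m M *m w) (d^T *m M *m d) ((d + w)^T *m Me *m (d + w))
  (p^T *m fe) (p^T *m f).
by move=> x1 x2 x3 x4 x5 x6; apply/matrixP => i j; rewrite !mxE; ring.
Qed.

Local Notation V := (vanishes_GammaD P hat).
Variables (phi : pt R -> R) (u p : 'cV[R]_(nnodes T)).
Hypothesis hu : is_state P hat phi u.
Hypothesis hp : is_adjoint P hat phi u p.
Hypothesis dA : definite_on_test P hat (Amx P hat phi).

Lemma Mtmx_sym psi : (Mtmx P hat psi)^T = Mtmx P hat psi.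
Proof.
apply/matrixP => i j; rewrite !mxE; congr (integral2 _ _); apply: funext => x.
by rewrite mulrAC.
Qed.

Variables (phie : R -> pt R -> R) (h : R -> R).
Hypotheses (h0 : \forall e \near 0^'+, 0 < h e) (hl : h e @[e --> 0^'+] --> (0 : R)).
Variables (A' M' : 'M[R]_(nnodes T)) (f' : 'cV[R]_(nnodes T)) (a' S : R).
Hypothesis cA : mcvg (fun e => (h e)^-1 *: (Amx P hat (phie e) - Amx P hat phi)) A'.
Hypothesis cf : mcvg (fun e => (h e)^-1 *: (fvec P hat (phie e) - fvec P hat phi)) f'.
Hypothesis cM : mcvg (fun e => (h e)^-1 *: (Mtmx P hat (phie e) - Mtmx P hat phi)) M'.
Hypothesis ca : (area (Omega T (phie e)) - area (Omega T phi)) / h e @[e --> 0^'+] --> a'.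
Hypothesis cS : area (symdiff (Omega T (phie e)) (Omega T phi)) / h e @[e --> 0^'+] --> S.
Hypothesis S0 : S != 0.

Lemma cost_derivative :
  (cost P hat (phie e) - cost P hat phi) / area (symdiff (Omega T (phie e)) (Omega T phi))
  @[e --> 0^'+] -->
  (c1 P * a' + ((p^T *m (A' *m u)) 0 0 - (p^T *m f') 0 0) +
   c2 P * ((u - uhat P)^T *m M' *m (u - uhat P)) 0 0) / S.
Proof.
have [W [cW nW]] := state_increment hu dA h0 hl cA cf.
have sE := stateE hu dA.
pose ue e := state P hat (phie e).
have cw : mcvg (fun e => ue e - u) 0.
  have : mcvg (fun e => h e *: ((h e)^-1 *: (ue e - u))) (0 *: W) by exact: mcvgZ.
  rewrite scale0r; apply: mcvg_near; near=> e.
  by rewrite scalerA divff ?scale1r// gt_eqF//; near: e.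
have cu : mcvg ue u.
  have : mcvg (fun e => (ue e - u) + u) (0 + u) by apply: mcvgD => //; exact: mcvg_cst.
  by rewrite add0r; apply: mcvg_near; near=> e; rewrite subrK.
(* The increment of the tracking term over [h], rewritten by the adjoint equation. In the last
   summand the inverse of [h] is placed on one copy of [ue e - u], which then converges, while the
   other copy tends to 0. *)
pose num e := p^T *m (((h e)^-1 *: (Amx P hat (phie e) - Amx P hat phi)) *m ue e)
  - p^T *m ((h e)^-1 *: (fvec P hat (phie e) - fvec P hat phi))
  + c2 P *: ((ue e - uhat P)^T *m ((h e)^-1 *: (Mtmx P hat (phie e) - Mtmx P hat phi))
                *m (ue e - uhat P)
     + (ue e - u)^T *m Mtmx P hat phi *m ((h e)^-1 *: (ue e - u))).
have cnum : mcvg num (p^T *m (A' *m u) - p^T *m f' +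
   c2 P *: ((u - uhat P)^T *m M' *m (u - uhat P) + 0^T *m Mtmx P hat phi *m W)).
  rewrite /num; apply: mcvgD.
    apply: mcvgD; first by apply: mcvgM; [exact: mcvg_cst|exact: mcvgM].
    by apply: mcvgN; apply: mcvgM => //; exact: mcvg_cst.
  apply: mcvgZ; first exact: cvg_cst.
  have cd : mcvg (fun e => ue e - uhat P) (u - uhat P).
    by apply: mcvgD => //; exact: mcvg_cst.
  apply: mcvgD; first by apply: mcvgM => //; apply: mcvgM => //; exact: mcvg_tr.
  by apply: mcvgM => //; apply: mcvgM; [exact: mcvg_tr|exact: mcvg_cst].
have lim : (c1 P * ((area (Omega T (phie e)) - area (Omega T phi)) / h e) + num e 0 0) /
    (area (symdiff (Omega T (phie e)) (Omega T phi)) / h e) @[e --> 0^'+] -->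
  (c1 P * a' + ((p^T *m (A' *m u)) 0 0 - (p^T *m f') 0 0) +
   c2 P * ((u - uhat P)^T *m M' *m (u - uhat P)) 0 0) / S.
  apply: cvgM; last exact: cvgV.
  rewrite -addrA; apply: cvgD; first by apply: cvgM => //; exact: cvg_cst.
  have := cnum 0 0; rewrite trmx0 !mul0mx addr0.
  move: (p^T *m _) (p^T *m f') (_ *m (u - uhat P)) => y1 y2 y3.
  by rewrite !mxE.
apply: cvg_trans lim; apply: near_eq_cvg; near=> e.
have he : 0 < h e by near: e.
have [Vw ueq] : V (ue e - u) /\
    forall v, V v -> v^T *m (Amx P hat (phie e) *m ue e) = v^T *m fvec P hat (phie e).
  by near: e.
have [Vp pe] := hp.
have -> : num e 0 0 = (h e)^-1 * (c2 P *
    (((ue e - uhat P)^T *m Mtmx P hat (phie e) *m (ue e - uhat P)) 0 0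
     - ((u - uhat P)^T *m Mtmx P hat phi *m (u - uhat P)) 0 0)).
  transitivity (((h e)^-1 *: (c2 P *: ((ue e - uhat P)^T *m Mtmx P hat (phie e) *m (ue e - uhat P)
     - (u - uhat P)^T *m Mtmx P hat phi *m (u - uhat P)))) 0 0); last first.
    by move: (_ *m (ue e - uhat P)) (_ *m (u - uhat P)) => z1 z2; rewrite !mxE.
  have -> := adjoint_increment (Mtmx P hat (phie e)) (Mtmx_sym phi) (pe _ Vw)
    (hu.2 _ Vp) (ueq _ Vp).
  rewrite /num -!scalemxAl -!scalemxAr -!scalemxAl.
  move: (p^T *m _) (p^T *m _) (_ *m (ue e - uhat P)) (_ *m (ue e - u)) => z1 z2 z3 z4.
  by rewrite !mxE; ring.
rewrite /cost sE -/(ue e).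
set Z1 := fun_of_matrix _ 0 0; set Z2 := fun_of_matrix _ 0 0.
(* If the symmetric difference has area 0, both quotients are 0, since [0^-1 = 0]. *)
have [->|D0] := eqVneq (area (symdiff (Omega T (phie e)) (Omega T phi))) 0.
  by rewrite mul0r !invr0 !mulr0.
by field; rewrite D0 gt_eqF.
Unshelve. all: by end_near. Qed.

End CostDerivative.

(** * Integrals over the mesh *)

Section PlaneOpen.
Variable R : realType.
Local Notation mR := (measurableTypeR R).

(** Links the product topology to the product sigma-algebra: an open set is the countable union of
    the boxes with rational centres and half-widths [1 / (n + 1)] that it contains. *)
Lemma open_measurable2 (A : set (pt R)) : open A -> measurable (A : set (mR * mR)).
Proof.
move=> oA.
pose box (p q : rat) (n : nat) : set (mR * mR) :=
  `]ratr p - n.+1%:R^-1, ratr p + n.+1%:R^-1[ `*` `]ratr q - n.+1%:R^-1, ratr q + n.+1%:R^-1[.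
pose F p q n := if `[< box p q n `<=` A >] then box p q n else set0.
have -> : A = \bigcup_p \bigcup_q \bigcup_n F p q n.
  apply/seteqP; split => [x Ax|x [p _ [q _ [n _]]]]; last first.
    by rewrite /F; case: asboolP => // h /h.
  have : nbhs x A by exact: open_nbhs_nbhs.
  rewrite -nbhs_ballE => -[e /= e0 he].
  have [n hn] : exists n, n.+1%:R^-1 < e / 2.
    near \oo => n; exists n; near: n.
    by apply: (near_infty_natSinv_lt (PosNum (divr_gt0 e0 (ltr0n _ 2)))).
  set d : R := n.+1%:R^-1 in hn.
  have d0 : 0 < d by rewrite invr_gt0.
  have [p] := @rat_in_itvoo R (x.1 - d) (x.1 + d) ltac:(lra).
  rewrite in_itv/= => /andP[p1 p2].
  have [q] := @rat_in_itvoo R (x.2 - d) (x.2 + d) ltac:(lra).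
  rewrite in_itv/= => /andP[q1 q2].
  exists p => //; exists q => //; exists n => //; rewrite /F ifT.
    by rewrite /box -/d; split; rewrite /= in_itv/=; apply/andP; split; lra.
  apply/asboolP => -[y1 y2] []; rewrite -/d /= !in_itv/= => /andP[h1 h2] /andP[h3 h4].
  by apply: he; split; rewrite /ball/= ltr_norml; apply/andP; split; lra.
apply: bigcupT_measurable_rat => p; apply: bigcupT_measurable_rat => q.
apply: bigcupT_measurable => n; rewrite /F; case: ifP => // _.
by apply: measurableX.
Unshelve. all: by end_near. Qed.

Lemma closed_measurable2 (A : set (pt R)) : closed A -> measurable (A : set (mR * mR)).
Proof.
move=> /closed_openC/open_measurable2 h.
by rewrite -[X in measurable X]setCK; exact: measurableC.
Qed.

End PlaneOpen.

Section MeshGeometry.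
Variables (R : realType) (T : mesh R).
Hypothesis hT : conforming_mesh T.
Implicit Types (k i : 'I_(nnodes T)) (l : 'I_(ntris T)) (j : 'I_3).

Definition nodes3 (V : 'I_3 -> 'I_(nnodes T)) (j : 'I_3) : pt R := node (V j).

Lemma det_Jmat V : \det (Jmat V) = det3 (nodes3 V).
Proof.
rewrite (expand_det_row _ 0) !big_ord_recl big_ord0 addr0 /cofactor !det_mx11 !mxE /crd/=.
rewrite /bump/= expr0 expr1 mul1r mulN1r mulrN /det3 /nodes3.
have -> : lift ord0 (0 : 'I_2) = 1 :> 'I_3 by apply: val_inj.
have -> : lift ord0 (lift 0 0 : 'I_2) = 2%:R :> 'I_3 by apply: val_inj.
have -> : ord0 = 0 :> 'I_3 by [].
by have -> : lift 0 (lift (lift ord0 ord0 : 'I_2) 0) = 1 :> 'I_3 by apply: val_inj.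
Qed.

Lemma det3_vtx_gt0 l : 0 < det3 (nodes3 (vtx l)).
Proof. by have [_ _ h _ _] := hT; rewrite -det_Jmat. Qed.

Lemma tauE l : tau l = tri (nodes3 (vtx l)).
Proof. by []. Qed.

Lemma lnode_rot k l : exists r, lnode k l = rot3 r (vtx l).
Proof. by exists (odflt 0 [pick i | vtx l i == k]). Qed.

Lemma det3_lnode_gt0 k l : 0 < det3 (nodes3 (lnode k l)).
Proof.
have [r ->] := lnode_rot k l.
have := det3_rot (nodes3 (vtx l)) r; rewrite /rot3 /nodes3 => ->.
exact: det3_vtx_gt0.
Qed.

Lemma det3_lnode k l : det3 (nodes3 (lnode k l)) != 0.
Proof. by rewrite gt_eqF// det3_lnode_gt0. Qed.

Lemma tau_lnode k l : tau l = tri (nodes3 (lnode k l)).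
Proof.
have [r ->] := lnode_rot k l; rewrite tauE -(tri_rot r)//.
by rewrite gt_eqF// det3_vtx_gt0.
Qed.

Lemma vtx_inj l : injective (@vtx R T l).
Proof.
move=> i j e; have := det3_vtx_gt0 l => /gt_eqF/negbT D0.
have := bary_vertex i j D0; rewrite /nodes3 e -/(nodes3 (vtx l) j) bary_vertex// eqxx.
by case: eqVneq => // _ /eqP; rewrite oner_eq0.
Qed.

Lemma open_tau l : open (tau l).
Proof. by rewrite tauE; apply: open_tri; rewrite gt_eqF// det3_vtx_gt0. Qed.

Lemma tau_dom l : tau l `<=` dom T.
Proof.
move=> x tx; have : nbhs x (tau l) by apply: open_nbhs_nbhs; split => //; exact: open_tau.
by apply: filterS => y ty; exists l => //; exact: subset_closure.
Qed.

Lemma closure_tau_dom l : closure (tau l) `<=` closure (dom T).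
Proof. exact/closure_subset/tau_dom. Qed.

Lemma dom_closure_tau x : dom T x -> exists l, closure (tau l) x.
Proof. by move=> /interior_subset [l _ h]; exists l. Qed.

Lemma open_dom : open (dom T).
Proof. exact: open_interior. Qed.

Lemma node_closure_tau l j : closure (tau l) (node (vtx l j)).
Proof.
have D0 : det3 (nodes3 (vtx l)) != 0 by rewrite gt_eqF// det3_vtx_gt0.
rewrite tauE closure_tri// => i /=.
by rewrite -/(nodes3 (vtx l) j) bary_vertex.
Qed.

Lemma affine_comb a b c (I : finType) (t : I -> R) (y : I -> pt R) (f : pt R -> R) :
  (forall x, f x = a * x.1 + b * x.2 + c) -> \sum_i t i = 1 ->
  f (\sum_i t i *: y i) = \sum_i t i * f (y i).
Proof.
move=> fE t1; rewrite fE.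
have -> : (\sum_i t i *: y i).1 = \sum_i t i * (y i).1.
  by rewrite (big_morph (@fst R R) (id1 := 0) (op1 := +%R)).
have -> : (\sum_i t i *: y i).2 = \sum_i t i * (y i).2.
  by rewrite (big_morph (@snd R R) (id1 := 0) (op1 := +%R)).
rewrite -[c]mulr1 -t1 !mulr_sumr -!big_split/=; apply: eq_bigr => i _.
rewrite fE; ring.
Qed.

(** Conformity excludes hanging nodes. The node is vertex [j'] of some [l']; the corresponding
    barycentric coordinate is affine and equals 1 at the node, but would vanish on the hull of the
    common vertices if the node were not one of them. *)
Lemma node_in_closure k l : closure (tau l) (node k) -> exists j, vtx l j = k.
Proof.
move=> kl; have [ninj /(_ k)[l' [j' E]] _ conf _] := hT.
have [->|ll'] := eqVneq l l'; first by exists j'.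
have [_ H] := conf _ _ ll'.
have : (closure (tau l) `&` closure (tau l')) (node k).
  by split => //; rewrite -E; exact: node_closure_tau.
rewrite H => -[t [t0 tS t1 kE]].
have D0 : det3 (nodes3 (vtx l')) != 0 by rewrite gt_eqF// det3_vtx_gt0.
have [a [b [c bE]]] := interpE (nodes3 (vtx l')) (fun i : 'I_3 => (i == j')%:R : R).
have := congr1 (interp (nodes3 (vtx l')) (fun i : 'I_3 => (i == j')%:R : R)) kE.
rewrite (affine_comb _ bE t1).
rewrite -E -/(nodes3 (vtx l') j') interp_vertex// eqxx => e1.
apply: contrapT => nk; move/eqP: e1; rewrite big1 ?oner_eq0// => i _.
have [Si|nSi] := boolP ([pred i | (i \in codom (vtx l)) && (i \in codom (vtx l'))] i); last first.
  by rewrite tS// mul0r.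
move: Si => /= /andP[/codomP[m1 im1] /codomP[m im]].
rewrite [in interp _ _ _]im -/(nodes3 (vtx l') m) interp_vertex//.
case: eqVneq => [mj|_]; last by rewrite mulr0.
by case: nk; exists m1; rewrite -im1 im mj E.
Qed.

End MeshGeometry.

Section MeshFunctions.
Variables (R : realType) (T : mesh R).
Hypothesis hT : conforming_mesh T.
Implicit Types (k i : 'I_(nnodes T)) (l : 'I_(ntris T)) (j : 'I_3).
Implicit Types (v w : pt R -> R).

Let D0 k l := det3_lnode hT k l.

Lemma patchP k l : tri_patch k l <-> closure (tau l) (node k).
Proof. by rewrite /tri_patch/=; split => [/set_mem|/mem_set]. Qed.

Lemma lnode0 k l : tri_patch k l -> lnode k l 0 = k.
Proof.
move=> /patchP kl; have [j E] := node_in_closure hT kl; rewrite /lnode.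
case: pickP => [r /eqP <-|/(_ j)]; first by rewrite add0r.
by rewrite E eqxx.
Qed.

Lemma lnode_inj k l : injective (lnode k l).
Proof. by move=> i j /(vtx_inj hT) /addIr. Qed.

Lemma lnode_patch k l j : lnode k l j = k -> tri_patch k l.
Proof. by move=> <-; apply/patchP; exact: (node_closure_tau hT). Qed.

Lemma lnode_closure k l j : closure (tau l) (node (lnode k l j)).
Proof. exact: (node_closure_tau hT). Qed.

Lemma lnode_one_ring k l j : tri_patch k l -> one_ring k (lnode k l j).
Proof. by move=> kl; exists l => //; exact: lnode_closure. Qed.

Lemma exists_patch k : exists l, tri_patch k l.
Proof.
have [_ /(_ k)[l [j E]] _ _ _] := hT.
by exists l; apply/patchP; rewrite -E; exact: (node_closure_tau hT).
Qed.

(** Continuity on the closure of the domain carries the affine formula from the open triangle to its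
    vertices, where the coefficients are read off. *)
Lemma S1h_interp k l v : S1h T v -> forall x, closure (tau l) x ->
  v x = interp (nodes3 (lnode k l)) (fun j => v (node (lnode k l j))) x.
Proof.
move=> [cv /(_ l)[a [b [c E]]]] x tx.
pose g (x : pt R) := a * x.1 + b * x.2 + c.
have vg y : closure (tau l) y -> v y = g y.
  move=> ty; have dy := closure_tau_dom hT ty.
  have cf : {within closure (dom T), continuous (fun z => v z - g z)}.
    move=> z; apply: cvgB; first exact: cv.
    by apply: continuous_subspaceT => z'; exact: continuous_affine.
  apply/eqP; rewrite -subr_eq0; apply/negPn/negP => n0.
  have : nbhs (v y - g y) [set r : R | r != 0].
    by apply: open_nbhs_nbhs; split; [exact: open_neq|].
  move=> /(proj1 (subspace_continuousP _ _) cf y dy) nb.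
  have [z [tz]] := ty _ nb.
  move=> /(_ (subset_closure (tau_dom hT tz))).
  have E0 : v z - g z = 0 by rewrite E// subrr.
  by rewrite /from_subspace/= E0 eqxx.
rewrite vg// (affine_interp (f := g) (D0 k l) (fun=> erefl) x).
by apply: eq_bigr => j _; rewrite /= vg//; exact: lnode_closure.
Qed.

Lemma S1h_lin (c : R) v w : S1h T v -> S1h T w -> S1h T (fun x => v x + c * w x).
Proof.
move=> [cv av] [cw aw]; split.
  move=> z; apply: cvgD; first exact: cv.
  by apply: cvgM; [exact: cvg_cst|exact: cw].
move=> l; have [a1 [b1 [c1 E1]]] := av l; have [a2 [b2 [c2 E2]]] := aw l.
exists (a1 + c * a2), (b1 + c * b2), (c1 + c * c2) => x tx.
by rewrite E1// E2//; ring.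
Qed.

Lemma S1h_open_neg v : S1h T v -> open (Omega T v).
Proof.
move=> [cv _]; rewrite openE => x [dx vx].
have ox : nbhs x (dom T) by apply: open_nbhs_nbhs; split => //; exact: open_dom.
have nb : nbhs (v x) [set r : R | r < 0].
  by apply: open_nbhs_nbhs; split; [exact: open_lt|].
have nb2 := proj1 (subspace_continuousP _ _) cv x (subset_closure dx) _ nb.
rewrite /interior/=.
near=> y; have dy : dom T y by near: y.
split => //; have : closure (dom T) y -> v y < 0 by near: y; exact: nb2.
by apply; exact: subset_closure.
Unshelve. all: by end_near. Qed.

Variable hat : 'I_(nnodes T) -> pt R -> R.
Hypothesis hhat : hat_basis hat.

Definition ind3 k l i (j : 'I_3) : R := (i == lnode k l j)%:R.

Lemma hat_interp k l i x : closure (tau l) x ->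
  hat i x = interp (nodes3 (lnode k l)) (ind3 k l i) x.
Proof.
have [Si vi] := hhat i => tx; rewrite (S1h_interp k Si tx).
by apply: eq_bigr => j _; rewrite vi.
Qed.

Definition perturb_coef k (e : R) v : R :=
  if k \in Tminus (T := T) v then e - v (node k)
  else if k \in Tplus (T := T) v then - e - v (node k) else e.

Lemma perturbE k e v : perturb hat k e v = fun x => v x + perturb_coef k e v * hat k x.
Proof.
apply: funext => x; rewrite /perturb /perturb_coef.
by case: ifP => _; [|case: ifP => _ //]; ring.
Qed.

Lemma S1h_perturb k e v : S1h T v -> S1h T (perturb hat k e v).
Proof. by move=> Sv; rewrite perturbE; apply: S1h_lin => //; exact: (hhat k).1. Qed.

Lemma perturb_node k e v i :
  perturb hat k e v (node i) = v (node i) + perturb_coef k e v * (k == i)%:R.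
Proof. by rewrite perturbE (hhat k).2. Qed.

Lemma hat_ge0 i x : dom T x -> 0 <= hat i x.
Proof.
move=> /dom_closure_tau[l tl]; rewrite (hat_interp i i tl) /interp.
move: tl; rewrite (tau_lnode hT i) closure_tri// => b0.
by apply: sumr_ge0 => j _; rewrite mulr_ge0.
Qed.

End MeshFunctions.

Section MeshIntegral.
Variables (R : realType) (T : mesh R).
Hypothesis hT : conforming_mesh T.
Local Notation mR := (measurableTypeR R).
Local Notation mu := (@lebesgue_measure R).
Local Notation mu2 := (mu \x mu)%E.
Implicit Types (k i : 'I_(nnodes T)) (l : 'I_(ntris T)) (j : 'I_3).
Implicit Types (f g : mR * mR -> R).

Lemma interp1 (P : 'I_3 -> pt R) x : interp P (fun=> 1) x = 1.
Proof. by rewrite /interp -[RHS](sum_bary P x); apply: eq_bigr => j _; rewrite mul1r. Qed.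

Lemma tri_lty (P : 'I_3 -> pt R) : det3 P != 0 -> (mu2 (tri P) < +oo)%E.
Proof.
move=> DP; have [/(integrable_lty (measurable_tri DP)) + _] := integral_tri (fun=> 1) (fun=> 1) DP.
rewrite (eq_integral (cst 1%E)) ?integral_cst ?mul1e//; first exact: measurable_tri.
by move=> x _; rewrite /= !interp1 mulr1.
Qed.

Definition mesh_interior : set (mR * mR) := \big[setU/set0]_(l : 'I_(ntris T)) tau l.
Definition mesh_edges : set (mR * mR) := dom T `\` mesh_interior.

Lemma mesh_interiorP x : mesh_interior x <-> exists l, tau l x.
Proof.
rewrite /mesh_interior -bigcup_seq; split=> [[l _ h]|[l h]]; first by exists l.
by exists l => //=; rewrite mem_index_enum.
Qed.

Lemma measurable_tau l : measurable (tau l : set (mR * mR)).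
Proof. by rewrite tauE; apply: measurable_tri; rewrite gt_eqF// det3_vtx_gt0. Qed.

Lemma measurable_dom : measurable (dom T : set (mR * mR)).
Proof. by apply: open_measurable2; exact: open_dom. Qed.

Lemma measurable_mesh_interior : measurable mesh_interior.
Proof. by apply: bigsetU_measurable => l _; exact: measurable_tau. Qed.

Lemma measurable_mesh_edges : measurable mesh_edges.
Proof. by apply: measurableD; [exact: measurable_dom|exact: measurable_mesh_interior]. Qed.

Lemma measurable_closure_tau l : measurable (closure (tau l) : set (mR * mR)).
Proof.
by apply: closed_measurable2; exact: closed_closure.
Qed.

(** A point of the domain lies in some closed triangle; if it is in no open one, a barycentric
    coordinate vanishes there. So finitely many lines cover the edges. *)
Lemma mesh_edges_null : mu2 mesh_edges = 0%E.
Proof.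
apply: (measure_negligible measurable_mesh_edges).
pose Z : set (mR * mR) := \big[setU/set0]_(lj <- enum {: 'I_(ntris T) * 'I_3})
  [set x | bary (nodes3 (vtx lj.1)) lj.2 x = 0].
have nZ : mu2.-negligible Z.
  rewrite /Z; elim/big_ind: _ => [|X Y|[l j] _]; first exact: negligible_set0.
    exact: negligibleU.
  have DP : det3 (nodes3 (vtx l)) != 0 by rewrite gt_eqF// det3_vtx_gt0.
  apply/negligibleP; first by apply: measurable_eq0; exact: measurable_bary.
  rewrite bary_interp; apply: interp0_null => //; exists j.
  by rewrite eqxx oner_eq0.
apply: negligibleS nZ => x [dx nx]; have [l tl] := dom_closure_tau dx.
have DP : det3 (nodes3 (vtx l)) != 0 by rewrite gt_eqF// det3_vtx_gt0.
have b0 : forall j, 0 <= bary (nodes3 (vtx l)) j x.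
  by move: tl; rewrite tauE closure_tri.
have [j bj] : exists j, bary (nodes3 (vtx l)) j x = 0.
  apply: contrapT => nj; apply: nx; apply/mesh_interiorP; exists l.
  rewrite tauE triE// => j; rewrite lt_neqAle b0 andbT eq_sym; apply/eqP => e.
  by apply: nj; exists j.
by rewrite /Z -bigcup_seq; exists (l, j) => //=; rewrite mem_enum.
Qed.

Lemma dom_setU : dom T = mesh_interior `|` mesh_edges.
Proof.
rewrite /mesh_edges; apply/seteqP; split => x.
  by move=> dx; have [?|?] := pselect (mesh_interior x); [left|right].
by case=> [/mesh_interiorP[l]|[]//]; exact: (tau_dom hT).
Qed.

Lemma dom_lty : (mu2 (dom T) < +oo)%E.
Proof.
rewrite dom_setU; apply: le_lt_trans.
  exact: (measureU2 _ measurable_mesh_interior measurable_mesh_edges).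
rewrite [X in (_ + X)%E]mesh_edges_null adde0.
suff [] : measurable mesh_interior /\ (mu2 mesh_interior < +oo)%E by [].
rewrite /mesh_interior; elim/big_ind: _ => [|X Y [mX fX] [mY fY]|l _].
- by rewrite measure0.
- split; first exact: measurableU.
  by apply: le_lt_trans (measureU2 _ mX mY) _; exact: lte_add_pinfty.
- by split; [exact: measurable_tau|rewrite tauE; apply: tri_lty; rewrite gt_eqF// det3_vtx_gt0].
Qed.

(** Boundedness gives integrability on every measurable part of the domain and, unlike
    integrability, passes to products. *)
Definition tame f := measurable_fun (dom T) f /\ exists C, forall x, dom T x -> `|f x| <= C.

Lemma tame_integrable f (A : set (mR * mR)) : tame f -> measurable A -> A `<=` dom T ->
  mu2.-integrable A (EFin \o f).
Proof.
move=> [mf [C fC]] mA sA; have idf := bounded_integrable measurable_dom dom_lty mf fC.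
exact: integrableS measurable_dom mA sA idf.
Qed.

Lemma tameM f g : tame f -> tame g -> tame (fun x => f x * g x).
Proof.
move=> [mf [C fC]] [mg [E gE]]; split; first exact: measurable_funM.
by exists (C * E) => x dx; rewrite normrM ler_pM// ?fC ?gE.
Qed.

Lemma Rintegral_dom f : tame f ->
  Rintegral mu2 (dom T) f = \sum_(l : 'I_(ntris T)) Rintegral mu2 (tau l) f.
Proof.
move=> tf; have idf := tame_integrable tf measurable_dom (@subset_refl _ _).
rewrite /Rintegral (negligible_integral measurable_mesh_edges measurable_dom idf mesh_edges_null).
have -> : dom T `\` mesh_edges = mesh_interior.
  rewrite /mesh_edges setDD; apply/setIidr => x /mesh_interiorP[l]; exact: (tau_dom hT).
rewrite /mesh_interior integral_bigsetU_EFin//.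
- have H (l : 'I_(ntris T)) : (\int[mu2]_(x in tau l) (f x)%:E)%E = (Rintegral mu2 (tau l) f)%:E.
    rewrite /Rintegral fineK//; apply: integrable_fin_num; first exact: measurable_tau.
    by apply: tame_integrable => //; [exact: measurable_tau|exact: (tau_dom hT)].
  by under eq_bigr do rewrite H; rewrite sumEFin.
- exact: measurable_tau.
- exact: index_enum_uniq.
- apply/trivIsetP => l l' _ _ ll'.
  by have [_ _ _ c _] := hT; have [] := c _ _ ll'.
- apply/measurable_EFinP; apply: (measurable_funS measurable_dom _ tf.1).
  by move=> x /mesh_interiorP[l]; exact: (tau_dom hT).
Qed.

(* On the null set of mesh edges the pieces of f are the closed triangles. *)
Lemma measurable_pieces f :
  (forall l, exists g, measurable_fun setT g /\ forall x, tau l x -> f x = g x) ->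
  (forall l, exists g, measurable_fun setT g /\
     forall x, mesh_edges x -> closure (tau l) x -> f x = g x) ->
  measurable_fun (dom T) f.
Proof.
move=> /choice[g hg] /choice[h hh] _ Y mY.
have -> : dom T `&` f @^-1` Y =
    \bigcup_(l in [set: 'I_(ntris T)]) (tau l `&` g l @^-1` Y) `|`
    \bigcup_(l in [set: 'I_(ntris T)]) (mesh_edges `&` closure (tau l) `&` h l @^-1` Y).
  apply/seteqP; split => x.
    move=> [dx fx]; have [[l tl]|nl] := pselect (exists l, tau l x).
      by left; exists l => //; split => //=; rewrite -(hg l).2.
    have [l tl] := dom_closure_tau dx.
    have ex : mesh_edges x by split => // /mesh_interiorP.
    by right; exists l => //; split => //=; rewrite -(hh l).2.
  case=> -[l _ []].
    by move=> tl gx; split; [exact: (tau_dom hT tl)|rewrite /= (hg l).2].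
  by move=> [ex tl] hx; split; [exact: ex.1|rewrite /= (hh l).2].
apply: measurableU; apply: fin_bigcup_measurable; try exact: finite_finset.
  move=> l _; apply: measurableI; first exact: measurable_tau.
  by rewrite -[X in measurable X]setTI; apply: (hg l).1.
move=> l _; apply: measurableI.
  by apply: measurableI; [exact: measurable_mesh_edges|exact: measurable_closure_tau].
by rewrite -[X in measurable X]setTI; apply: (hh l).1.
Qed.

End MeshIntegral.

(** * Elementwise gradients *)

Section Gradients.
Variable R : realType.

Lemma derive_affine (f : pt R -> R) (a b c : R) (x v : pt R) :
  (\forall y \near x, f y = a * y.1 + b * y.2 + c) ->
  'D_v f x = a * v.1 + b * v.2.
Proof.
move=> fE; apply: cvg_lim => //.
have : (fun=> a * v.1 + b * v.2) h @[h --> (0 : R)^'] --> a * v.1 + b * v.2 by exact: cvg_cst.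
apply: cvg_trans; apply: near_eq_cvg.
have cx : h *: v + x @[h --> (0 : R)^'] --> x.
  have : h *: v + x @[h --> (0 : R)] --> (0 : R) *: v + x.
    by apply: cvgD; [apply: cvgZr_tmp; exact: cvg_id|exact: cvg_cst].
  by rewrite scale0r add0r; exact: cvg_within_filter.
have fx := nbhs_singleton fE.
near=> h; have -> : (f \o shift x) (h *: v) = a * (h *: v + x).1 + b * (h *: v + x).2 + c.
  by rewrite /=; near: h; exact: (cx _ fE).
rewrite fx !ptE; have h0 : h != 0 by near: h; exact: nbhs_dnbhs_neq.
by rewrite /GRing.scale/=; field.
Unshelve. all: by end_near. Qed.

Lemma gradient_affine (f : pt R -> R) (a b c : R) (x : pt R) :
  (\forall y \near x, f y = a * y.1 + b * y.2 + c) ->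
  gradient f x = \col_i (if i == 0 then a else b).
Proof.
move=> fE; apply/colP => i; rewrite !mxE (derive_affine _ fE)/=.
by case: i => -[|[|//]] ? /=; rewrite ?mulr0 ?mulr1 ?addr0 ?add0r.
Qed.

Lemma gradient_psi (j : 'I_3) : gradient (@psi R j) 0 =
  \col_i (if j == 0 then - 1 else (j == lift ord0 i)%:R).
Proof.
pose a : R := nth 0 [:: -1; 1; 0] j; pose b : R := nth 0 [:: -1; 0; 1] j.
pose c : R := nth 0 [:: 1; 0; 0] j.
rewrite (@gradient_affine _ a b c); last first.
  near=> y; rewrite /psi /a /b /c; case: j {a b c} => -[|[|[|//]]] ? /=; ring.
apply/colP => i; rewrite !mxE /a /b.
by case: j {a b c} => -[|[|[|//]]] ?; case: i => -[|[|//]] ?.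
Unshelve. all: by end_near. Qed.

End Gradients.

Section LocalGradient.
Variables (R : realType) (T : mesh R).
Hypothesis hT : conforming_mesh T.
Implicit Types (k i : 'I_(nnodes T)) (l : 'I_(ntris T)) (j : 'I_3).

Lemma Jl_unit k l : Jl k l \in unitmx.
Proof. by rewrite unitmxE unitfE det_Jmat det3_lnode. Qed.

(** The chain rule for the affine map from the reference triangle. It is checked after
    multiplication by the transposed Jacobian, where both sides are the differences of vertex values
    along the two edges from vertex 0. *)
Lemma gradient_local k l (f : pt R -> R) (v : 'I_3 -> R) x : tau l x ->
  (forall y, tau l y -> f y = interp (nodes3 (lnode k l)) v y) ->
  gradient f x = (invmx (Jl k l))^T *m \sum_j v j *: gradient (@psi R j) 0.
Proof.
move=> tx fE; have [a [b [c E]]] := interpE (nodes3 (lnode k l)) v.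
have D0 := det3_lnode hT k l.
rewrite (@gradient_affine _ _ a b c); last first.
  have : nbhs x (tau l) by apply: open_nbhs_nbhs; split => //; exact: (open_tau hT).
  by apply: filterS => y /fE ->; rewrite E.
rewrite trmx_inv; apply: (can_inj (mulKmx (_ : (Jl k l)^T \in unitmx))).
  by rewrite unitmx_tr Jl_unit.
rewrite mulKVmx ?unitmx_tr ?Jl_unit//.
have vE j : v j = a * (node (lnode k l j)).1 + b * (node (lnode k l j)).2 + c.
  by rewrite -(interp_vertex v j D0) E.
have h1 : lift ord0 (0 : 'I_2) = 1 :> 'I_3 by apply: val_inj.
have h2 : lift ord0 (1 : 'I_2) = 2%:R :> 'I_3 by apply: val_inj.
under eq_bigr do rewrite gradient_psi.
apply/colP => m; rewrite mxE summxE sum3 !big_ord_recl big_ord0 addr0.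
rewrite !mxE /crd/= !vE.
have [-> | ->] : m = 0 \/ m = 1.
  by case: m => -[|[|//]] ?; [left|right]; apply: val_inj.
  by rewrite h1 /=; ring.
by rewrite h2 /=; ring.
Qed.

End LocalGradient.

(** * Assembly of the discrete data from the elements *)

Section Assembly.
Variables (R : realType) (T : mesh R).
Hypothesis hT : conforming_mesh T.
Variable hat : 'I_(nnodes T) -> pt R -> R.
Hypothesis hhat : hat_basis hat.
Local Notation mR := (measurableTypeR R).
Local Notation mu := (@lebesgue_measure R).
Local Notation mu2 := (mu \x mu)%E.
Variable k : 'I_(nnodes T).
Implicit Types (i : 'I_(nnodes T)) (l : 'I_(ntris T)) (j : 'I_3).
Implicit Types (ps : pt R -> R).

Let D0 l := det3_lnode hT k l.

Definition ltri l : 'I_3 -> pt R := nodes3 (lnode k l).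

Lemma tame_of_interp (f : mR * mR -> R) (C : R) :
  (forall l, exists g, measurable_fun setT g /\
     forall x, closure (tau l) x -> dom T x -> f x = g x) ->
  (forall x, dom T x -> `|f x| <= C) -> tame T f.
Proof.
move=> h fC; split; last by exists C.
apply: (measurable_pieces hT) => l; have [g [mg fg]] := h l; exists g; split => // x.
  by move=> tx; apply: fg; [exact: subset_closure|exact: (tau_dom hT tx)].
by move=> [dx _] tx; exact: fg.
Qed.

Lemma hat_tame i : tame T (hat i).
Proof.
apply: (@tame_of_interp _ 3) => [l|x /dom_closure_tau[l tx]].
  exists (interp (ltri l) (ind3 k l i)); split; first exact: measurable_interp.
  by move=> x tx _; exact: (hat_interp hT hhat).
rewrite (hat_interp hT hhat k i tx) /interp sum3.
move: tx; rewrite (tau_lnode hT k) closure_tri// => b0.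
have s1 := sum_bary (nodes3 (lnode k l)) x; rewrite sum3 in s1.
have h j : 0 <= ind3 k l i j * bary (nodes3 (lnode k l)) j x <= 1.
  rewrite /ind3; case: eqP => _; rewrite ?mul1r ?mul0r ?lexx ?ler01// b0/=.
  by have := (b0 0, b0 1, b0 2%:R) => -[[? ?] ?]; move: j; apply: forall3; lra.
have := (h 0, h 1, h 2%:R) => -[[/andP[? ?] /andP[? ?]] /andP[? ?]].
by rewrite ger0_norm; lra.
Qed.

Lemma tau_Omega l ps : S1h T ps -> forall x, tau l x ->
  (x \in Omega T ps) = (interp (ltri l) (fun j => ps (node (lnode k l j))) x < 0).
Proof.
move=> Sp x tx; rewrite -(S1h_interp hT k Sp); last exact: subset_closure.
apply/idP/idP => [/set_mem[]//|px]; apply/mem_set; split => //.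
exact: (tau_dom hT tx).
Qed.

Lemma pw_tame ps (v1 v2 : R) : S1h T ps -> tame T (pw (Omega T ps) v1 v2).
Proof.
move=> Sp; apply: (@tame_of_interp _ (`|v1| + `|v2|)) => [l|x _].
  exists (fun x => if interp (ltri l) (fun j => ps (node (lnode k l j))) x < 0 then v1 else v2).
  split.
    apply: measurable_fun_ifT => //.
    by apply: measurable_fun_ltr => //; exact: measurable_interp.
  move=> x tx dx; rewrite /pw -(S1h_interp hT k Sp)//.
  case: ifPn => [/set_mem[_ ->]//|/negP h]; case: ifPn => // px.
  by case: h; apply/mem_set.
by rewrite /pw; case: ifP => _; rewrite ?lerDl ?lerDr.
Qed.

(** The constant gradient of hat function [i] on [tau l]; it is 0 if [i] is not a vertex of [tau l],
    as [ind3] then vanishes. *)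
Definition gvec l i : 'cV[R]_2 :=
  (invmx (Jl k l))^T *m \sum_j ind3 k l i j *: gradient (@psi R j) 0.

Lemma grad_hat l i x : tau l x -> grad T (hat i) x = gvec l i.
Proof.
move=> tx; rewrite /grad asboolT; last by exists l.
apply: (gradient_local hT tx) => y ty; apply: (hat_interp hT hhat).
exact: subset_closure.
Qed.

Definition gdot l i i' : R := ((gvec l i')^T *m gvec l i) 0 0.

Lemma gdot_tame i i' : tame T (fun x => ((grad T (hat i') x)^T *m grad T (hat i) x) 0 0).
Proof.
split.
  apply: (measurable_pieces hT) => l.
    exists (fun=> gdot l i i'); split; first exact: measurable_cst.
    by move=> x tx; rewrite !(grad_hat _ tx).
  exists (fun=> 0); split; first exact: measurable_cst.
  move=> x [_ nx] _; rewrite /grad !asboolF ?mulmx0 ?mxE//;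
    by move=> h; apply: nx; apply/mesh_interiorP.
exists (\sum_l `|gdot l i i'|) => x _.
have [[l tx]|nx] := pselect (exists l, tau l x).
  rewrite !(grad_hat _ tx) (bigD1 l)//= lerDl; exact: sumr_ge0.
rewrite /grad !asboolF// mulmx0 mxE normr0; exact: sumr_ge0.
Qed.

Lemma gdotE l i i' : gdot l i i' =
  \sum_a \sum_b ind3 k l i a * ind3 k l i' b * k0 k l a b.
Proof.
pose G a := (invmx (Jl k l))^T *m gradient (@psi R a) 0.
have gE i0 : gvec l i0 = \sum_a ind3 k l i0 a *: G a.
  by rewrite /gvec mulmx_sumr; apply: eq_bigr => a _; rewrite -scalemxAr.
rewrite /gdot !gE mulmx_sumr summxE; apply: eq_bigr => a _.
rewrite raddf_sum /= mulmx_suml summxE; apply: eq_bigr => b _ /=.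
have -> : (ind3 k l i' b *: G b)^T = ind3 k l i' b *: (G b)^T by apply/matrixP => ? ?; rewrite !mxE.
rewrite -scalemxAl -scalemxAr [LHS]mxE [X in _ * X]mxE mulrA [_ * ind3 k l i a]mulrC; congr (_ * _).
by rewrite [RHS]mxE.
Qed.

Definition lval ps l j : R := ps (node (lnode k l j)).

Definition tmass l (f g : 'I_3 -> R) : R := `|det3 (ltri l)| * mass f g.

Lemma integrable_tau_pw ps (v1 v2 : R) l (f g : 'I_3 -> R) : S1h T ps ->
  mu2.-integrable (tau l) (EFin \o
    (fun x => pw (Omega T ps) v1 v2 x * (interp (ltri l) f x * interp (ltri l) g x))).
Proof.
move=> Sp; pose h x := interp (ltri l) f x * interp (ltri l) g x.
have mt : measurable (tau l : set (mR * mR)) by exact: measurable_tau.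
have ih : mu2.-integrable (tau l) (EFin \o h).
  by rewrite (tau_lnode hT k); have [] := integral_tri f g (D0 l).
have [mpw _] := pw_tame v1 v2 Sp.
apply: (@le_integrable _ _ _ _ _ mt _ (fun x => (`|v1| + `|v2|)%:E * (h x)%:E)%E).
- apply/measurable_EFinP; apply: measurable_funM.
    exact: measurable_funS (measurable_dom T) (@tau_dom _ _ hT l) mpw.
  by apply: measurable_funTS; apply: measurable_funM; exact: measurable_interp.
- move=> x _; rewrite /= lee_fin !normrM ler_wpM2r//.
  rewrite [leRHS]ger0_norm ?addr_ge0//.
  by rewrite /pw; case: ifP => _; rewrite ?lerDl ?lerDr.
- exact: integrableZl.
Qed.

(** The weight is [v2] everywhere plus [v1 - v2] on the negative part, so the level set function
    enters only through one moment. *)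
Lemma integral_tau_pw ps (v1 v2 : R) l (f g : 'I_3 -> R) : S1h T ps ->
  Rintegral mu2 (tau l)
    (fun x => pw (Omega T ps) v1 v2 x * (interp (ltri l) f x * interp (ltri l) g x)) =
  v2 * tmass l f g + (v1 - v2) * moment (ltri l) (lval ps l) f g.
Proof.
move=> Sp; pose h x := interp (ltri l) f x * interp (ltri l) g x.
have tE := tau_lnode hT k l.
have mt : measurable (tau l : set (mR * mR)) by exact: measurable_tau.
have [ih eh] := integral_tri f g (D0 l).
pose A : set (mR * mR) := trineg (ltri l) (lval ps l).
have mA : measurable A by exact: (measurable_trineg _ (D0 l)).
have At : A `<=` tau l by rewrite tE => x [].
have Bt : tau l `\` A `<=` tau l by move=> x [].
have mB : measurable (tau l `\` A) by exact: measurableD.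
have tAB : tau l = A `|` (tau l `\` A).
  apply/seteqP; split => x; first by move=> tx; have [?|?] := pselect (A x); [left|right].
  by case=> [/At|[]].
rewrite -tE -/(h) in ih eh.
have disj : [disjoint A & tau l `\` A] by apply/disj_setPS => x [? []].
have iA : mu2.-integrable A (EFin \o h) by exact: integrableS ih.
have iB : mu2.-integrable (tau l `\` A) (EFin \o h) by exact: integrableS ih.
have AE x : A x -> pw (Omega T ps) v1 v2 x = v1.
  by move=> Ax; rewrite /pw (tau_Omega Sp (At _ Ax)) ifT//; exact: Ax.2.
have BE x : (tau l `\` A) x -> pw (Omega T ps) v1 v2 x = v2.
  move=> [tx nA]; rewrite /pw (tau_Omega Sp tx) ifN//; apply/negP => ax; apply: nA.
  by split => //; rewrite -/(ltri l) /ltri -tE.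
have ipw := integrable_tau_pw v1 v2 l f g Sp.
rewrite {1}tAB Rintegral_setU// -?tAB//.
rewrite (@eq_Rintegral _ _ _ mu2 A (fun x => v1 * h x)); last by move=> x /set_mem /AE ->.
rewrite (@eq_Rintegral _ _ _ mu2 (tau l `\` A) (fun x => v2 * h x)); last first.
  by move=> x /set_mem /BE ->.
rewrite !RintegralZl//.
have : Rintegral mu2 (tau l) h = Rintegral mu2 A h + Rintegral mu2 (tau l `\` A) h.
  by rewrite {1}tAB Rintegral_setU// -tAB.
rewrite eh /moment -/A -/h /tmass => e.
have -> : Rintegral mu2 (tau l `\` A) h = `|det3 (ltri l)| * mass f g - Rintegral mu2 A h.
  by rewrite -[X in X - _]/(`|det3 (nodes3 (lnode k l))| * mass f g) e addrC addKr.
ring.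
Qed.

Variable P : problem R (nnodes T).

Definition one3 (j : 'I_3) : R := 1.

Lemma interp_one3 l x : interp (ltri l) one3 x = 1.
Proof. exact: interp1. Qed.

(* The integral over tau_l of f g weighted by v1 in Omega and v2 outside. *)
Definition pwmoment (v1 v2 : R) ps l f g : R :=
  v2 * tmass l f g + (v1 - v2) * moment (ltri l) (lval ps l) f g.

Lemma hat_tau l i x : tau l x -> hat i x = interp (ltri l) (ind3 k l i) x.
Proof. by move=> tx; apply: (hat_interp hT hhat); exact: subset_closure. Qed.

Lemma hat_hat_integral ps (v1 v2 : R) i i' : S1h T ps ->
  integral2 (dom T) (fun x => pw (Omega T ps) v1 v2 x * hat i' x * hat i x) =
  \sum_l pwmoment v1 v2 ps l (ind3 k l i') (ind3 k l i).
Proof.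
move=> Sp; rewrite /integral2 (Rintegral_dom hT); last first.
  by apply: tameM; [apply: tameM; [exact: pw_tame|exact: hat_tame]|exact: hat_tame].
apply: eq_bigr => l _; rewrite /pwmoment -integral_tau_pw//.
by apply: eq_Rintegral => x /set_mem tx; rewrite !(hat_tau _ tx) mulrA.
Qed.

Lemma hat_integral ps (v1 v2 : R) i : S1h T ps ->
  integral2 (dom T) (fun x => pw (Omega T ps) v1 v2 x * hat i x) =
  \sum_l pwmoment v1 v2 ps l (ind3 k l i) one3.
Proof.
move=> Sp; rewrite /integral2 (Rintegral_dom hT); last first.
  by apply: tameM; [exact: pw_tame|exact: hat_tame].
apply: eq_bigr => l _; rewrite /pwmoment -integral_tau_pw//.
by apply: eq_Rintegral => x /set_mem tx; rewrite (hat_tau _ tx) interp_one3 mulr1.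
Qed.

Lemma grad_grad_integral ps (v1 v2 : R) l i i' : S1h T ps ->
  Rintegral mu2 (tau l) (fun x => pw (Omega T ps) v1 v2 x
    * ((grad T (hat i') x)^T *m grad T (hat i) x) 0 0) =
  pwmoment v1 v2 ps l one3 one3 * gdot l i i'.
Proof.
move=> Sp; rewrite /pwmoment -integral_tau_pw// -RintegralZr//.
- apply: eq_Rintegral => x /set_mem tx.
  by rewrite !(grad_hat _ tx) !interp_one3 !mulr1.
- exact: measurable_tau.
- exact: integrable_tau_pw.
Qed.

Lemma AmxE ps i i' : S1h T ps -> Amx P hat ps i i' =
  \sum_l (pwmoment (lambda1 P) (lambda2 P) ps l one3 one3 * gdot l i i'
          + pwmoment (alpha1 P) (alpha2 P) ps l (ind3 k l i') (ind3 k l i)).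
Proof.
move=> Sp; rewrite mxE /integral2.
have t1 : tame T (fun x => pw (Omega T ps) (lambda1 P) (lambda2 P) x
    * ((grad T (hat i') x)^T *m grad T (hat i) x) 0 0).
  by apply: tameM; [exact: pw_tame|exact: gdot_tame].
have t2 : tame T (fun x => pw (Omega T ps) (alpha1 P) (alpha2 P) x * hat i' x * hat i x).
  by apply: tameM; [apply: tameM; [exact: pw_tame|exact: hat_tame]|exact: hat_tame].
rewrite RintegralD; last 3 first.
- exact: measurable_dom.
- exact: (tame_integrable hT t1 (measurable_dom T)).
- exact: (tame_integrable hT t2 (measurable_dom T)).
rewrite big_split/=; congr (_ + _); last exact: hat_hat_integral.
by rewrite (Rintegral_dom hT)//; apply: eq_bigr => l _; exact: grad_grad_integral.
Qed.

Lemma fvecE ps i : S1h T ps -> fvec P hat ps i 0 =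
  \sum_l pwmoment (fsrc1 P) (fsrc2 P) ps l (ind3 k l i) one3.
Proof. by move=> Sp; rewrite mxE hat_integral. Qed.

Lemma MtmxE ps i i' : S1h T ps -> Mtmx P hat ps i i' =
  \sum_l pwmoment (talpha1 P) (talpha2 P) ps l (ind3 k l i') (ind3 k l i).
Proof. by move=> Sp; rewrite mxE hat_hat_integral. Qed.

(** The indicator of [Omega] is the weight with values 1 and 0, so the area falls under the same
    formula as the other data. *)
Lemma areaE ps : S1h T ps -> area (Omega T ps) = \sum_l moment (ltri l) (lval ps l) one3 one3.
Proof.
move=> Sp; have mO : measurable (Omega T ps : set (mR * mR)).
  by apply: open_measurable2; exact: S1h_open_neg.
have -> : area (Omega T ps) = Rintegral mu2 (dom T) (pw (Omega T ps) 1 0).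
  rewrite /area -[LHS]mul1r -Rintegral_cst//.
  have -> : Omega T ps = dom T `&` Omega T ps by apply/esym/setIidr => x [].
  rewrite Rintegral_mkcondr; apply: eq_Rintegral => x _.
  rewrite patchE /pw; congr (if _ then _ else _).
  rewrite (_ : dom T `&` Omega T ps = Omega T ps)//; apply/setIidr => y [] //.
rewrite (Rintegral_dom hT); last exact: pw_tame.
apply: eq_bigr => l _; rewrite -[RHS]mul1r -[X in X * _](subr0 1).
rewrite -[RHS]add0r -[X in X + _](mul0r (tmass l one3 one3)) -integral_tau_pw//.
by apply: eq_Rintegral => x _; rewrite !interp_one3 !mulr1.
Qed.

End Assembly.

Arguments one3 {R} j.

(** * Area of the symmetric difference *)

Section SymmetricDifference.
Variables (R : realType) (T : mesh R).
Hypothesis hT : conforming_mesh T.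
Local Notation mR := (measurableTypeR R).
Local Notation mu := (@lebesgue_measure R).
Local Notation mu2 := (mu \x mu)%E.
Variable k : 'I_(nnodes T).
Implicit Types (l : 'I_(ntris T)) (j : 'I_3) (v w : pt R -> R).

Lemma measurable_Omega v : S1h T v -> measurable (Omega T v : set (mR * mR)).
Proof. by move=> Sv; apply: open_measurable2; exact: S1h_open_neg. Qed.

(** Within a triangle where the affine function is not identically zero, a limit point of [Omega]
    outside [Omega] lies on its zero line. The mesh edges are null anyway. *)
Lemma boundary_Omega_null w : S1h T w ->
  mu2.-negligible (dom T `&` closure (Omega T w) `\` Omega T w).
Proof.
(* A triangle on which [w] vanishes identically gets the empty set: none of its interior points is a
   limit of points with [w < 0]. *)
move=> Sw; pose Z : set (mR * mR) := \big[setU/set0]_(l : 'I_(ntris T))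
  if [forall j, lval k w l j == 0] then set0 else [set x | interp (ltri k l) (lval k w l) x = 0].
have nZ : mu2.-negligible Z.
  rewrite /Z; elim/big_ind: _ => [|X Y|l _]; first exact: negligible_set0.
    exact: negligibleU.
  case: ifPn => [_|]; first exact: negligible_set0.
  rewrite negb_forall => /existsP[j wj].
  apply/negligibleP; first by apply: measurable_eq0; exact: measurable_interp.
  by apply: interp0_null; [exact: det3_lnode|exists j].
have ne : mu2.-negligible (mesh_edges T).
  by apply/negligibleP; [exact: measurable_mesh_edges|exact: mesh_edges_null].
apply: negligibleS (negligibleU ne nZ) => x [[dx cx] nx].
have [[l tx]|nt] := pselect (exists l, tau l x); last first.
  by left; split => // /mesh_interiorP.
right; rewrite /Z -bigcup_seq; exists l; first by rewrite /= mem_index_enum.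
have nbt : nbhs x (tau l) by apply: open_nbhs_nbhs; split => //; exact: (open_tau hT).
have wE y : tau l y -> w y = interp (ltri k l) (lval k w l) y.
  by move=> ty; apply: (S1h_interp hT k Sw); exact: subset_closure.
case: ifPn => [/forallP z|_].
  have [y [[_ wy] ty]] := cx _ nbt.
  by move: wy; rewrite wE// /interp big1 ?ltxx// => j _; rewrite (eqP (z j)) mul0r.
rewrite /= -wE//; apply/eqP; rewrite eq_le; apply/andP; split; last first.
  by rewrite leNgt; apply/negP => wx; apply: nx; split.
rewrite leNgt; apply/negP => wx; rewrite wE// in wx.
have nbp : nbhs x [set y | 0 < interp (ltri k l) (lval k w l) y].
  apply: open_nbhs_nbhs; split => //.
  apply: (open_comp (D := [set r : R | 0 < r])); last exact: open_gt.
  by move=> y _; exact: continuous_interp.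
have [y [[_ wy] [ty /= py]]] := cx _ (filterI nbt nbp).
by move: wy; rewrite wE// ltNge ltW.
Qed.

(** The sets are nested, so one of the two differences is empty. In the other, removing the closure
    of the smaller set instead of the set itself costs a null set. *)
Lemma area_symdiff v w : S1h T v -> S1h T w -> (forall x, dom T x -> v x <= w x) ->
  area (symdiff (Omega T w) (Omega T v)) = area (Omega T v) - area (Omega T w).
Proof.
move=> Sv Sw vw.
have wv : Omega T w `<=` Omega T v.
  by move=> x [dx wx]; split => //; exact: le_lt_trans (vw _ dx) wx.
have -> : symdiff (Omega T w) (Omega T v) = Omega T v `\` closure (Omega T w).
  apply/seteqP; split => x; last by right.
  by case=> // -[wx []]; apply: subset_closure; exact: wv.
have mv := measurable_Omega Sv; have mw := measurable_Omega Sw.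
have mc : measurable (closure (Omega T w) : set (mR * mR)).
  by apply: closed_measurable2; exact: closed_closure.
pose Z : set (mR * mR) := Omega T v `&` closure (Omega T w) `\` Omega T w.
have mZ : measurable Z by apply: measurableD => //; exact: measurableI.
have Z0 : mu2 Z = 0%E.
  apply: measure_negligible => //; apply: negligibleS (boundary_Omega_null Sw).
  by move=> x [[[dx _] cx] nx].
have fO u : S1h T u -> (mu2 (Omega T u) < +oo)%E.
  move=> Su; apply: le_lt_trans (dom_lty hT); apply: le_measure; rewrite ?inE.
  - exact: measurable_Omega.
  - exact: measurable_dom.
  - by move=> x [].
have E : mu2 (Omega T v `\` closure (Omega T w)) = (mu2 (Omega T v) - mu2 (Omega T w))%E.
  have <- : mu2 (Omega T v `\` Omega T w) = (mu2 (Omega T v) - mu2 (Omega T w))%E.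
    by rewrite measureD ?fO//= setIidr.
  have -> : Omega T v `\` Omega T w = (Omega T v `\` closure (Omega T w)) `|` Z.
    apply/seteqP; split => x.
      move=> [vx nw]; have [cx|ncx] := pselect (closure (Omega T w) x); first by right.
      by left.
    by case=> [[vx ncx]|[[vx cx] nx]]; split => // wx; apply: ncx; exact: subset_closure.
  by rewrite measureU0//; exact: measurableD.
rewrite /area E fineB// ge0_fin_numE//; exact: fO.
Qed.

End SymmetricDifference.

(** * Definiteness of the stiffness matrix *)

Section MomentLinear.
Variable R : realType.
Local Notation mu := (@lebesgue_measure R).
Local Notation mu2 := (mu \x mu)%E.

Lemma interp_lin (P : 'I_3 -> pt R) (a : R) (f f' : 'I_3 -> R) x :
  interp P (fun j => a * f j + f' j) x = a * interp P f x + interp P f' x.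
Proof.
rewrite /interp mulr_sumr -big_split/=; apply: eq_bigr => j _; ring.
Qed.

Lemma moment_sym (P : 'I_3 -> pt R) (v f g : 'I_3 -> R) : moment P v f g = moment P v g f.
Proof. by congr Rintegral; apply: funext => x; rewrite mulrC. Qed.

Lemma moment_lin (P : 'I_3 -> pt R) (v f f' g : 'I_3 -> R) (a : R) : det3 P != 0 ->
  moment P v (fun j => a * f j + f' j) g = a * moment P v f g + moment P v f' g.
Proof.
move=> D0; have mt := measurable_trineg v D0.
have it (h h' : 'I_3 -> R) : mu2.-integrable (trineg P v)
    (EFin \o (fun x => interp P h x * interp P h' x)).
  by apply: integrable_sub_tri => // x [].
rewrite /moment -RintegralZl// -RintegralD//; last exact: (integrableZl mt a (it f g)).
by apply: eq_Rintegral => x _; rewrite interp_lin; ring.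
Qed.

Lemma moment0 (P : 'I_3 -> pt R) (v g : 'I_3 -> R) : det3 P != 0 -> moment P v (fun=> 0) g = 0.
Proof.
move=> D0; have := moment_lin v (fun=> 0) (fun=> 0) g 1 D0.
rewrite (_ : (fun j : 'I_3 => 1 * 0 + 0) = (fun=> 0 : R)); last first.
  by apply: funext => j; rewrite mulr0 addr0.
by move=> h; lra.
Qed.

Lemma mass_lin (f f' g : 'I_3 -> R) (a : R) :
  mass (fun j => a * f j + f' j) g = a * mass f g + mass f' g.
Proof. by rewrite /mass !sum3; field. Qed.

Lemma mass_sym (f g : 'I_3 -> R) : mass f g = mass g f.
Proof. by rewrite /mass !sum3; field. Qed.

End MomentLinear.

Section Definite.
Variables (R : realType) (T : mesh R).
Hypothesis hT : conforming_mesh T.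
Variable hat : 'I_(nnodes T) -> pt R -> R.
Hypothesis hhat : hat_basis hat.
Local Notation mR := (measurableTypeR R).
Local Notation mu := (@lebesgue_measure R).
Local Notation mu2 := (mu \x mu)%E.
Variable k : 'I_(nnodes T).
Implicit Types (i : 'I_(nnodes T)) (l : 'I_(ntris T)) (j : 'I_3).
Implicit Types (ps : pt R -> R).
Variable P : problem R (nnodes T).

Lemma pwmoment_lin (v1 v2 : R) ps l (f f' g : 'I_3 -> R) a :
  pwmoment k v1 v2 ps l (fun j => a * f j + f' j) g =
  a * pwmoment k v1 v2 ps l f g + pwmoment k v1 v2 ps l f' g.
Proof.
rewrite /pwmoment /tmass mass_lin moment_lin; last exact: (det3_lnode hT k l).
ring.
Qed.

Lemma pwmoment_sym (v1 v2 : R) ps l (f g : 'I_3 -> R) :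
  pwmoment k v1 v2 ps l f g = pwmoment k v1 v2 ps l g f.
Proof. by rewrite /pwmoment /tmass mass_sym moment_sym. Qed.

Lemma pwmoment_sum (v1 v2 : R) ps l (I : Type) (r : seq I) (c : I -> R) (F : I -> 'I_3 -> R) g :
  pwmoment k v1 v2 ps l (fun j => \sum_(i <- r) c i * F i j) g =
  \sum_(i <- r) c i * pwmoment k v1 v2 ps l (F i) g.
Proof.
elim: r => [|i r IH].
  rewrite big_nil; under [fun j => _]eq_fun do rewrite big_nil.
  rewrite /pwmoment /tmass moment0; last exact: (det3_lnode hT k l).
  have -> : mass (fun=> 0) g = 0 :> R by rewrite /mass !sum3; ring.
  by rewrite !mulr0 addr0.
rewrite big_cons -IH -pwmoment_lin.
by under [fun j => _]eq_fun do rewrite big_cons.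
Qed.

(** The moment over the negative part and what is missing to [tmass] are both integrals of a square,
    hence nonnegative. *)
Lemma pwmoment_ge (m v1 v2 : R) ps l (f : 'I_3 -> R) : S1h T ps -> m <= v1 -> m <= v2 ->
  m * tmass k l f f <= pwmoment k v1 v2 ps l f f.
Proof.
move=> Sp mv1 mv2.
have h1 : 0 <= moment (ltri k l) (lval k ps l) f f.
  by apply: Rintegral_ge0 => x _; rewrite -expr2 sqr_ge0.
have h2 : 0 <= tmass k l f f - moment (ltri k l) (lval k ps l) f f.
  have := integral_tau_pw hT k 0 1 l f f Sp.
  rewrite mul1r sub0r mulN1r => <-; apply: Rintegral_ge0 => x _.
  by rewrite mulr_ge0 -?expr2 ?sqr_ge0// /pw; case: ifP.
rewrite /pwmoment; nra.
Qed.

Lemma tmass_const l (c : R) : tmass k l (fun=> c) (fun=> c) = det3 (ltri k l) / 2 * c ^+ 2.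
Proof.
by rewrite /tmass (gtr0_norm (det3_lnode_gt0 hT k l)) /mass !sum3; field.
Qed.

Definition vvec (v : 'cV[R]_(nnodes T)) l j : R := v (lnode k l j) 0.

Lemma sum_ind3 (v : 'cV[R]_(nnodes T)) l j : \sum_i v i 0 * ind3 k l i j = vvec v l j.
Proof.
rewrite (bigD1 (lnode k l j))//= /ind3 eqxx mulr1 big1 ?addr0// => i /negbTE ->.
by rewrite mulr0.
Qed.

(** Grouped by elements, so that nonnegativity can be seen summand by summand. *)
Lemma quadratic_form ps (v : 'cV[R]_(nnodes T)) : S1h T ps -> (v^T *m (Amx P hat ps *m v)) 0 0 =
  \sum_l (pwmoment k (lambda1 P) (lambda2 P) ps l one3 one3 *
     ((\sum_i v i 0 *: gvec k l i)^T *m (\sum_i v i 0 *: gvec k l i)) 0 0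
   + pwmoment k (alpha1 P) (alpha2 P) ps l (vvec v l) (vvec v l)).
Proof.
move=> Sp; rewrite mxE.
under eq_bigr => i _.
  rewrite !mxE mulr_sumr.
  under eq_bigr => i' _ do rewrite (AmxE hT hhat k)// mulr_suml mulr_sumr.
  rewrite exchange_big/=; over.
rewrite exchange_big/=; apply: eq_bigr => l _.
transitivity (\sum_i \sum_i' (pwmoment k (lambda1 P) (lambda2 P) ps l one3 one3 *
    (v i 0 * v i' 0 * gdot k l i i')) +
  \sum_i \sum_i' v i 0 *
    (v i' 0 * pwmoment k (alpha1 P) (alpha2 P) ps l (ind3 k l i') (ind3 k l i))).
  rewrite -big_split/=; apply: eq_bigr => i _; rewrite -big_split/=.
  by apply: eq_bigr => i' _; ring.
congr (_ + _).
  rewrite mulmx_sumr summxE mulr_sumr; apply: eq_bigr => i _.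
  rewrite raddf_sum /= mulmx_suml summxE mulr_sumr; apply: eq_bigr => i' _.
  have -> : (v i' 0 *: gvec k l i')^T = v i' 0 *: (gvec k l i')^T.
    by apply/matrixP => ? ?; rewrite !mxE.
  rewrite -scalemxAl -scalemxAr /gdot [X in _ = _ * X]mxE [X in _ = _ * (_ * X)]mxE; ring.
have E : vvec v l = fun j => \sum_i v i 0 * ind3 k l i j.
  by apply: funext => j; rewrite sum_ind3.
rewrite {1}E pwmoment_sum; apply: eq_bigr => i _; rewrite -mulr_sumr pwmoment_sym.
by rewrite E pwmoment_sum.
Qed.

Lemma vvec_femfun (v : 'cV[R]_(nnodes T)) l x : closure (tau l) x ->
  femfun hat v x = interp (ltri k l) (vvec v l) x.
Proof.
move=> tx; rewrite /femfun.
transitivity (\sum_i \sum_j v i 0 * (ind3 k l i j * bary (ltri k l) j x)).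
  by apply: eq_bigr => i _; rewrite (hat_interp hT hhat k i tx) mulr_sumr.
rewrite exchange_big; apply: eq_bigr => j _ /=.
by rewrite -sum_ind3 mulr_suml; apply: eq_bigr => i _; rewrite mulrA.
Qed.

Lemma edge_closure l j (t : R) : 0 <= t <= 1 -> closure (tau l) (edge l j t).
Proof.
move=> /andP[t0 t1].
have DP : det3 (nodes3 (vtx l)) != 0 by rewrite gt_eqF// det3_vtx_gt0.
rewrite tauE closure_tri//= => i.
have [a [b [c E]]] := interpE (nodes3 (vtx l)) (fun j : 'I_3 => (j == i)%:R : R).
have -> : bary (nodes3 (vtx l)) i (edge l j t) =
    (1 - t) * bary (nodes3 (vtx l)) i (node (vtx l j)) +
    t * bary (nodes3 (vtx l)) i (node (vtx l (j + 1))).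
  by rewrite bary_interp !E /edge !ptE; ring.
rewrite -/(nodes3 (vtx l) j) -/(nodes3 (vtx l) (j + 1)) !bary_vertex//.
by rewrite addr_ge0// mulr_ge0// subr_ge0.
Qed.

(** Positive length supplies a point of [GammaD] on the mesh, where a constant test function is
    forced to vanish. *)
Lemma GammaD_meets_closure : (0 < bdlength T (GammaD P))%E ->
  exists l x, closure (tau l) x /\ GammaD P x.
Proof.
move=> b0; apply: contrapT => nG; move: b0; rewrite /bdlength big1 ?ltxx// => l _.
rewrite big1// => j _.
rewrite (_ : [set t | _] = set0) ?measure0 ?mule0//.
apply/seteqP; split => // t [/=]; rewrite in_itv/= => t01 Gt; apply: nG.
by exists l, (edge l j t); split => //; exact: edge_closure.
Qed.

Lemma tau_nonempty l : exists x, tau l x.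
Proof.
exists (\sum_j (3^-1 : R) *: node (vtx l j)), (fun=> 3^-1).
by split => //; rewrite sum3; field.
Qed.

(** The set where [f] equals [c l] is cut out of the domain by the closed triangles with that value,
    its complement by the remaining ones. Both unions are finite, hence closed, and connectedness
    leaves only the whole domain. *)
Lemma locally_constant (f : pt R -> R) (c : 'I_(ntris T) -> R) :
  (forall l x, closure (tau l) x -> f x = c l) -> forall l l', c l = c l'.
Proof.
move=> fc l l'; have [_ _ _ _ cd] := hT.
pose D (s : pred 'I_(ntris T)) : set (pt R) := \bigcup_(m in [set m | s m]) closure (tau m).
have cD s : closed (D s).
  by apply: closed_bigcup; [exact: finite_finset|move=> m _; exact: closed_closure].
have [x tx] := tau_nonempty l; have [y ty] := tau_nonempty l'.
have E : dom T `&` [set z | f z = c l] = dom T.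
  apply: cd.
  - exists x; split; first exact: (tau_dom hT tx).
    by apply: fc; exact: subset_closure.
  - exists (~` D [pred m | c m != c l]); first by rewrite openC; exact: cD.
    apply/seteqP; split => z [dz /= fz]; split => //.
      by case=> m /= /eqP cm tm; apply: cm; rewrite -(fc _ _ tm).
    have [m tm] := dom_closure_tau dz; rewrite (fc _ _ tm).
    by apply/eqP/negPn/negP => cm; apply: fz; exists m.
  - exists (D [pred m | c m == c l]); first exact: cD.
    apply/seteqP; split => z [dz /= fz]; split => //.
      by have [m tm] := dom_closure_tau dz; exists m => //=; rewrite -(fc _ _ tm) fz.
    by case: fz => m /= /eqP <- tm; exact: fc.
have : (dom T `&` [set z | f z = c l]) y by rewrite E; exact: (tau_dom hT ty).
by case=> _ /= <-; apply: fc; exact: subset_closure.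
Qed.

(** The transposed Jacobian brings the gradient back to a combination of [(-1, -1)], [(1, 0)] and
    [(0, 1)], which vanishes only for equal coefficients. *)
Lemma gvec_sum_eq0 (v : 'cV[R]_(nnodes T)) l :
  ((\sum_i v i 0 *: gvec k l i)^T *m (\sum_i v i 0 *: gvec k l i)) 0 0 = 0 ->
  forall j, vvec v l j = vvec v l 0.
Proof.
set g := \sum_i _ => g0.
have gz : g = 0.
  move: g0; rewrite mxE; under eq_bigr do rewrite mxE -expr2.
  move/psumr_eq0P => h; apply/colP => i; rewrite [RHS]mxE; apply/eqP.
  by rewrite -sqrf_eq0; apply/eqP/h => // i' _; exact: sqr_ge0.
have : \sum_j vvec v l j *: gradient (@psi R j) 0 = 0 :> 'cV[R]_2.
  have : g = (invmx (Jl k l))^T *m \sum_j vvec v l j *: gradient (@psi R j) 0.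
    rewrite /g /gvec; under eq_bigr do rewrite scalemxAr scaler_sumr.
    rewrite -mulmx_sumr; congr (_ *m _); rewrite exchange_big/=; apply: eq_bigr => j _.
    by rewrite -sum_ind3 scaler_suml; apply: eq_bigr => i _; rewrite scalerA.
  rewrite gz trmx_inv => /(congr1 (mulmx (Jl k l)^T)); rewrite mulmx0.
  by rewrite mulKVmx ?unitmx_tr ?(Jl_unit hT).
under eq_bigr do rewrite gradient_psi.
rewrite sum3 => e; have e0 := congr1 (fun z : 'cV_2 => z 0 0) e.
have e1 := congr1 (fun z : 'cV_2 => z 1 0) e.
move: e0 e1; rewrite !mxE/= !mulr0 !mulr1 ?addr0 mulrN1 => e0 e1.
by apply: forall3 => //; lra.
Qed.

(** A null vector has zero gradient and is constant on each element. If [GammaD] has positive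
    length, the constants agree by connectedness and vanish at a Dirichlet point; if [alpha1] and
    [alpha2] are positive, the reaction term kills each constant separately. *)
Lemma Amx_definite ps : admissible P -> S1h T ps -> definite_on_test P hat (Amx P hat ps).
Proof.
move=> [[l1 l2] [a1 a2 _ _] _ _ bc] Sp v Vv vA.
pose ml := Num.min (lambda1 P) (lambda2 P); pose ma := Num.min (alpha1 P) (alpha2 P).
have ml0 : 0 < ml by rewrite lt_min l1.
have ma0 : 0 <= ma by rewrite le_min a1.
have td l : 0 < det3 (ltri k l) by exact: (det3_lnode_gt0 hT).
have tge l f : 0 <= tmass k l f f.
  rewrite /tmass /ltri; have [_ <-] := integral_tri f f (det3_lnode hT k l).
  by apply: Rintegral_ge0 => x _; rewrite -expr2 sqr_ge0.
have pl l : 0 < pwmoment k (lambda1 P) (lambda2 P) ps l one3 one3.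
  apply: lt_le_trans (pwmoment_ge (m := ml) l one3 Sp _ _); last 2 first.
  - by rewrite ge_min lexx.
  - by rewrite ge_min lexx orbT.
  by rewrite mulr_gt0// (tmass_const l 1) expr1n mulr1 divr_gt0.
have pa l : ma * tmass k l (vvec v l) (vvec v l) <=
    pwmoment k (alpha1 P) (alpha2 P) ps l (vvec v l) (vvec v l).
  by apply: pwmoment_ge => //; rewrite ge_min lexx ?orbT.
have gg l : 0 <= ((\sum_i v i 0 *: gvec k l i)^T *m (\sum_i v i 0 *: gvec k l i)) 0 0.
  by rewrite mxE; apply: sumr_ge0 => c _; rewrite mxE -expr2 sqr_ge0.
have pa0 l : 0 <= pwmoment k (alpha1 P) (alpha2 P) ps l (vvec v l) (vvec v l).
  by apply: le_trans (pa l); rewrite mulr_ge0.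
have := congr1 (fun z : 'M[R]_1 => z 0 0) vA; rewrite quadratic_form// [RHS]mxE => /psumr_eq0P h.
have {}h l : pwmoment k (lambda1 P) (lambda2 P) ps l one3 one3 *
     ((\sum_i v i 0 *: gvec k l i)^T *m (\sum_i v i 0 *: gvec k l i)) 0 0
   + pwmoment k (alpha1 P) (alpha2 P) ps l (vvec v l) (vvec v l) = 0.
  by apply: h => // m _; rewrite addr_ge0// mulr_ge0// ltW.
have vc l j : vvec v l j = vvec v l 0.
  apply: gvec_sum_eq0; have := h l; move: (pl l) (gg l) (pa0 l).
  set x := pwmoment _ _ _ _ _ _ _; set y := fun_of_matrix _ 0 0; set z := pwmoment _ _ _ _ _ _ _.
  move=> x0 y0 z0 /eqP; rewrite paddr_eq0 ?mulr_ge0// ?(ltW x0)// mulf_eq0 gt_eqF//=.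
  by move=> /andP[/eqP].
have fc l x : closure (tau l) x -> femfun hat v x = vvec v l 0.
  move=> tx; rewrite (vvec_femfun v tx) /interp.
  under eq_bigr do rewrite vc.
  by rewrite -mulr_sumr sum_bary mulr1.
have all0 : forall l, vvec v l 0 = 0.
  case: bc => [/GammaD_meets_closure[l [x [tx Gx]]] l'|[a1p a2p] l].
    by rewrite (locally_constant fc l' l) -(fc _ _ tx) Vv.
  have map : 0 < ma by rewrite lt_min a1p.
  have z0 : pwmoment k (alpha1 P) (alpha2 P) ps l (vvec v l) (vvec v l) = 0.
    have := h l => /eqP; rewrite paddr_eq0 ?mulr_ge0// ?(ltW (pl l))//.
    by move=> /andP[_ /eqP].
  have := pa l; rewrite z0 (_ : vvec v l = fun=> vvec v l 0); last exact: funext.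
  rewrite tmass_const; set w := vvec v l 0 => hw.
  have : w ^+ 2 <= 0 by move: hw; rewrite mulrA pmulr_rle0// mulr_gt0// divr_gt0.
  by rewrite le_eqVlt ltNge sqr_ge0 orbF sqrf_eq0 => /eqP.
apply/colP => i; rewrite [RHS]mxE.
have [_ /(_ i)[l [j E]] _ _ _] := hT.
have := fc l _ (@node_closure_tau _ _ hT l j); rewrite all0 E => <-.
rewrite /femfun (bigD1 i)//= (hhat i).2 eqxx mulr1 big1 ?addr0// => i' ne.
by rewrite (hhat i').2 (negbTE ne) mulr0.
Qed.

End Definite.

Lemma scalemxBE (R : pzRingType) m n (c : R) (X Y : 'M[R]_(m, n)) i j :
  (c *: (X - Y)) i j = c * (X i j - Y i j).
Proof. by rewrite mxE; congr (_ * _); rewrite mxE; congr (_ + _); rewrite mxE. Qed.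

(** * The derivative of the cost *)

Section General.
Variables (R : realType) (T : mesh R) (P : problem R (nnodes T)).
Variable hat : 'I_(nnodes T) -> pt R -> R.
Hypotheses (hT : conforming_mesh T) (hP : admissible P) (hhat : hat_basis hat).
Variables (phi : pt R -> R) (u p : 'cV[R]_(nnodes T)) (k : 'I_(nnodes T)).
Hypotheses (Sphi : S1h T phi) (hu : is_state P hat phi u) (hp : is_adjoint P hat phi u p).
Variables (phie : R -> pt R -> R) (h : R -> R).
Hypothesis Sphie : forall e, S1h T (phie e).
Hypotheses (h0 : \forall e \near 0^'+, 0 < h e) (hl : h e @[e --> 0^'+] --> (0 : R)).
Variables (m : 'I_(ntris T) -> 'M[R]_3) (s : R).
Implicit Types (l : 'I_(ntris T)) (i : 'I_(nnodes T)) (f g : 'I_3 -> R).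

Definition bil3 (X : 'M[R]_3) f g : R := \sum_a \sum_b f a * X a b * g b.

Hypothesis hm : forall l f g,
  (moment (ltri k l) (lval k (phie e) l) f g - moment (ltri k l) (lval k phi l) f g) / h e
    @[e --> 0^'+] --> bil3 (m l) f g.
Hypothesis hS : \forall e \near 0^'+, area (symdiff (Omega T (phie e)) (Omega T phi)) =
  - s * (area (Omega T (phie e)) - area (Omega T phi)).
Hypothesis ms0 : - s * \sum_l bil3 (m l) one3 one3 != 0.

Lemma pwmoment_cvg (v1 v2 : R) l f g :
  (h e)^-1 * (pwmoment k v1 v2 (phie e) l f g - pwmoment k v1 v2 phi l f g)
    @[e --> 0^'+] --> (v1 - v2) * bil3 (m l) f g.
Proof.
rewrite (_ : (fun e => _) = (fun e => (v1 - v2) *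
    ((moment (ltri k l) (lval k (phie e) l) f g - moment (ltri k l) (lval k phi l) f g) / h e))).
  by apply: cvgM; [exact: cvg_cst|exact: hm].
by apply: funext => e; rewrite /pwmoment; ring.
Qed.

Definition Mder (v1 v2 : R) : 'M[R]_(nnodes T) := \matrix_(i, i')
  \sum_l (v1 - v2) * bil3 (m l) (ind3 k l i) (ind3 k l i').

Definition Fder (v1 v2 : R) : 'cV[R]_(nnodes T) := \col_i
  \sum_l (v1 - v2) * bil3 (m l) (ind3 k l i) one3.

Definition Kder (v1 v2 : R) : 'M[R]_(nnodes T) := \matrix_(i, i')
  \sum_l (v1 - v2) * bil3 (m l) one3 one3 * gdot k l i i'.

Lemma Mtmx_cvg : mcvg (fun e => (h e)^-1 *: (Mtmx P hat (phie e) - Mtmx P hat phi))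
  (Mder (talpha1 P) (talpha2 P)).
Proof.
move=> i i'; rewrite [X in _ --> X]mxE.
rewrite (_ : (fun e => _) = (fun e => \sum_l (h e)^-1 *
   (pwmoment k (talpha1 P) (talpha2 P) (phie e) l (ind3 k l i) (ind3 k l i')
    - pwmoment k (talpha1 P) (talpha2 P) phi l (ind3 k l i) (ind3 k l i')))).
  by apply: cvg_bigsum => l; exact: pwmoment_cvg.
apply: funext => e; rewrite scalemxBE !(MtmxE hT hhat k)// -mulr_sumr sumrB.
by congr (_ * (_ - _)); apply: eq_bigr => l _; rewrite pwmoment_sym.
Qed.

Lemma fvec_cvg : mcvg (fun e => (h e)^-1 *: (fvec P hat (phie e) - fvec P hat phi))
  (Fder (fsrc1 P) (fsrc2 P)).
Proof.
move=> i j; rewrite ord1 [X in _ --> X]mxE.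
rewrite (_ : (fun e => _) = (fun e => \sum_l (h e)^-1 *
   (pwmoment k (fsrc1 P) (fsrc2 P) (phie e) l (ind3 k l i) one3
    - pwmoment k (fsrc1 P) (fsrc2 P) phi l (ind3 k l i) one3))).
  by apply: cvg_bigsum => l; exact: pwmoment_cvg.
by apply: funext => e; rewrite scalemxBE !(fvecE hT hhat k)// -mulr_sumr sumrB.
Qed.

Lemma Amx_cvg : mcvg (fun e => (h e)^-1 *: (Amx P hat (phie e) - Amx P hat phi))
  (Kder (lambda1 P) (lambda2 P) + Mder (alpha1 P) (alpha2 P)).
Proof.
move=> i i'; rewrite [X in _ --> X]mxE [Kder _ _ i i']mxE [Mder _ _ i i']mxE -big_split/=.
rewrite (_ : (fun e => _) = (fun e => \sum_l
   ((h e)^-1 * (pwmoment k (lambda1 P) (lambda2 P) (phie e) l one3 one3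
    - pwmoment k (lambda1 P) (lambda2 P) phi l one3 one3) * gdot k l i i' +
   (h e)^-1 * (pwmoment k (alpha1 P) (alpha2 P) (phie e) l (ind3 k l i) (ind3 k l i')
    - pwmoment k (alpha1 P) (alpha2 P) phi l (ind3 k l i) (ind3 k l i'))))).
  apply: cvg_bigsum => l; apply: cvgD; last exact: pwmoment_cvg.
  by apply: cvgM; [exact: pwmoment_cvg|exact: cvg_cst].
apply: funext => e; rewrite scalemxBE !(AmxE hT hhat k)// -sumrB mulr_sumr.
apply: eq_bigr => l _.
rewrite !(pwmoment_sym _ _ _ _ _ (ind3 k l i') (ind3 k l i)); ring.
Qed.

Lemma area_cvg : (area (Omega T (phie e)) - area (Omega T phi)) / h e @[e --> 0^'+] -->
  \sum_l bil3 (m l) one3 one3.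
Proof.
rewrite (_ : (fun e => _) = (fun e => \sum_l (moment (ltri k l) (lval k (phie e) l) one3 one3 -
   moment (ltri k l) (lval k phi l) one3 one3) / h e)).
  by apply: cvg_bigsum => l; exact: hm.
by apply: funext => e; rewrite !(areaE hT k)// -sumrB mulr_suml.
Qed.

(** [s] stands for the direction of the perturbation: 1 if it raises phi, so that [Omega] shrinks,
    and -1 if it lowers phi. *)
Lemma general_derivative :
  let pku l := ((loc k l p)^T *m k0 k l *m loc k l u) 0 0 in
  let w l := loc k l u - loc k l (uhat P) in
  (cost P hat (phie e) - cost P hat phi) / area (symdiff (Omega T (phie e)) (Omega T phi))
  @[e --> 0^'+] -->
  (c1 P * (\sum_l bil3 (m l) one3 one3)
   + (lambda1 P - lambda2 P) * (\sum_l pku l * bil3 (m l) one3 one3)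
   + (alpha1 P - alpha2 P) * (\sum_l ((loc k l p)^T *m m l *m loc k l u) 0 0)
   - (fsrc1 P - fsrc2 P) * (\sum_l ((loc k l p)^T *m m l *m (const_mx 1 : 'cV[R]_3)) 0 0)
   + c2 P * (talpha1 P - talpha2 P) * (\sum_l ((w l)^T *m m l *m w l) 0 0))
  / (- s * \sum_l bil3 (m l) one3 one3).
Proof.
move=> pku w.
have dA := Amx_definite hT hhat k hP Sphi.
have cS : area (symdiff (Omega T (phie e)) (Omega T phi)) / h e @[e --> 0^'+] -->
   - s * \sum_l bil3 (m l) one3 one3.
  have : - s * ((area (Omega T (phie e)) - area (Omega T phi)) / h e) @[e --> 0^'+] -->
     - s * \sum_l bil3 (m l) one3 one3 by apply: cvgM; [exact: cvg_cst|exact: area_cvg].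
  by apply: cvg_trans; apply: near_eq_cvg; near=> e; rewrite (near hS)// mulrA.
have := cost_derivative hu hp dA h0 hl Amx_cvg fvec_cvg Mtmx_cvg area_cvg cS ms0.
suff -> : (c1 P * (\sum_l bil3 (m l) one3 one3) +
   ((p^T *m ((Kder (lambda1 P) (lambda2 P) + Mder (alpha1 P) (alpha2 P)) *m u)) 0 0 -
    (p^T *m Fder (fsrc1 P) (fsrc2 P)) 0 0) +
   c2 P * ((u - uhat P)^T *m Mder (talpha1 P) (talpha2 P) *m (u - uhat P)) 0 0) =
  c1 P * (\sum_l bil3 (m l) one3 one3)
   + (lambda1 P - lambda2 P) * (\sum_l pku l * bil3 (m l) one3 one3)
   + (alpha1 P - alpha2 P) * (\sum_l ((loc k l p)^T *m m l *m loc k l u) 0 0)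
   - (fsrc1 P - fsrc2 P) * (\sum_l ((loc k l p)^T *m m l *m (const_mx 1 : 'cV[R]_3)) 0 0)
   + c2 P * (talpha1 P - talpha2 P) * (\sum_l ((w l)^T *m m l *m w l) 0 0) by [].
(* [E l] restricts a global nodal vector to the element. The limit matrices become sums of
   [(E l)^T *m X *m E l], which turns global products into local ones. *)
pose E l : 'M[R]_(3, nnodes T) := \matrix_(j, i) ind3 k l i j.
have locE l (v : 'cV[R]_(nnodes T)) : loc k l v = E l *m v.
  apply/colP => j; rewrite !mxE -/(vvec k v l j) -sum_ind3.
  by apply: eq_bigr => i _; rewrite mxE mulrC.
have bilE (X : 'M[R]_3) l i i' : bil3 X (ind3 k l i) (ind3 k l i') = ((E l)^T *m X *m E l) i i'.
  rewrite mxE /bil3 exchange_big/=; apply: eq_bigr => b _; rewrite mxE mulr_suml.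
  by apply: eq_bigr => a _; rewrite !mxE.
have bil1E (X : 'M[R]_3) l i : bil3 X (ind3 k l i) one3 =
    ((E l)^T *m X *m (const_mx 1 : 'cV[R]_3)) i 0.
  rewrite mxE /bil3 exchange_big/=; apply: eq_bigr => b _; rewrite mxE mulr_suml.
  by apply: eq_bigr => a _; rewrite !mxE.
have MderE v1 v2 : Mder v1 v2 = (v1 - v2) *: \sum_l ((E l)^T *m m l *m E l).
  apply/matrixP => i i'; rewrite !mxE summxE mulr_sumr; apply: eq_bigr => l _.
  by rewrite bilE.
have FderE v1 v2 : Fder v1 v2 = (v1 - v2) *: \sum_l ((E l)^T *m m l *m (const_mx 1 : 'cV[R]_3)).
  apply/matrixP => i i'; rewrite ord1 !mxE summxE mulr_sumr; apply: eq_bigr => l _.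
  by rewrite bil1E.
have KderE v1 v2 : Kder v1 v2 =
    (v1 - v2) *: \sum_l (bil3 (m l) one3 one3 *: ((E l)^T *m k0 k l *m E l)).
  apply/matrixP => i i'; rewrite !mxE summxE mulr_sumr; apply: eq_bigr => l _.
  rewrite [in RHS]mxE -mulrA; congr (_ * (_ * _)); rewrite gdotE -bilE /bil3.
  by apply: eq_bigr => a _; apply: eq_bigr => b _; ring.
have quad (X : 'I_(ntris T) -> 'M[R]_3) (v v' : 'cV[R]_(nnodes T)) :
   v^T *m (\sum_l ((E l)^T *m X l *m E l)) *m v' = \sum_l ((loc k l v)^T *m X l *m loc k l v').
  rewrite mulmx_sumr mulmx_suml; apply: eq_bigr => l _.
  by rewrite !locE trmx_mul !mulmxA.
have lin (X : 'I_(ntris T) -> 'M[R]_3) (v : 'cV[R]_(nnodes T)) :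
   v^T *m (\sum_l ((E l)^T *m X l *m (const_mx 1 : 'cV[R]_3))) =
   \sum_l ((loc k l v)^T *m X l *m (const_mx 1 : 'cV[R]_3) : 'M[R]_1).
  rewrite mulmx_sumr; apply: eq_bigr => l _.
  by rewrite !locE trmx_mul !mulmxA.
rewrite MderE FderE KderE MderE mulmxDl mulmxDr -!scalemxAl -!scalemxAr -!scalemxAl.
rewrite !mulmxA quad lin.
rewrite (_ : \sum_l (bil3 (m l) one3 one3 *: ((E l)^T *m k0 k l *m E l)) =
   \sum_l ((E l)^T *m (bil3 (m l) one3 one3 *: k0 k l) *m E l)); last first.
  by apply: eq_bigr => l _; rewrite -scalemxAr -scalemxAl.
rewrite !quad.
have Epk : \sum_l pku l * bil3 (m l) one3 one3 =
   (\sum_l ((loc k l p)^T *m (bil3 (m l) one3 one3 *: k0 k l) *m loc k l u)) 0 0.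
  rewrite summxE; apply: eq_bigr => l _; rewrite -scalemxAr -scalemxAl [RHS]mxE mulrC //.
have Ew : \sum_l ((w l)^T *m m l *m w l) 0 0 =
   (\sum_l ((loc k l (u - uhat P))^T *m m l *m loc k l (u - uhat P))) 0 0.
  rewrite summxE; apply: eq_bigr => l _; rewrite /w; congr ((_^T *m _ *m _) 0 0);
   by apply/colP => j; rewrite !mxE.
rewrite Epk Ew -!summxE.
move: (\sum_l _) (\sum_l _) (\sum_l _) (\sum_l _) (\sum_l _) => x1 x2 x3 x4 x5.
by rewrite !mxE; ring.
Unshelve. all: by end_near. Qed.

End General.

(** * Elements that the interface does not cut *)

Section Cut.
Variables (R : realType).
Implicit Types (P : 'I_3 -> pt R) (v f g : 'I_3 -> R).

Lemma tri_meets_sign P v i : det3 P != 0 -> v i < 0 -> exists2 x, tri P x & interp P v x < 0.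
Proof.
move=> D0 vi; have cP : closure (tri P) (P i).
  by rewrite closure_tri// => j; rewrite bary_vertex.
have nb : nbhs (P i) [set x | interp P v x < 0].
  apply: open_nbhs_nbhs; split; last by rewrite /= interp_vertex.
  apply: (open_comp (D := [set r : R | r < 0])); last exact: open_lt.
  by move=> x _; exact: continuous_interp.
by have [x [tx ix]] := cP _ nb; exists x.
Qed.

Lemma interp_segment P v x y (t : R) :
  interp P v ((1 - t) *: x + t *: y) = (1 - t) * interp P v x + t * interp P v y.
Proof. by have [a [b [c E]]] := interpE P v; rewrite !E !ptE; ring. Qed.

Lemma tri_convex P x y (t : R) : det3 P != 0 -> tri P x -> tri P y -> 0 <= t <= 1 ->
  tri P ((1 - t) *: x + t *: y).
Proof.
move=> D0; rewrite !triE// => /= tx ty /andP[t0 t1] j.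
rewrite bary_interp interp_segment -!bary_interp.
have := tx j; have := ty j; nra.
Qed.

End Cut.

Section CutMesh.
Variables (R : realType) (T : mesh R).
Variable hat : 'I_(nnodes T) -> pt R -> R.
Hypotheses (hT : conforming_mesh T) (hhat : hat_basis hat).
Variables (k : 'I_(nnodes T)).
Implicit Types (l : 'I_(ntris T)) (v : pt R -> R).

(** On a segment in the triangle from a negative to a positive value there is a zero [z]. It is a
    limit of points with negative value, but does not belong to [Omega]. *)
Lemma tau_boundary l v i j : S1h T v -> lval k v l i < 0 -> 0 < lval k v l j ->
  tau l `&` boundary (Omega T v) !=set0.
Proof.
move=> Sv vi vj; have D0 := det3_lnode hT k l.
have tE := tau_lnode hT k l.
have vE y : tau l y -> v y = interp (ltri k l) (lval k v l) y.
  by move=> ty; apply: (S1h_interp hT k Sv); exact: subset_closure.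
have [x tx ix] := tri_meets_sign D0 vi.
have [y ty] : exists2 y, tri (ltri k l) y & interp (ltri k l) (\- lval k v l) y < 0.
  by apply: (@tri_meets_sign _ _ _ j) => //; rewrite oppr_lt0.
rewrite interpN oppr_lt0 => iy.
set X := interp _ _ x in ix; set Y := interp _ _ y in iy.
pose t := X / (X - Y); have XY : X - Y < 0 by lra.
have t0 : 0 < t by rewrite /t ltr_ndivlMr// mul0r.
have t1 : t < 1 by rewrite /t ltr_ndivrMr// mul1r; lra.
pose z := (1 - t) *: x + t *: y.
have tz : tau l z by rewrite tE; apply: tri_convex => //; rewrite !ltW.
have iz : interp (ltri k l) (lval k v l) z = 0.
  rewrite /z interp_segment -/X -/Y /t; field; exact: ltr0_neq0.
exists z; split => //; split; last first.
  by move=> /interior_subset[_]; rewrite vE// iz ltxx.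
move=> B nB; pose c (e : R) := (1 - e) *: z + e *: x.
have cc : c e @[e --> 0^'+] --> z.
  have -> : z = c 0 by rewrite /c subr0 scale1r scale0r addr0.
  apply: cvg_at_right_filter; apply: cvgD; apply: cvgZr_tmp; last exact: cvg_id.
  by apply: cvgB; [exact: cvg_cst|exact: cvg_id].
have nc : \forall e \near 0^'+, B (c e) by exact: cc.
near (0 : R)^'+ => e; exists (c e); split; last by near: e.
have e0 : 0 < e by near: e; exact: nbhs_right_gt.
have e1 : e < 1 by near: e; exact: nbhs_right_lt.
have tc : tau l (c e) by rewrite tE; apply: tri_convex; rewrite -?tE ?(ltW e0) ?(ltW e1)// tE.
split; first exact: (tau_dom hT tc).
by rewrite vE// /c interp_segment iz mulr0 add0r pmulr_rlt0.
Unshelve. all: by end_near. Qed.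

Lemma lval_perturb e v l j : tri_patch k l ->
  lval k (perturb hat k e v) l j =
  v3 (lval k v l 0 + perturb_coef k e v) (lval k v l 1) (lval k v l 2%:R) j.
Proof.
move=> kl; rewrite /lval (perturb_node hhat).
have -> : (k == lnode k l j) = (0 == j).
  by rewrite -[X in X == _](lnode0 hT kl) (inj_eq (lnode_inj hT (l := l))).
move: j; apply: forall3; rewrite /v3/=.
- by rewrite mulr1.
- by rewrite mulr0 addr0.
- by rewrite mulr0 addr0.
Qed.

Lemma lval_perturb_out e v l : ~~ tri_patch k l ->
  lval k (perturb hat k e v) l = lval k v l.
Proof.
move=> kl; apply: funext => j; rewrite /lval (perturb_node hhat).
case: eqP => [E|_]; last by rewrite mulr0 addr0.
by case/negP: kl; apply: (lnode_patch hT (j := j)).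
Qed.

(* If the vertex values had both signs for all small e, the element would be cut. *)
Lemma uncut_moment v l f g : S1h T v -> Snodes (T := T) v k ->
  l \notin cut_elements hat v k ->
  \forall e \near 0^'+, moment (ltri k l) (lval k (perturb hat k e v) l) f g =
    moment (ltri k l) (lval k v l) f g.
Proof.
move=> Sv Sk; have D0 := det3_lnode hT k l.
have [kl|kl _] := boolP (tri_patch k l); last first.
  by near=> e; rewrite lval_perturb_out.
have ce e : perturb_coef k e v = e.
  rewrite /perturb_coef !ifN//; apply/negP => /set_mem h; apply: Sk; [by right|by left].
move=> lC; set a := lval k v l 0; set b := lval k v l 1; set c := lval k v l 2%:R.
have LE e : lval k (perturb hat k e v) l = v3 (a + e) b c.
  by apply: funext => j; rewrite lval_perturb// ce.
have L0 : lval k v l = v3 a b c by apply: funext; exact: forall3.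
have ncut (i j : 'I_3) : ~ (\forall e \near 0^'+, v3 (a + e) b c i < 0 /\ 0 < v3 (a + e) b c j).
  move=> H; move/negP: lC; apply; rewrite /cut_elements inE/= kl/=; apply/asboolP.
  near=> e; have [vi vj] : v3 (a + e) b c i < 0 /\ 0 < v3 (a + e) b c j by near: e.
  by apply: (@tau_boundary _ _ i j); rewrite ?LE//; exact: S1h_perturb.
have near_gt (x : R) : 0 <= x -> \forall e \near 0^'+, 0 < x + e.
  move=> x0; near=> e; have : 0 < e by near: e; exact: nbhs_right_gt.
  lra.
have near_lt (x : R) : x < 0 -> \forall e \near 0^'+, x + e < 0.
  move=> x0; near=> e; suff : e < - x by lra.
  by near: e; apply: nbhs_right_lt; lra.
(* For [a >= 0], zero included, the perturbed value is positive; for [a < 0] it stays negative. The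
   other two values must weakly share that sign, so both moments are empty or both are full. *)
have [a0|a0] := leP 0 a.
  have b0 : 0 <= b.
    rewrite leNgt; apply/negP => b0; apply: (ncut 1 0).
    by near=> e; split => //=; near: e; exact: near_gt.
  have c0 : 0 <= c.
    rewrite leNgt; apply/negP => c0; apply: (ncut 2%:R 0).
    by near=> e; split => //=; near: e; exact: near_gt.
  near=> e; have : 0 < a + e by near: e; exact: near_gt.
  move=> ae; rewrite LE L0 !moment_empty//; apply: forall3; rewrite /v3//=; exact: ltW.
have b0 : b <= 0.
  rewrite leNgt; apply/negP => b0; apply: (ncut 0 1).
  by near=> e; split => //=; near: e; exact: near_lt.
have c0 : c <= 0.
  rewrite leNgt; apply/negP => c0; apply: (ncut 0 2%:R).
  by near=> e; split => //=; near: e; exact: near_lt.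
near=> e; have : a + e < 0 by near: e; exact: near_lt.
move=> ae; rewrite LE L0 !moment_full//; try (by exists 0).
  by apply: forall3; rewrite /v3//=; exact: ltW.
by apply: forall3; rewrite /v3//=; exact: ltW.
Unshelve. all: by end_near. Qed.

End CutMesh.

Section LimitAux.
Variable R : realType.

Lemma cvg_to_eq (f : R -> R) (a b : R) :
  f e @[e --> 0^'+] --> a -> a = b -> f e @[e --> 0^'+] --> b.
Proof. by move=> h <-. Qed.

Lemma cvg_le0_limit (f : R -> R) (a : R) :
  (\forall e \near 0^'+, f e <= 0) -> f e @[e --> 0^'+] --> a -> a <= 0.
Proof. by move=> h c; apply: (closed_cvg (fun x : R => x <= 0)) c => //; exact: closed_le. Qed.

(** Raising the vertex values shrinks the negative part; this will give the sign of [dka]. *)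
Lemma moment_antitone (P : 'I_3 -> pt R) (v w f : 'I_3 -> R) : det3 P != 0 ->
  (forall j, v j <= w j) -> moment P w f f <= moment P v f f.
Proof.
move=> D0 vw; have sub : trineg P w `<=` trineg P v.
  move=> x [tx wx]; split => //; apply: le_lt_trans wx.
  move: tx; rewrite triE// => b0; apply: ler_sum => j _.
  by rewrite ler_pM2r.
have mw := measurable_trineg w D0; have mv := measurable_trineg v D0.
have E : trineg P v = trineg P w `|` (trineg P v `\` trineg P w).
  apply/seteqP; split => x; first by move=> vx; have [?|?] := pselect (trineg P w x); [left|right].
  by case=> [/sub|[]].
rewrite {2}/moment E Rintegral_setU//.
- by rewrite lerDl; apply: Rintegral_ge0 => x _; rewrite -expr2 sqr_ge0.
- exact: measurableD.
- by rewrite -E; apply: integrable_sub_tri => // x [].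
- by apply/disj_setPS => x [? []].
Qed.

End LimitAux.

(** * The three kinds of nodes *)

Section Cases.
Variables (R : realType) (T : mesh R) (P : problem R (nnodes T)).
Variable hat : 'I_(nnodes T) -> pt R -> R.
Hypotheses (hT : conforming_mesh T) (hP : admissible P) (hhat : hat_basis hat).
Variables (phi : pt R -> R) (u p : 'cV[R]_(nnodes T)) (k : 'I_(nnodes T)).
Hypotheses (Sphi : S1h T phi) (hu : is_state P hat phi u) (hp : is_adjoint P hat phi u p).
Implicit Types (l : 'I_(ntris T)).

Local Notation phie e := (perturb hat k e phi).
Local Notation pku l := (((loc k l p)^T *m k0 k l *m loc k l u) 0 0).

Lemma lval_phi l : lval k phi l = v3 (phil phi k l 0) (phil phi k l 1) (phil phi k l 2%:R).
Proof. by apply: funext; exact: forall3. Qed.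

Lemma perturb_le (e : R) : perturb_coef k e phi <= 0 -> forall x, dom T x -> phie e x <= phi x.
Proof.
move=> c0 x dx; rewrite perturbE gerDl; apply: mulr_le0_ge0 => //.
exact: (hat_ge0 hT hhat).
Qed.

Lemma perturb_ge (e : R) : 0 <= perturb_coef k e phi -> forall x, dom T x -> phi x <= phie e x.
Proof.
move=> c0 x dx; rewrite perturbE lerDl; apply: mulr_ge0 => //.
exact: (hat_ge0 hT hhat).
Qed.

Lemma symdiff_le (e : R) : perturb_coef k e phi <= 0 ->
  area (symdiff (Omega T (phie e)) (Omega T phi)) =
  area (Omega T (phie e)) - area (Omega T phi).
Proof.
move=> c0; rewrite /symdiff setUC -[_ `|` _]/(symdiff _ _).
apply: (area_symdiff hT k) => //; first exact: S1h_perturb.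
exact: perturb_le.
Qed.

Lemma symdiff_ge (e : R) : 0 <= perturb_coef k e phi ->
  area (symdiff (Omega T (phie e)) (Omega T phi)) =
  - 1 * (area (Omega T (phie e)) - area (Omega T phi)).
Proof.
move=> c0; rewrite mulN1r opprB; apply: (area_symdiff hT k) => //.
  exact: S1h_perturb.
exact: perturb_ge.
Qed.

Lemma bil3_0 (f g : 'I_3 -> R) : bil3 0 f g = 0.
Proof.
rewrite /bil3 big1// => a _; rewrite big1// => b _.
by rewrite mxE mulr0 mul0r.
Qed.

Lemma bil3_delta (x : R) (f g : 'I_3 -> R) : bil3 (x *: delta_mx 0 0) f g = x * (f 0 * g 0).
Proof. by rewrite /bil3 !sum3 !mxE/=; ring. Qed.

Lemma mulmx_delta (x : R) (y z : 'cV[R]_3) :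
  (y^T *m (x *: delta_mx 0 0) *m z) 0 0 = x * (y 0 0 * z 0 0).
Proof.
rewrite -(bil3_delta x (fun j => y j 0) (fun j => z j 0)) mxE /bil3 exchange_big/=.
apply: eq_bigr => b _; rewrite mxE mulr_suml; apply: eq_bigr => a _.
by rewrite [y^T _ _]mxE.
Qed.

(** On the scale [e ^+ 2] an element of the patch counts with weight [q l / 2]. The total weight
    cancels in all terms except the stiffness term: gradients differ between elements, and a
    weighted mean remains. *)
Lemma topological_case (b : bool) (sg := (if b then 1 else - 1) : R) :
  (forall e l, tri_patch k l ->
     lval k (phie e) l = v3 (sg * e) (phil phi k l 1) (phil phi k l 2%:R)) ->
  (forall l, tri_patch k l -> sg * phil phi k l 1 < 0 /\ sg * phil phi k l 2%:R < 0) ->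
  sg * phi (node k) <= 0 ->
  (\forall e \near 0^'+, area (symdiff (Omega T (phie e)) (Omega T phi)) =
     - sg * (area (Omega T (phie e)) - area (Omega T phi))) ->
  is_topshape_derivative P hat phi k (- sg *
    (c1 P + (lambda1 P - lambda2 P) *
     ((\sum_(l in tri_patch k)
         pku l * `|\det (Jl k l)| / (phil phi k l 1 * phil phi k l 2%:R))
      / (\sum_(l in tri_patch k)
         `|\det (Jl k l)| / (phil phi k l 1 * phil phi k l 2%:R)))
     + (alpha1 P - alpha2 P) * p k 0 * u k 0 - (fsrc1 P - fsrc2 P) * p k 0
     + c2 P * (talpha1 P - talpha2 P) * (u k 0 - uhat P k 0) ^+ 2)).
Proof.
move=> lE bc ak hS.
have sg2 : sg * sg = 1 by rewrite /sg; case: (b); rewrite ?mulrNN mulr1.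
pose q l := `|\det (Jl k l)| / (phil phi k l 1 * phil phi k l 2%:R).
pose m l : 'M[R]_3 := if tri_patch k l then (- sg * (q l / 2)) *: delta_mx 0 0 else 0.
have q0 l : tri_patch k l -> 0 < q l.
  move=> /bc[h1 h2]; rewrite /q divr_gt0//.
    by rewrite normr_gt0 det_Jmat det3_lnode.
  have : 0 < (sg * phil phi k l 1) * (sg * phil phi k l 2%:R) by rewrite nmulr_rgt0.
  by rewrite mulrACA sg2 mul1r.
pose S := \sum_(l in tri_patch k) q l.
have S0 : 0 < S.
  have [l kl] := exists_patch hT k.
  rewrite /S (bigD1 l)//= ltr_pwDl ?q0//; apply: sumr_ge0 => i /andP[/q0 qi _]; exact: ltW.
have sa : \sum_l bil3 (m l) one3 one3 = - sg * (S / 2).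
  rewrite /S mulr_suml mulr_sumr [RHS]big_mkcond/=; apply: eq_bigr => l _.
  rewrite /m; change (l \in tri_patch k) with (tri_patch k l).
  by case: ifP => _; [rewrite bil3_delta /one3 !mulr1|rewrite bil3_0].
have nS : - sg * \sum_l bil3 (m l) one3 one3 = S / 2.
  by rewrite sa mulrA mulrNN sg2 mul1r.
have hm l f g : (moment (ltri k l) (lval k (phie e) l) f g -
                 moment (ltri k l) (lval k phi l) f g) / e ^+ 2
    @[e --> 0^'+] --> bil3 (m l) f g.
  rewrite /m; case: ifPn => kl; last first.
    rewrite bil3_0; under eq_fun do rewrite (lval_perturb_out hT)// subrr mul0r.
    exact: cvg_cst.
  rewrite bil3_delta lval_phi; under eq_fun do rewrite lE//.
  have [b0 c0] := bc _ kl.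
  have a0 : sg * phil phi k l 0 <= 0 by rewrite /phil (lnode0 hT kl).
  rewrite -[- sg * _ * _]mulrA /q [\det _]det_Jmat.
  exact: (@local_topological _ b (ltri k l) _ _ _ f g (det3_lnode hT k l) a0 b0 c0).
have h0 : \forall e \near (0 : R)^'+, 0 < e ^+ 2.
  by near=> e; rewrite exprn_gt0//; near: e; exact: nbhs_right_gt.
have hl : e ^+ 2 @[e --> (0 : R)^'+] --> (0 : R).
  have : e * e @[e --> (0 : R)^'+] --> (0 * 0 : R).
    by apply: cvgM; apply: cvg_at_right_filter; exact: cvg_id.
  by rewrite mulr0; under eq_fun do rewrite -expr2.
have := general_derivative hT hP hhat Sphi hu hp (fun e => S1h_perturb hhat k e Sphi) h0 hl hm hS.
rewrite nS => /(_ (lt0r_neq0 (divr_gt0 S0 (ltr0n _ 2)))).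
rewrite sa /is_topshape_derivative.
have lock (y : 'cV[R]_(nnodes T)) l : tri_patch k l -> loc k l y 0 0 = y k 0.
  by move=> kl; rewrite mxE (lnode0 hT kl).
have quad (x y : 'cV[R]_(nnodes T)) : \sum_l ((loc k l x)^T *m m l *m loc k l y) 0 0 =
   - sg * (S / 2) * (x k 0 * y k 0).
  rewrite -sa mulr_suml; apply: eq_bigr => l _; rewrite /m; case: ifPn => kl.
    by rewrite mulmx_delta bil3_delta !lock// /one3 !mulr1.
  by rewrite bil3_0 mul0r mulmx0 mul0mx mxE.
have lin (x : 'cV[R]_(nnodes T)) :
   \sum_l ((loc k l x)^T *m m l *m (const_mx 1 : 'cV[R]_3)) 0 0 = - sg * (S / 2) * x k 0.
  rewrite -sa mulr_suml; apply: eq_bigr => l _; rewrite /m; case: ifPn => kl.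
    by rewrite mulmx_delta bil3_delta !lock// /one3 !mxE !mulr1.
  by rewrite bil3_0 mul0r mulmx0 mul0mx mxE.
have Ew : \sum_l ((loc k l u - loc k l (uhat P))^T *m m l *m (loc k l u - loc k l (uhat P))) 0 0 =
   - sg * (S / 2) * (u k 0 - uhat P k 0) ^+ 2.
  transitivity (\sum_l ((loc k l (u - uhat P))^T *m m l *m loc k l (u - uhat P)) 0 0).
    by apply: eq_bigr => l _; congr ((_^T *m _ *m _) 0 0); apply/colP => j; rewrite !mxE.
  by rewrite quad !mxE expr2.
have Ep : \sum_l pku l * bil3 (m l) one3 one3 = - sg / 2 * \sum_(l in tri_patch k)
         pku l * `|\det (Jl k l)| / (phil phi k l 1 * phil phi k l 2%:R).
  rewrite mulr_sumr [RHS]big_mkcond/=; apply: eq_bigr => l _.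
  rewrite /m; change (l \in tri_patch k) with (tri_patch k l).
  case: ifPn => kl; last by rewrite bil3_0 mulr0.
  by rewrite bil3_delta /one3 /q !mulr1; ring.
rewrite quad lin Ew Ep => lim; apply: cvg_to_eq lim _; rewrite -/S.
by field; rewrite gt_eqF.
Unshelve. all: by end_near. Qed.

Lemma Snodes_coef e : Snodes (T := T) phi k -> perturb_coef k e phi = e.
Proof.
by move=> Sk; rewrite /perturb_coef !ifN//; apply/negP => /set_mem h; apply: Sk; [right|left].
Qed.

Variable I : 'I_(ntris T) -> config.
Hypothesis hI : standing_assumption hat phi k I.

Lemma Snodes_lval e l : Snodes (T := T) phi k -> tri_patch k l ->
  lval k (phie e) l = v3 (phil phi k l 0 + e) (phil phi k l 1) (phil phi k l 2%:R).
Proof.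
by move=> Sk kl; apply: funext => j; rewrite (lval_perturb hT hhat)// Snodes_coef.
Qed.

Lemma Snodes_config l : Snodes (T := T) phi k -> l \in cut_elements hat phi k ->
  \forall e \near 0^'+, forall j,
    Num.sg (v3 (phil phi k l 0 + e) (phil phi k l 1) (phil phi k l 2%:R) j)
      = sign_pattern R (I l) j.
Proof.
move=> Sk lC; have [h1 _ _] := hI.
have kl : tri_patch k l by move: lC => /andP[].
have := h1 _ lC; rewrite /has_config; apply: filterS => e h j.
by rewrite -h -[perturb _ _ _ _ _]/(lval k (phie e) l j) Snodes_lval.
Qed.

(** Raising phi shrinks [Omega], so each [dka] is nonpositive and [dkatilde] is minus the total area
    derivative. Hence the sign of [c1]. *)
Lemma Snodes_case : Snodes (T := T) phi k -> dkatilde hat phi k I != 0 ->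
  let w l := loc k l u - loc k l (uhat P) in
  is_topshape_derivative P hat phi k
    (- c1 P
     + (lambda1 P - lambda2 P) * ((\sum_(l in cut_elements hat phi k) pku l * dka phi k I l)
                  / dkatilde hat phi k I)
     + (alpha1 P - alpha2 P) * ((\sum_(l in cut_elements hat phi k)
                    ((loc k l p)^T *m dkm phi k I l *m loc k l u) 0 0)
                 / dkatilde hat phi k I)
     - (fsrc1 P - fsrc2 P) * ((\sum_(l in cut_elements hat phi k)
                    ((loc k l p)^T *m dkf phi k I l) 0 0)
             / dkatilde hat phi k I)
     + c2 P * (talpha1 P - talpha2 P)
       * ((\sum_(l in cut_elements hat phi k) ((w l)^T *m dkm phi k I l *m w l) 0 0)
          / dkatilde hat phi k I)).
Proof.
move=> Sk D0 w; set C := cut_elements hat phi k.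
pose m l : 'M[R]_3 := if l \in C then dkm phi k I l else 0.
have CP l : l \in C -> tri_patch k l by move=> /andP[].
have reg l : l \in C -> config_regular (I l) (phil phi k l 0) (phil phi k l 1) (phil phi k l 2%:R).
  by move=> lC; apply: near_config_regular; exact: Snodes_config.
have hm l f g : (moment (ltri k l) (lval k (phie e) l) f g -
                 moment (ltri k l) (lval k phi l) f g) / e
    @[e --> 0^'+] --> bil3 (m l) f g.
  rewrite /m; case: ifPn => lC; last first.
    rewrite bil3_0; have : (fun=> 0 : R) e @[e --> (0 : R)^'+] --> (0 : R) by exact: cvg_cst.
    apply: cvg_trans; apply: near_eq_cvg.
    by have := uncut_moment hT hhat f g Sphi Sk lC; apply: filterS => e ->; rewrite subrr mul0r.
  have := local_derivative (f := f) (g := g) (det3_lnode hT k l) (Snodes_config Sk lC).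
  rewrite /rder addr0 -lval_phi.
  under eq_fun do rewrite -(Snodes_lval _ Sk (CP _ lC)).
  move=> lim; apply: cvg_to_eq lim _; rewrite /bil3 mulr_sumr; apply: eq_bigr => a _.
  rewrite mulr_sumr; apply: eq_bigr => b _; rewrite /dkm mxE [\det _]det_Jmat; ring.
have bil1 l : bil3 (m l) one3 one3 = if l \in C then dka phi k I l else 0.
  rewrite /m; case: ifPn => lC; last exact: bil3_0.
  rewrite /dka -(sum_fbar (reg _ lC)) /bil3 mulr_sumr; apply: eq_bigr => a _.
  rewrite -(sum_mbar _ (reg _ lC)) mulr_sumr; apply: eq_bigr => b _.
  by rewrite /one3 mul1r mulr1 mxE.
have dka0 l : l \in C -> dka phi k I l <= 0.
  move=> lC; have := hm l one3 one3; rewrite bil1 lC.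
  apply: cvg_le0_limit; near=> e; rewrite ler_pdivrMr ?mul0r ?subr_le0.
    apply: (moment_antitone (v := lval k phi l) _ (det3_lnode hT k l)) => j.
    have := Snodes_lval e Sk (CP _ lC) => ->; rewrite lval_phi; move: j.
    apply: forall3 => //=; rewrite lerDl; near: e; exact: nbhs_right_ge.
  by near: e; exact: nbhs_right_gt.
have sa : \sum_l bil3 (m l) one3 one3 = - dkatilde hat phi k I.
  rewrite /dkatilde -sumrN [RHS]big_mkcond; apply: eq_bigr => l _; rewrite bil1.
  by rewrite -/C; case: ifP => // lC; rewrite ler0_norm ?opprK// dka0.
have hS : \forall e \near 0^'+, area (symdiff (Omega T (phie e)) (Omega T phi)) =
     - 1 * (area (Omega T (phie e)) - area (Omega T phi)).
  by near=> e; apply: symdiff_ge; rewrite Snodes_coef//; near: e; exact: nbhs_right_ge.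
have h0 : \forall e \near (0 : R)^'+, 0 < e by exact: nbhs_right_gt.
have hl : e @[e --> (0 : R)^'+] --> (0 : R) by apply: cvg_at_right_filter; exact: cvg_id.
have := general_derivative hT hP hhat Sphi hu hp (fun e => S1h_perturb hhat k e Sphi) h0 hl hm hS.
rewrite sa mulrNN mul1r => /(_ D0) lim; apply: cvg_to_eq lim _.
have Ek : \sum_l pku l * bil3 (m l) one3 one3 = \sum_(l in C) pku l * dka phi k I l.
  by rewrite [RHS]big_mkcond; apply: eq_bigr => l _; rewrite bil1; case: ifP => // _; rewrite mulr0.
have Em (x : 'I_(ntris T) -> 'cV[R]_3) (y : 'I_(ntris T) -> 'cV[R]_3) :
   \sum_l ((x l)^T *m m l *m y l) 0 0 = \sum_(l in C) ((x l)^T *m dkm phi k I l *m y l) 0 0.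
  rewrite [RHS]big_mkcond; apply: eq_bigr => l _; rewrite /m.
  by case: ifP => // _; rewrite mulmx0 mul0mx mxE.
(* [dkf] consists of the row sums of [dkm], by the partition of unity. *)
have Ef : \sum_l ((loc k l p)^T *m m l *m (const_mx 1 : 'cV[R]_3)) 0 0 =
   \sum_(l in C) ((loc k l p)^T *m dkf phi k I l) 0 0.
  rewrite (Em (fun l => loc k l p) (fun=> const_mx 1)); apply: eq_bigr => l lC.
  rewrite -mulmxA; congr ((_ *m _) 0 0); apply/colP => a; rewrite mxE.
  rewrite [RHS]mxE -(sum_mbar _ (reg _ lC)) mulr_sumr; apply: eq_bigr => b _.
  by rewrite !mxE mulr1.
rewrite Ek Ef (Em (fun l => loc k l p) (fun l => loc k l u)) (Em w w).
by field.
Unshelve. all: by end_near. Qed.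

End Cases.

Section TopologicalNodes.
Variables (R : realType) (T : mesh R) (hat : 'I_(nnodes T) -> pt R -> R).
Hypotheses (hT : conforming_mesh T) (hhat : hat_basis hat).
Variables (phi : pt R -> R) (k : 'I_(nnodes T)) (I : 'I_(ntris T) -> config).
Hypothesis hI : standing_assumption hat phi k I.

Lemma one_ring_self : one_ring k k.
Proof.
have [l kl] := exists_patch hT k.
by have := lnode_one_ring hT 0 kl; rewrite (lnode0 hT kl).
Qed.

(** At x_k itself the patterns A^+ and A^- demand opposite signs. This matters because [perturb]
    tests [Tminus] before [Tplus]. *)
Lemma Tminus_Tplus_disjoint : Tminus (T := T) phi k -> Tplus (T := T) phi k -> False.
Proof.
have [_ hm hp] := hI => /hm km /hp kp; have [l kl] := exists_patch hT k.
apply: (@near_cst R); apply: filterS (filterI (km _ kl) (kp _ kl)) => e [h1 h2].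
have := h1 0; rewrite h2 /sign_pattern /config_sign/= => /eqP.
by rewrite eqNr oner_eq0.
Qed.

(** The perturbation leaves the vertices other than x_k alone, so their signs in the pattern are
    those of phi. *)
Lemma topological_config (b : bool) (sg := (if b then 1 else - 1) : R) l : tri_patch k l ->
  has_config hat phi k l (shA, b) ->
  sg * phil phi k l 1 < 0 /\ sg * phil phi k l 2%:R < 0.
Proof.
move=> kl hc; have neg (j : 'I_3) : j != 0 -> sg * phil phi k l j < 0.
  move=> j0; apply: near_cst; apply: filterS hc => e /(_ j) hj.
  apply: (sg_pattern b _).2; move: hj.
  rewrite (perturb_node hhat) /sign_pattern /config_sign/= (negbTE j0).
  have -> : (k == lnode k l j) = false.
    by rewrite -[X in X == _](lnode0 hT kl) (inj_eq (lnode_inj hT (l := l))) eq_sym (negbTE j0).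
  by rewrite mulr0 addr0.
by split; apply: neg.
Qed.

End TopologicalNodes.

Theorem theorem4p6 (R : realType) (T : mesh R) (P : problem R (nnodes T))
    (hat : 'I_(nnodes T) -> pt R -> R) (phi : pt R -> R)
    (u p : 'cV[R]_(nnodes T)) (k : 'I_(nnodes T))
    (I : 'I_(ntris T) -> config)
    (hT : conforming_mesh T) (hP : admissible P) (hhat : hat_basis hat)
    (hphi : S1h T phi)
    (hu : is_state P hat phi u) (hp : is_adjoint P hat phi u p)
    (hI : standing_assumption hat phi k I)
    (hden : Snodes phi k -> dkatilde hat phi k I != 0) :
  let Dlambda := lambda1 P - lambda2 P in
  let Dalpha := alpha1 P - alpha2 P in
  let Df := fsrc1 P - fsrc2 P in
  let Dtalpha := talpha1 P - talpha2 P in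
  let uk := u k 0 in
  let pk := p k 0 in
  let uhatk := uhat P k 0 in
  let C := cut_elements hat phi k in
  let pku l := ((loc k l p)^T *m k0 k l *m loc k l u) 0 0 in
  let w l := loc k l u - loc k l (uhat P) in
  [/\ Tminus phi k ->
      is_topshape_derivative P hat phi k
        (- c1 P
         - Dlambda
           * ((\sum_(l in tri_patch k)
                 pku l * `|\det (Jl k l)| / (phil phi k l 1 * phil phi k l 2%:R))
              / (\sum_(l in tri_patch k)
                 `|\det (Jl k l)| / (phil phi k l 1 * phil phi k l 2%:R)))
         - Dalpha * pk * uk + Df * pk
         - c2 P * Dtalpha * (uk - uhatk) ^+ 2),
      Tplus phi k ->
      is_topshape_derivative P hat phi k
        (c1 P
         + Dlambda
           * ((\sum_(l in tri_patch k)
                 pku l * `|\det (Jl k l)| / (phil phi k l 1 * phil phi k l 2%:R))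
              / (\sum_(l in tri_patch k)
                 `|\det (Jl k l)| / (phil phi k l 1 * phil phi k l 2%:R)))
         + Dalpha * pk * uk - Df * pk
         + c2 P * Dtalpha * (uk - uhatk) ^+ 2)
    & Snodes phi k ->
      is_topshape_derivative P hat phi k
        (- c1 P
         + Dlambda * ((\sum_(l in C) pku l * dka phi k I l)
                      / dkatilde hat phi k I)
         + Dalpha * ((\sum_(l in C)
                        ((loc k l p)^T *m dkm phi k I l *m loc k l u) 0 0)
                     / dkatilde hat phi k I)
         - Df * ((\sum_(l in C) ((loc k l p)^T *m dkf phi k I l) 0 0)
                 / dkatilde hat phi k I)
         + c2 P * Dtalpha
           * ((\sum_(l in C) ((w l)^T *m dkm phi k I l *m w l) 0 0)
              / dkatilde hat phi k I))].
Proof.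
move=> Dl Da Df Dt uk pk uhatk C pku w.
have [_ hm hp'] := hI.
split=> hk.
- have ce e : perturb_coef k e phi = e - phi (node k) by rewrite /perturb_coef mem_set.
  have pk0 : phi (node k) <= 0 by apply: hk; exact: one_ring_self.
  (* The perturbation overwrites the value at x_k by [e], whatever [phi (node k)] was. *)
  have lE e l : tri_patch k l ->
     lval k (perturb hat k e phi) l = v3 (1 * e) (phil phi k l 1) (phil phi k l 2%:R).
    move=> kl; apply: funext => j; rewrite (lval_perturb hT hhat)// ce mul1r.
    by rewrite {1}/lval (lnode0 hT kl) addrCA subrr addr0.
  have lim := topological_case hT hP hhat hphi hu hp (b := true) lE
    (fun l kl => topological_config hT hhat kl (hm hk l kl)).
  have hS : \forall e \near 0^'+, area (symdiff (Omega T (perturb hat k e phi)) (Omega T phi)) =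
      - 1 * (area (Omega T (perturb hat k e phi)) - area (Omega T phi)).
    near=> e; apply: (symdiff_ge hT hhat hphi); rewrite ce subr_ge0; apply: le_trans pk0 _.
    by near: e; exact: nbhs_right_ge.
  apply: cvg_to_eq (lim _ hS) _; first by rewrite mul1r.
  by rewrite /Dl /Da /Df /Dt /uk /pk /uhatk; ring.
- have nk : k \in Tminus (T := T) phi = false.
    by apply/negP => /set_mem km; exact: (Tminus_Tplus_disjoint hT hI km hk).
  have ce e : perturb_coef k e phi = - e - phi (node k) by rewrite /perturb_coef nk mem_set.
  have pk0 : 0 <= phi (node k) by apply: hk; exact: one_ring_self.
  have lE e l : tri_patch k l ->
     lval k (perturb hat k e phi) l = v3 (-1 * e) (phil phi k l 1) (phil phi k l 2%:R).
    move=> kl; apply: funext => j; rewrite (lval_perturb hT hhat)// ce mulN1r.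
    by rewrite {1}/lval (lnode0 hT kl) addrCA subrr addr0.
  have lim := topological_case hT hP hhat hphi hu hp (b := false) lE
    (fun l kl => topological_config hT hhat kl (hp' hk l kl)).
  have hS : \forall e \near 0^'+, area (symdiff (Omega T (perturb hat k e phi)) (Omega T phi)) =
      - - 1 * (area (Omega T (perturb hat k e phi)) - area (Omega T phi)).
    near=> e; rewrite opprK mul1r; apply: (symdiff_le hT hhat hphi).
    rewrite ce -opprD oppr_le0; apply: addr_ge0 => //.
  apply: cvg_to_eq (lim _ hS) _; first by rewrite mulN1r oppr_le0.
  by rewrite /Dl /Da /Df /Dt /uk /pk /uhatk; ring.
exact: (Snodes_case hT hP hhat hphi hu hp hI hk (hden hk)).
Unshelve. all: by end_near. Qed.
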